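(* Let $0<q<1$, $\mathcal{A}=\mathcal{O}(SU_q(2))$. Let $\pi$ be the model $\ast$-representation of $\mathcal{A}$ on $\mathcal{G}\oplus\mathcal{H}$, $\mathcal{H}=\bigoplus_{n\ge 0}\mathcal{H}_n$, determined by unitaries $v$ on $\mathcal{G}$ and $w$ on $\mathcal{H}_0$ (see context). Consider the following data. (a) A linear operator $T$ and a symmetric linear operator $R$ on $\mathcal{H}_0$ and a dense linear subspace $\mathcal{D}_0\subseteq \mathcal{D}(T)\cap\mathcal{D}(T^* )\cap\mathcal{D}(R)$ of $\mathcal{H}_0$ with $w\mathcal{D}_0=\mathcal{D}_0$ such that for all $\eta\in\mathcal{D}_0$ $$wTw^*\eta=qT\eta,\qquad w^2Rw^{*2}\eta+q^2R\eta=(1+q^2)wRw^*\eta .$$ (b) A symmetric linear operator $Q$ on $\mathcal{G}$ and a dense linear subspace $\mathcal{E}\subseteq\mathcal{D}(Q)$ of $\mathcal{G}$ with $v\mathcal{E}=\mathcal{E}$ such that for all $\eta\in\mathcal{E}$ $$v^2Qv^{*2}\eta+q^2Q\eta=(1+q^2)vQv^*\eta .$$ (c) A linear operator $F$ on $\mathcal{G}\oplus\mathcal{H}$ which has $\mathcal{D}_F:=\mathcal{E}\oplus\mathrm{Lin}\{\eta_n:\eta\in\mathcal{D}_0,n\in\mathbb{N}_0\}$ as a core and satisfies $$F\eta_n=\lambda_n(T\eta)_{n-1}+(w^nRw^{*n}\eta)_n+\lambda_{n+1}(T^*\eta)_{n+1}\quad(\eta\in\mathcal{D}_0,\ n\in\mathbb{N}_0),\qquad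 F\eta=Q\eta\quad(\eta\in\mathcal{E}),$$ where $\lambda_n=(1-q^{2n})^{1/2}$ and $(\cdot)_{-1}:=0$. Then every pair $(\pi,F)$ arising in this way is an admissible commutator representation of the $3D$-calculus on $SU_q(2)$. Conversely, up to unitary equivalence, any admissible commutator representation of the $3D$-calculus is of this form.
   Context: **The algebra.** $0<q<1$; $\mathcal{A}=\mathcal{O}(SU_q(2))$ is the Hopf $\ast$-algebra generated by $a,b,c,d$ with $ab=qba$, $ac=qca$, $bd=qdb$, $cd=qdc$, $bc=cb$, $ad-qbc=da-q^{-1}bc=1$; $\Delta(a)=a\otimes a+b\otimes c$, $\Delta(b)=a\otimes b+b\otimes d$, $\Delta(c)=c\otimes a+d\otimes c$, $\Delta(d)=c\otimes b+d\otimes d$; $\varepsilon(a)=\varepsilon(d)=1$, $\varepsilon(b)=\varepsilon(c)=0$; $S(a)=d$, $S(d)=a$, $S(b)=-q^{-1}b$, $S(c)=-qc$; $a^*=d$, $b^*=-qc$, $c^*=-q^{-1}b$, $d^*=a$. Sweedler notation: $\Delta(x)=x_{(1)}\otimes x_{(2)}$. **Differential calculi.** A first order differential calculus (FODC) over a unital $\ast$-algebra $\mathcal{A}$ is an $\mathcal{A}$-bimodule $\Gamma$ with a linear map $\mathrm{d}:\mathcal{A}\to\Gamma$ such that $\mathrm{d}(xy)=x\,\mathrm{d}y+\mathrm{d}x\,y$ and $\Gamma=\mathrm{Lin}\{x\,\mathrm{d}y\,z\}$. It is a $\ast$-FODC if it is equipped with an (antilinear) involution with $(x\,\mathrm{d}y\,z)^*=z^*\mathrm{d}(y^*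 )x^*$. A homomorphism of FODC $\Gamma_1\to\Gamma_2$ is a linear map $\rho$ with $\rho(x\,\mathrm{d}_1y\,z)=x\,\mathrm{d}_2y\,z$; for $\ast$-FODC one also requires $\rho(\omega^* )=\rho(\omega)^*$. An FODC over a Hopf algebra is left-covariant if there is a linear map $\varphi:\Gamma\to\mathcal{A}\otimes\Gamma$ with $\varphi(x\,\mathrm{d}y)=\Delta(x)(\mathrm{id}\otimes\mathrm{d})\Delta(y)$. Put $\omega_\Gamma(x)=S(x_{(1)})\mathrm{d}x_{(2)}$ and $\mathcal{R}_\Gamma=\{x\in\ker\varepsilon:\omega_\Gamma(x)=0\}$; this is a right ideal which determines $\Gamma$ up to isomorphism, and every right ideal contained in $\ker\varepsilon$ occurs. The $3D$-calculus is the left-covariant $\ast$-FODC over $\mathcal{O}(SU_q(2))$ whose right ideal is generated by $b^2,\ c^2,\ bc,\ (a-1)b,\ (a-1)c,\ q^2a+d-(q^2+1)$. **Commutator representations.** Let $\pi$ be a $\ast$-representation of $\mathcal{A}$ by bounded operators on a Hilbert space and $F$ a symmetric operator on that space with dense domain $\mathcal{D}(F)$; let $\mathcal{D}_F\subseteq\mathcal{D}(F)$ be a dense linear subspace with $\pi(\mathcal{A})\mathcal{D}_F\subseteq\mathcal{D}(F)$. $\Gamma_{\pi,F}$ is the span of the operators $\pi(x)(F\pi(y)-\pi(y)F)\pi(z)\lceil\mathcal{D}_F$ (restriction to $\mathcal{D}_F$), with bimodule structure given by multiplication by $\pi(x)$ from left and right, differential $\mathrm{d}_{\pi,F}(x)=(\mathrm{i}F\pi(x)-\pi(x)\mathrm{i}F)\lceil\mathcal{D}_F$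 and involution $\big(\sum_j\pi(x_j)(F\pi(y_j)-\pi(y_j)F)\pi(z_j)\lceil\mathcal{D}_F\big)^*=\sum_j\pi(z_j^* )(\pi(y_j^* )F-F\pi(y_j^* ))\pi(x_j^* )\lceil\mathcal{D}_F$; it is a $\ast$-FODC. $(\pi,F)$ is a commutator representation of a $\ast$-FODC $\Gamma$ if there is a $\ast$-FODC homomorphism $\rho:\Gamma\to\Gamma_{\pi,F}$. **Model for $\pi$.** Up to unitary equivalence every $\ast$-representation of $\mathcal{O}(SU_q(2))$ has the following form. Let $v,w$ be unitaries on Hilbert spaces $\mathcal{G}$, $\mathcal{H}_0$ (either may be $\{0\}$), $\mathcal{H}=\bigoplus_{n=0}^\infty\mathcal{H}_n$ with $\mathcal{H}_n=\mathcal{H}_0$; for $\eta\in\mathcal{H}_0$ let $\eta_n$ be the vector of $\mathcal{H}$ with $n$-th component $\eta$ and all others zero ($\eta_{-1}:=0$). On $\mathcal{G}$: $\pi(a)=v$, $\pi(d)=v^*$, $\pi(b)=\pi(c)=0$. On $\mathcal{H}$: $\pi(a)\eta_n=\lambda_n\eta_{n-1}$, $\pi(d)\eta_n=\lambda_{n+1}\eta_{n+1}$, $\pi(c)\eta_n=q^n(w\eta)_n$, $\pi(b)\eta_n=-q^{n+1}(w^*\eta)_n$, with $\lambda_n=(1-q^{2n})^{1/2}$. **Admissibility.** A commutator representation $(\pi,F)$ is admissible if there are linear subspaces $\mathcal{E}\subseteq\ker\pi(c)$ and $\mathcal{D}_0\subseteq\ker\pi(a)$ with $\pi(a)\mathcal{E}\subseteq\mathcal{E}$,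 $\pi(d)\mathcal{E}\subseteq\mathcal{E}$, $\pi(b)\mathcal{D}_0\subseteq\mathcal{D}_0$, $\pi(c)\mathcal{D}_0\subseteq\mathcal{D}_0$ such that $\mathcal{D}_F:=\mathcal{E}+\mathrm{Lin}\{\pi(d^n)\mathcal{D}_0:n\in\mathbb{N}_0\}$ is contained in $\mathcal{D}(F)$ and is a core for $F$; this $\mathcal{D}_F$ is the domain used in the commutator representation. In the model: $\mathcal{E}\subseteq\mathcal{G}$, $\mathcal{D}_0\subseteq\mathcal{H}_0$, $v\mathcal{E}=\mathcal{E}$, $w\mathcal{D}_0=\mathcal{D}_0$, and $\mathcal{E}\oplus\mathrm{Lin}\{\eta_n:\eta\in\mathcal{D}_0,n\in\mathbb{N}_0\}$ is a core for $F$. *)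

(* Defs.v *)
From HB Require Import structures.
From mathcomp Require Import all_boot all_order all_algebra.
From mathcomp Require Import complex sesquilinear.
From mathcomp Require Import boolp classical_sets functions reals.

Set Implicit Arguments.
Unset Strict Implicit.
Unset Printing Implicit Defensive.
Import Order.TTheory GRing.Theory Num.Theory Num.Def.
Local Open Scope classical_set_scope.
Local Open Scope quotient_scope.
Local Open Scope ring_scope.

Section Spans.
Variables (K : nzRingType) (V : lmodType K).

Definition subspace (D : set V) : Prop :=
  D 0 /\ forall (c : K) (x y : V), D x -> D y -> D (c *: x + y).

Definition lin (X : set V) : set V :=
  [set x | exists s : seq (K * V),
     (forall p, p \in s -> X p.2) /\ x = \sum_(p <- s) p.1 *: p.2].

End Spans.

Section Tensor.
Variables (K : comNzRingType) (U V : lmodType K).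

Definition bilin (W : lmodType K) (f : U -> V -> W) : Prop :=
  (forall v, linear (f ^~ v)) /\ (forall u, linear (f u)).

Definition fsum (W : lmodType K) (f : U -> V -> W) (s : seq (U * V)) : W :=
  \sum_(p <- s) f p.1 p.2.

(* The formal sum [:: (u1, v1); ...] stands for u1 (x) v1 + ...; two formal
   sums are identified when no bilinear map separates them. *)
Definition tensor_equiv (s t : seq (U * V)) : bool :=
  `[< forall (W : lmodType K) (f : U -> V -> W),
        bilin f -> fsum f s = fsum f t >].

Lemma tensor_equiv_refl : reflexive tensor_equiv.
Proof. by move=> s; apply/asboolP. Qed.

Lemma tensor_equiv_sym : symmetric tensor_equiv.
Proof.
by move=> s t; apply/asboolP/asboolP => h W f bf; rewrite (h W f bf).
Qed.

Lemma tensor_equiv_trans : transitive tensor_equiv.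
Proof.
move=> t s u /asboolP h1 /asboolP h2; apply/asboolP => W f bf.
by rewrite (h1 W f bf) (h2 W f bf).
Qed.

Canonical tensor_equivRel :=
  EquivRel tensor_equiv tensor_equiv_refl tensor_equiv_sym tensor_equiv_trans.

Definition tensor : Type := {eq_quot tensor_equiv}.

HB.instance Definition _ := Choice.on tensor.
HB.instance Definition _ := Quotient.on tensor.

(* For bilinear f, the linear map u (x) v |-> f u v. *)
Definition tlift (W : lmodType K) (f : U -> V -> W) (t : tensor) : W :=
  fsum f (repr t).

Lemma tlift_pi (W : lmodType K) (f : U -> V -> W) s :
  bilin f -> tlift f (\pi_tensor s) = fsum f s.
Proof.
move=> bf; rewrite /tlift.
have: (repr (\pi_tensor s) = s %[mod {eq_quot tensor_equiv}])%qT by rewrite reprK.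
by move/eqmodP/asboolP => /(_ W f bf).
Qed.

Lemma tensorP (x y : tensor) :
  (forall (W : lmodType K) (f : U -> V -> W), bilin f -> tlift f x = tlift f y)
  -> x = y.
Proof.
move=> h; rewrite -(reprK x) -(reprK y).
by apply/eqmodP/asboolP => W f bf; exact: h.
Qed.

Definition pure (u : U) (v : V) : tensor := \pi_tensor [:: (u, v)].

Definition tensor_zero : tensor := \pi_tensor [::].
Definition tensor_add (x y : tensor) : tensor := \pi_tensor (repr x ++ repr y).
Definition tensor_scale (c : K) (x : tensor) : tensor :=
  \pi_tensor [seq (c *: p.1, p.2) | p <- repr x].
Definition tensor_opp (x : tensor) : tensor := tensor_scale (-1) x.

Section Lift.
Variables (W : lmodType K) (f : U -> V -> W) (bf : bilin f).

Lemma tlift_pure u v : tlift f (pure u v) = f u v.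
Proof. by rewrite tlift_pi // /fsum big_seq1. Qed.

Lemma tlift_zero : tlift f tensor_zero = 0.
Proof. by rewrite tlift_pi // /fsum big_nil. Qed.

Lemma tlift_add x y : tlift f (tensor_add x y) = tlift f x + tlift f y.
Proof. by rewrite tlift_pi // /fsum big_cat. Qed.

Lemma tlift_scale c x : tlift f (tensor_scale c x) = c *: tlift f x.
Proof.
rewrite tlift_pi // /fsum big_map scaler_sumr; apply: eq_bigr => p _ /=.
have f0 : f 0 p.2 = 0.
  by have := bf.1 p.2 (-1) 0 0; rewrite scaler0 addr0 scaleN1r addNr.
by have := bf.1 p.2 c p.1 0; rewrite f0 !addr0.
Qed.

Lemma tlift_opp x : tlift f (tensor_opp x) = - tlift f x.
Proof. by rewrite tlift_scale scaleN1r. Qed.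

End Lift.

Let addA : associative tensor_add.
Proof.
by move=> x y z; apply: tensorP => W f bf; rewrite !(tlift_add bf) addrA.
Qed.
Let addC : commutative tensor_add.
Proof.
by move=> x y; apply: tensorP => W f bf; rewrite !(tlift_add bf) addrC.
Qed.
Let add0 : left_id tensor_zero tensor_add.
Proof.
by move=> x; apply: tensorP => W f bf; rewrite tlift_add// tlift_zero// add0r.
Qed.
Let addN : left_inverse tensor_zero tensor_opp tensor_add.
Proof.
move=> x; apply: tensorP => W f bf.
by rewrite tlift_add// tlift_opp// tlift_zero// addNr.
Qed.

HB.instance Definition _ := GRing.isZmodule.Build tensor addA addC add0 addN.

Let scaleA a b v : tensor_scale a (tensor_scale b v) = tensor_scale (a * b) v.
Proof.
by apply: tensorP => W f bf; rewrite !(tlift_scale bf) scalerA.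
Qed.
Let scale1 : left_id 1 tensor_scale.
Proof. by move=> x; apply: tensorP => W f bf; rewrite tlift_scale// scale1r. Qed.
Let scaleDr : right_distributive tensor_scale +%R.
Proof.
move=> c x y; apply: tensorP => W f bf.
by rewrite tlift_scale// !(tlift_add bf) !(tlift_scale bf) scalerDr.
Qed.
Let scaleDl v : {morph tensor_scale^~ v : a b / a + b}.
Proof.
move=> a b; apply: tensorP => W f bf.
by rewrite (tlift_add bf) !(tlift_scale bf) scalerDl.
Qed.

HB.instance Definition _ :=
  GRing.Zmodule_isLmodule.Build K tensor scaleA scale1 scaleDr scaleDl.

Lemma tlift_linear (W : lmodType K) (f : U -> V -> W) :
  bilin f -> linear (tlift f).
Proof. by move=> bf c x y; rewrite (tlift_add bf) (tlift_scale bf). Qed.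

Lemma pure_bilin : bilin pure.
Proof.
split=> [v|u] c x y; apply: tensorP => W f bf;
  rewrite (tlift_add bf) (tlift_scale bf) !(tlift_pure bf).
- exact: bf.1.
- exact: bf.2.
Qed.

Lemma tlift_sum (W : lmodType K) (f : U -> V -> W) (bf : bilin f) I (r : seq I) F :
  tlift f (\sum_(i <- r) F i) = \sum_(i <- r) tlift f (F i).
Proof.
by elim/big_rec2: _ => [|i y1 y2 _ <-];
  [exact: tlift_zero|exact: tlift_add].
Qed.

Lemma tensorE (x : tensor) : x = \sum_(p <- repr x) pure p.1 p.2.
Proof.
apply: tensorP => W f bf; rewrite tlift_sum //.
by apply: eq_bigr => p _; rewrite tlift_pure.
Qed.

Lemma tensor_ext (W : lmodType K) (f g : tensor -> W) :
  linear f -> linear g -> (forall u v, f (pure u v) = g (pure u v)) -> f =1 g.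
Proof.
move=> lf lg h x; rewrite (tensorE x).
have lin0 (k : tensor -> W) : linear k -> k 0 = 0.
  by move=> lk; have := lk (-1) 0 0; rewrite scaler0 addr0 scaleN1r addNr.
elim/big_rec: _ => [|i y _ e]; first by rewrite !lin0.
by have := lf 1 (pure i.1 i.2) y; have := lg 1 (pure i.1 i.2) y; rewrite !scale1r => -> ->; rewrite h e.
Qed.

End Tensor.

Section TwistedOpposite.
Variables (K : comNzRingType) (s : {rmorphism K -> K}) (B : algType K).

(* The opposite algebra of B, with scalars acting through s: an algebra map
   A -> twist s B is an s-semilinear anti-multiplicative map A -> B. *)
Definition twist (s' : {rmorphism K -> K}) (B' : Type) : Type := B'.
Local Notation T := (twist s B).

HB.instance Definition _ := GRing.Zmodule.on T.

Definition twist_mul (x y : T) : T := (y : B) * (x : B).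
Definition twist_scale (c : K) (x : T) : T := s c *: (x : B).

Let mulA : associative twist_mul.
Proof. by move=> x y z; rewrite /twist_mul mulrA. Qed.
Let mul1 : left_id (1 : B) twist_mul.
Proof. by move=> x; rewrite /twist_mul mulr1. Qed.
Let mulr1' : right_id (1 : B) twist_mul.
Proof. by move=> x; rewrite /twist_mul mul1r. Qed.
Let mulDl : left_distributive twist_mul +%R.
Proof. by move=> x y z; rewrite /twist_mul mulrDr. Qed.
Let mulDr : right_distributive twist_mul +%R.
Proof. by move=> x y z; rewrite /twist_mul mulrDl. Qed.
Let one0 : (1 : B) != 0 :> T. Proof. exact: oner_neq0. Qed.

HB.instance Definition _ :=
  GRing.Zmodule_isNzRing.Build T mulA mul1 mulr1' mulDl mulDr one0.

Let scaleA a b v : twist_scale a (twist_scale b v) = twist_scale (a * b) v.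
Proof. by rewrite /twist_scale rmorphM scalerA. Qed.
Let scale1 : left_id 1 twist_scale.
Proof. by move=> x; rewrite /twist_scale rmorph1 scale1r. Qed.
Let scaleDr : right_distributive twist_scale +%R.
Proof. by move=> c x y; rewrite /twist_scale scalerDr. Qed.
Let scaleDl v : {morph twist_scale^~ v : a b / a + b}.
Proof. by move=> a b; rewrite /twist_scale rmorphD scalerDl. Qed.

HB.instance Definition _ :=
  GRing.Zmodule_isLmodule.Build K T scaleA scale1 scaleDr scaleDl.

Let scaleAl (c : K) (x y : T) : c *: (x * y) = (c *: x) * y.
Proof.
by rewrite /GRing.scale /GRing.mul /= /twist_scale /twist_mul scalerAr.
Qed.
Let scaleAr (c : K) (x y : T) : c *: (x * y) = x * (c *: y).
Proof.
by rewrite /GRing.scale /GRing.mul /= /twist_scale /twist_mul scalerAl.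
Qed.

HB.instance Definition _ := GRing.Lmodule_isLalgebra.Build K T scaleAl.
HB.instance Definition _ := GRing.Lalgebra_isAlgebra.Build K T scaleAr.

End TwistedOpposite.

Inductive qterm (C : Type) : Type :=
  | Ta | Tb | Tc | Td
  | Tscal of C
  | Tadd of qterm C & qterm C
  | Tmul of qterm C & qterm C.
Arguments Ta {C}. Arguments Tb {C}. Arguments Tc {C}. Arguments Td {C}.

HB.instance Definition _ (C : Type) := gen_eqMixin (qterm C).
HB.instance Definition _ (C : Type) := gen_choiceMixin (qterm C).

Fixpoint qeval (K : comNzRingType) (B : algType K) (a b c d : B)
    (t : qterm K) : B :=
  match t with
  | Ta => a | Tb => b | Tc => c | Td => d
  | Tscal z => z%:A
  | Tadd t u => qeval a b c d t + qeval a b c d u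
  | Tmul t u => qeval a b c d t * qeval a b c d u
  end.

Record qrel (K : fieldType) (q : K) (B : algType K) (a b c d : B) : Prop := {
  qrel_ab : a * b = q *: (b * a);
  qrel_ac : a * c = q *: (c * a);
  qrel_bd : b * d = q *: (d * b);
  qrel_cd : c * d = q *: (d * c);
  qrel_bc : b * c = c * b;
  qrel_det : a * d - q *: (b * c) = 1;
  qrel_det' : d * a - q^-1 *: (b * c) = 1
}.

Section Presented.
Variables (K : fieldType) (q : K).

(* Two noncommutative polynomials in a, b, c, d are identified when they agree
   in every algebra in which the relations hold, i.e. modulo the two-sided
   ideal generated by the relations. *)
Definition qequiv (t u : qterm K) : bool :=
  `[< forall (B : algType K) (a b c d : B), qrel q a b c d ->
        qeval a b c d t = qeval a b c d u >].

Lemma qequiv_refl : reflexive qequiv.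
Proof. by move=> t; apply/asboolP. Qed.

Lemma qequiv_sym : symmetric qequiv.
Proof.
by move=> t u; apply/asboolP/asboolP => h B a b c d r; rewrite (h B a b c d r).
Qed.

Lemma qequiv_trans : transitive qequiv.
Proof.
move=> t s u /asboolP h1 /asboolP h2; apply/asboolP => B a b c d r.
by rewrite (h1 B a b c d r) (h2 B a b c d r).
Qed.

Canonical qequivRel := EquivRel qequiv qequiv_refl qequiv_sym qequiv_trans.

Definition OSU : Type := {eq_quot qequiv}.
HB.instance Definition _ := Choice.on OSU.
HB.instance Definition _ := Quotient.on OSU.

(* For a, b, c, d satisfying the relations, the algebra homomorphism which maps
   the generators of OSU to a, b, c, d. *)
Definition qlift (B : algType K) (a b c d : B) (x : OSU) : B :=
  qeval a b c d (repr x).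

Lemma qlift_pi (B : algType K) (a b c d : B) t :
  qrel q a b c d -> qlift a b c d (\pi_OSU t) = qeval a b c d t.
Proof.
move=> r; rewrite /qlift.
have: (repr (\pi_OSU t) = t %[mod {eq_quot qequiv}])%qT by rewrite reprK.
by move/eqmodP/asboolP => /(_ B a b c d r).
Qed.

Lemma OSU_P (x y : OSU) :
  (forall (B : algType K) (a b c d : B), qrel q a b c d ->
     qlift a b c d x = qlift a b c d y) -> x = y.
Proof.
move=> h; rewrite -(reprK x) -(reprK y).
by apply/eqmodP/asboolP => B a b c d r; exact: h.
Qed.

Definition ua : OSU := \pi_OSU Ta.
Definition ub : OSU := \pi_OSU Tb.
Definition uc : OSU := \pi_OSU Tc.
Definition ud : OSU := \pi_OSU Td.

Definition OSU_zero : OSU := \pi_OSU (Tscal 0).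
Definition OSU_one : OSU := \pi_OSU (Tscal 1).
Definition OSU_add (x y : OSU) : OSU := \pi_OSU (Tadd (repr x) (repr y)).
Definition OSU_mul (x y : OSU) : OSU := \pi_OSU (Tmul (repr x) (repr y)).
Definition OSU_scale (z : K) (x : OSU) : OSU :=
  \pi_OSU (Tmul (Tscal z) (repr x)).
Definition OSU_opp (x : OSU) : OSU := OSU_scale (-1) x.

Section Lift.
Variables (B : algType K) (a b c d : B) (r : qrel q a b c d).
Local Notation f := (qlift a b c d).

Lemma qlift_zero : f OSU_zero = 0.
Proof. by rewrite qlift_pi //= scale0r. Qed.
Lemma qlift_one : f OSU_one = 1.
Proof. by rewrite qlift_pi //= scale1r. Qed.
Lemma qlift_add x y : f (OSU_add x y) = f x + f y.
Proof. by rewrite qlift_pi. Qed.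
Lemma qlift_mul x y : f (OSU_mul x y) = f x * f y.
Proof. by rewrite qlift_pi. Qed.
Lemma qlift_scale z x : f (OSU_scale z x) = z *: f x.
Proof. by rewrite qlift_pi //= mulr_algl. Qed.
Lemma qlift_opp x : f (OSU_opp x) = - f x.
Proof. by rewrite qlift_scale scaleN1r. Qed.
Lemma qlift_a : f ua = a. Proof. by rewrite qlift_pi. Qed.
Lemma qlift_b : f ub = b. Proof. by rewrite qlift_pi. Qed.
Lemma qlift_c : f uc = c. Proof. by rewrite qlift_pi. Qed.
Lemma qlift_d : f ud = d. Proof. by rewrite qlift_pi. Qed.
End Lift.

Lemma qrel_counit : @qrel K q K^o 1 0 0 1.
Proof.
by split; rewrite ?(mulr0, mul0r, scaler0, subr0, mulr1).
Qed.

Local Ltac osu :=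
  move=> *; apply: OSU_P => *;
  do ?[rewrite qlift_zero //|rewrite qlift_one //|rewrite qlift_add //
      |rewrite qlift_mul //|rewrite qlift_opp //|rewrite qlift_scale //].

Let addA : associative OSU_add. Proof. by osu; rewrite addrA. Qed.
Let addC : commutative OSU_add. Proof. by osu; rewrite addrC. Qed.
Let add0 : left_id OSU_zero OSU_add. Proof. by osu; rewrite add0r. Qed.
Let addN : left_inverse OSU_zero OSU_opp OSU_add.
Proof. by osu; rewrite addNr. Qed.

HB.instance Definition _ := GRing.isZmodule.Build OSU addA addC add0 addN.

Let mulA : associative OSU_mul. Proof. by osu; rewrite mulrA. Qed.
Let mul1 : left_id OSU_one OSU_mul. Proof. by osu; rewrite mul1r. Qed.
Let mulr1' : right_id OSU_one OSU_mul. Proof. by osu; rewrite mulr1. Qed.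
Let mulDl : left_distributive OSU_mul OSU_add.
Proof. by osu; rewrite mulrDl. Qed.
Let mulDr : right_distributive OSU_mul OSU_add.
Proof. by osu; rewrite mulrDr. Qed.
Let one0 : OSU_one != OSU_zero.
Proof.
apply/eqP => e; have := qlift_one qrel_counit.
by rewrite e (qlift_zero qrel_counit) => /eqP; rewrite eq_sym oner_eq0.
Qed.

HB.instance Definition _ :=
  GRing.Zmodule_isNzRing.Build OSU mulA mul1 mulr1' mulDl mulDr one0.

Let scaleA a b v : OSU_scale a (OSU_scale b v) = OSU_scale (a * b) v.
Proof. by osu; rewrite scalerA. Qed.
Let scale1 : left_id 1 OSU_scale. Proof. by osu; rewrite scale1r. Qed.
Let scaleDr : right_distributive OSU_scale OSU_add.
Proof. by osu; rewrite scalerDr. Qed.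
Let scaleDl v : {morph OSU_scale^~ v : a b / a + b >-> OSU_add a b}.
Proof. by osu; rewrite scalerDl. Qed.

HB.instance Definition _ :=
  GRing.Zmodule_isLmodule.Build K OSU scaleA scale1 scaleDr scaleDl.

Let scaleAl z x y : OSU_scale z (OSU_mul x y) = OSU_mul (OSU_scale z x) y.
Proof. by osu; rewrite scalerAl. Qed.
Let scaleAr z x y : OSU_scale z (OSU_mul x y) = OSU_mul x (OSU_scale z y).
Proof. by osu; rewrite scalerAr. Qed.

HB.instance Definition _ := GRing.Lmodule_isLalgebra.Build K OSU scaleAl.
HB.instance Definition _ := GRing.Lalgebra_isAlgebra.Build K OSU scaleAr.

Lemma qrel_gen : qrel q ua ub uc ud.
Proof.
by split; apply: OSU_P => B a b c d r;
  do ?rewrite ?(qlift_add r, qlift_opp r, qlift_scale r, qlift_mul r,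
             qlift_one r, qlift_a r, qlift_b r, qlift_c r, qlift_d r); case: r.
Qed.

Section LiftMorphism.
Variables (B : algType K) (a b c d : B) (r : qrel q a b c d).
Local Notation f := (qlift a b c d).

Lemma qliftP : [/\ linear f, f 1 = 1 & {morph f : x y / x * y}].
Proof.
split=> [z x y||x y].
- by rewrite (qlift_add r) (qlift_scale r).
- exact: qlift_one.
- exact: qlift_mul.
Qed.

End LiftMorphism.

Lemma OSU_ind (P : OSU -> Prop) :
  P ua -> P ub -> P uc -> P ud -> (forall z : K, P z%:A) ->
  (forall x y, P x -> P y -> P (x + y)) ->
  (forall x y, P x -> P y -> P (x * y)) -> forall x, P x.
Proof.
move=> Pa Pb Pc Pd Pz PD PM x; rewrite -(reprK x).
have pi_scal z : \pi_OSU (Tscal z) = z%:A.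
  by apply: OSU_P => B a b c d r; rewrite (qlift_scale r) (qlift_one r) qlift_pi.
have pi_add t u : \pi_OSU (Tadd t u) = \pi_OSU t + \pi_OSU u.
  by apply: OSU_P => B a b c d r; rewrite (qlift_add r) !qlift_pi.
have pi_mul t u : \pi_OSU (Tmul t u) = \pi_OSU t * \pi_OSU u.
  by apply: OSU_P => B a b c d r; rewrite (qlift_mul r) !qlift_pi.
elim: (repr x) => //= [z|t IHt u IHu|t IHt u IHu].
- by rewrite pi_scal.
- by rewrite pi_add; apply: PD.
- by rewrite pi_mul; apply: PM.
Qed.

End Presented.

Section TensorSquare.
Variables (K : fieldType) (q : K).
Local Notation A := (OSU q).

Definition OSU2 : Type := tensor A A.
HB.instance Definition _ := GRing.Lmodule.on OSU2.

Definition tmul (s t : OSU2) : OSU2 :=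
  tlift (fun x y => tlift (fun x' y' => pure (x * x') (y * y')) t) s.

Lemma tmul_bilin_in (x y : A) :
  bilin (fun x' y' => pure (x * x') (y * y') : OSU2).
Proof.
by split=> [v|u] c s t; rewrite mulrDr -scalerAr; apply pure_bilin.
Qed.

Lemma tmul_bilin_out (t : OSU2) :
  bilin (fun x y => tlift (fun x' y' => pure (x * x') (y * y') : OSU2) t).
Proof.
split=> [v|u] c x y; rewrite (tensorE t) !(tlift_sum (tmul_bilin_in _ _));
  rewrite scaler_sumr -big_split /=; apply: eq_bigr => p _;
  rewrite !(tlift_pure (tmul_bilin_in _ _)) mulrDl -scalerAl; apply pure_bilin.
Qed.

Lemma tmul_linl (t : OSU2) : linear (tmul^~ t).
Proof. exact: tlift_linear (tmul_bilin_out t). Qed.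

Lemma tmul_linr (s : OSU2) : linear (tmul s).
Proof.
move=> c x y; rewrite /tmul /tlift /fsum scaler_sumr -big_split /=.
by apply: eq_bigr => p _; exact: (tlift_linear (tmul_bilin_in _ _)).
Qed.

Lemma tmul_pure (x y x' y' : A) :
  tmul (pure x y) (pure x' y') = pure (x * x') (y * y').
Proof.
by rewrite /tmul (tlift_pure (tmul_bilin_out _)) (tlift_pure (tmul_bilin_in _ _)).
Qed.

Definition tone : OSU2 := pure 1 1.

Let tmulDl : left_distributive tmul +%R.
Proof. by move=> x y z; have := tmul_linl z 1 x y; rewrite !scale1r. Qed.
Let tmulDr : right_distributive tmul +%R.
Proof. by move=> x y z; have := tmul_linr x 1 y z; rewrite !scale1r. Qed.
Let tmul0l t : tmul 0 t = 0.
Proof. by have := tmul_linl t (-1) 0 0; rewrite scaler0 addr0 scaleN1r addNr. Qed.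
Let tmul0r t : tmul t 0 = 0.
Proof. by have := tmul_linr t (-1) 0 0; rewrite scaler0 addr0 scaleN1r addNr. Qed.
Let scaleAl c x y : c *: tmul x y = tmul (c *: x) y.
Proof. by have := tmul_linl y c x 0; rewrite !addr0 tmul0l addr0. Qed.
Let scaleAr c x y : c *: tmul x y = tmul x (c *: y).
Proof. by have := tmul_linr x c y 0; rewrite !addr0 tmul0r addr0. Qed.
Let tmul1 : left_id tone tmul.
Proof.
apply: (tensor_ext (tmul_linr tone)) => [c x y //|u v].
by rewrite tmul_pure !mul1r.
Qed.
Let tmulr1 : right_id tone tmul.
Proof.
apply: (tensor_ext (tmul_linl tone)) => [c x y //|u v].
by rewrite tmul_pure !mulr1.
Qed.
Let tmulA : associative tmul.
Proof.
move=> x y z.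
apply: (@tensor_ext _ _ _ _ (tmul^~ (tmul y z)) (fun x => tmul (tmul x y) z)).
- exact: tmul_linl.
- by move=> c s t; rewrite tmul_linl tmul_linl.
move=> u v.
apply: (@tensor_ext _ _ _ _ (fun y => tmul (pure u v) (tmul y z))
                            (fun y => tmul (tmul (pure u v) y) z)).
- by move=> c s t; rewrite tmul_linl tmul_linr.
- by move=> c s t; rewrite tmul_linr tmul_linl.
move=> u' v'.
apply: (@tensor_ext _ _ _ _ (fun z => tmul (pure u v) (tmul (pure u' v') z))
                            (tmul (tmul (pure u v) (pure u' v')))).
- by move=> c s t; rewrite !tmul_linr.
- exact: tmul_linr.
by move=> u'' v''; rewrite !tmul_pure !mulrA.
Qed.
Let tone0 : tone != 0.
Proof.
have r := qrel_counit q.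
have [le1 e1 _] := qliftP r.
set e := qlift (1 : K^o) 0 0 1 in le1 e1.
have bf : bilin (fun x y => e x * e y : K^o).
  split=> [v|u] c x y; rewrite le1.
  - by rewrite mulrDl -scalerAl.
  - by rewrite mulrDr -scalerAr.
apply/eqP => h; have := tlift_pure bf 1 1.
rewrite -/tone h (tlift_zero bf : tlift _ 0 = 0) e1 mulr1 => /eqP.
by rewrite eq_sym oner_eq0.
Qed.

HB.instance Definition _ :=
  GRing.Zmodule_isNzRing.Build OSU2 tmulA tmul1 tmulr1 tmulDl tmulDr tone0.
HB.instance Definition _ := GRing.Lmodule_isLalgebra.Build K OSU2 scaleAl.
HB.instance Definition _ := GRing.Lalgebra_isAlgebra.Build K OSU2 scaleAr.

End TensorSquare.

Lemma qrel_twist (K : fieldType) (q : K) (s : {rmorphism K -> K}) (B : algType K)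
    (a b c d : B) : s q = q ->
  b * a = q *: (a * b) -> c * a = q *: (a * c) -> d * b = q *: (b * d) ->
  d * c = q *: (c * d) -> c * b = b * c -> d * a - q *: (c * b) = 1 ->
  a * d - q^-1 *: (c * b) = 1 -> qrel q (a : twist s B) b c d.
Proof.
move=> sq *.
by split=> //; rewrite /GRing.scale /= /twist_scale ?fmorphV sq.
Qed.

Section HopfStructure.
Variables (K : fieldType) (q : K).
Local Notation A := (OSU q).
Local Notation a := (ua q).
Local Notation b := (ub q).
Local Notation c := (uc q).
Local Notation d := (ud q).
Local Notation "x ⊗ y" := (pure x y : OSU2 q) (at level 35).

Definition coproduct : A -> OSU2 q :=
  qlift (a ⊗ a + b ⊗ c) (a ⊗ b + b ⊗ d) (c ⊗ a + d ⊗ c) (c ⊗ b + d ⊗ d).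

Definition counit : A -> K := qlift (1 : K^o) 0 0 1.

Definition antipode : A -> A :=
  qlift (d : twist idfun A) (- q^-1 *: b) (- q *: c) a.

Lemma qrel_coproduct : q != 0 ->
  qrel q (a ⊗ a + b ⊗ c) (a ⊗ b + b ⊗ d) (c ⊗ a + d ⊗ c) (c ⊗ b + d ⊗ d).
Proof.
move=> q0.
have ab : a * b = q *: (b * a) by case: (qrel_gen q).
have ac : a * c = q *: (c * a) by case: (qrel_gen q).
have bd : b * d = q *: (d * b) by case: (qrel_gen q).
have cd : c * d = q *: (d * c) by case: (qrel_gen q).
have cb : c * b = b * c by case: (qrel_gen q).
have ad : a * d = 1 + q *: (b * c).
  by have <- := qrel_det (qrel_gen q); rewrite subrK.
have da : d * a = 1 + q^-1 *: (b * c).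
  by have <- := qrel_det' (qrel_gen q); rewrite subrK.
have PM (x y x' y' : A) : (x ⊗ y) * (x' ⊗ y') = (x * x') ⊗ (y * y').
  exact: tmul_pure.
have PDl (x x' y : A) : (x + x') ⊗ y = x ⊗ y + x' ⊗ y.
  by have := (pure_bilin _ _).1 y 1 x x'; rewrite !scale1r.
have PDr (x y y' : A) : x ⊗ (y + y') = x ⊗ y + x ⊗ y'.
  by have := (pure_bilin _ _).2 x 1 y y'; rewrite !scale1r.
have P0l (y : A) : (0 : A) ⊗ y = 0.
  by apply: (addrI ((0 : A) ⊗ y)); rewrite -PDl !addr0.
have P0r (x : A) : x ⊗ (0 : A) = 0.
  by apply: (addrI (x ⊗ (0 : A))); rewrite -PDr !addr0.
have PZl z (x y : A) : (z *: x) ⊗ y = z *: (x ⊗ y).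
  by have := (pure_bilin _ _).1 y z x 0; rewrite P0l !addr0.
have PZr z (x y : A) : x ⊗ (z *: y) = z *: (x ⊗ y).
  by have := (pure_bilin _ _).2 x z y 0; rewrite P0r !addr0.
have expand := (mulrDl, mulrDr, PM, ab, ac, bd, cd, cb, ad, da, PDl, PDr,
                PZl, PZr, scalerDr, scalerA, mulfV q0, mulVf q0, scale1r).
have one : 1 = 1 ⊗ 1 :> OSU2 q by [].
split; try (apply/eqP; rewrite subr_eq; apply/eqP);
  rewrite ?one !expand -?addrA.
- by congr (_ + _); rewrite addrCA.
- by congr (_ + _); rewrite addrCA.
- by congr (_ + _); rewrite addrCA.
- by congr (_ + _); rewrite addrCA.
- by congr (_ + _); rewrite addrCA [RHS]addrCA; congr (_ + _); rewrite addrCA.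
- by rewrite addrCA; do 3 congr (_ + _); rewrite addrCA.
- rewrite [RHS]addrCA; congr (_ + _); rewrite addrCA; congr (_ + _).
  by rewrite addrCA.
Qed.

Lemma qrel_antipode : q != 0 ->
  qrel q (d : twist idfun A) (- q^-1 *: b) (- q *: c) a.
Proof.
move=> q0; have [ab ac bd cd bc det det'] := qrel_gen q.
apply: qrel_twist => //.
- by rewrite -scalerAl -scalerAr bd !scalerA mulrC.
- by rewrite -scalerAl -scalerAr cd !scalerA mulrC.
- by rewrite -scalerAl -scalerAr ab !scalerA mulrC.
- by rewrite -scalerAl -scalerAr ac !scalerA mulrC.
- by rewrite -!scalerAl -!scalerAr !scalerA bc mulrC.
- rewrite -scalerAl -scalerAr !scalerA !(mulrN, mulNr) opprK mulfK// -bc; exact: det.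
- rewrite -scalerAl -scalerAr !scalerA !(mulrN, mulNr) opprK mulVf// mul1r -bc.
  exact: det'.
Qed.

End HopfStructure.

Record starAlgType (C : numClosedFieldType) := StarAlg {
  star_sort :> algType C;
  star : star_sort -> star_sort;
  starD : forall (z : C) x y, star (z *: x + y) = z^* *: star x + star y;
  starM : forall x y, star (x * y) = star y * star x;
  starK : involutive star
}.

Section StarStructure.
Variables (C : numClosedFieldType) (q : C) (q0 : q != 0) (qR : q^* = q).
Local Notation A := (OSU q).
Local Notation a := (ua q).
Local Notation b := (ub q).
Local Notation c := (uc q).
Local Notation d := (ud q).

Definition OSU_star : A -> A :=
  qlift (d : twist Num.conj A) (- q *: c) (- q^-1 *: b) a.

Lemma qrel_star : qrel q (d : twist Num.conj A) (- q *: c) (- q^-1 *: b) a.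
Proof.
have [ab ac bd cd bc det det'] := qrel_gen q.
apply: qrel_twist => //.
- by rewrite -scalerAl -scalerAr cd !scalerA mulrC.
- by rewrite -scalerAl -scalerAr bd !scalerA mulrC.
- by rewrite -scalerAl -scalerAr ac !scalerA mulrC.
- by rewrite -scalerAl -scalerAr ab !scalerA mulrC.
- by rewrite -!scalerAl -!scalerAr !scalerA bc mulrC.
- rewrite -scalerAl -scalerAr !scalerA !(mulrN, mulNr) opprK divff// mul1r; exact: det.
- rewrite -scalerAl -scalerAr !scalerA !(mulrN, mulNr) opprK mulfVK//; exact: det'.
Qed.

Lemma OSU_starD (z : C) (x y : A) :
  OSU_star (z *: x + y) = z^* *: OSU_star x + OSU_star y.
Proof. by have [+ _ _] := qliftP qrel_star; apply. Qed.

Lemma OSU_starM (x y : A) : OSU_star (x * y) = OSU_star y * OSU_star x.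
Proof. by have [_ _] := qliftP qrel_star; apply. Qed.

Lemma OSU_starK : involutive OSU_star.
Proof.
have s1 : OSU_star 1 = 1 by have [_ + _] := qliftP qrel_star.
have s0 : OSU_star 0 = 0.
  by have := OSU_starD (-1) 0 0; rewrite !scaler0 addr0 rmorphN1 scaleN1r addNr.
have sZ z x : OSU_star (z *: x) = z^* *: OSU_star x.
  by have := OSU_starD z x 0; rewrite s0 !addr0.
have sD x y : OSU_star (x + y) = OSU_star x + OSU_star y.
  by have := OSU_starD 1 x y; rewrite rmorph1 !scale1r.
have sa : OSU_star a = d by apply: (qlift_a qrel_star).
have sb : OSU_star b = - q *: c by apply: (qlift_b qrel_star).
have sc : OSU_star c = - q^-1 *: b by apply: (qlift_c qrel_star).
have sd : OSU_star d = a by apply: (qlift_d qrel_star).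
have qN : (- q)^* = - q by rewrite rmorphN /= qR.
have qVN : (- q^-1)^* = - q^-1 by rewrite rmorphN /= fmorphV /= qR.
apply: OSU_ind => [|||||x y ex ey|x y ex ey].
- by rewrite sa sd.
- by rewrite sb sZ sc qN scalerA mulrNN divff// scale1r.
- by rewrite sc sZ sb qVN scalerA mulrNN mulVf// scale1r.
- by rewrite sd sa.
- by move=> z; rewrite !sZ !s1 conjCK.
- by rewrite !sD ex ey.
- by rewrite !OSU_starM ex ey.
Qed.

Definition OSU_starAlg : starAlgType C :=
  StarAlg OSU_starD OSU_starM OSU_starK.

End StarStructure.

(* A bimodule Gamma over A: lact x w is x w, ract w x is w x. *)
Record fodc (K : fieldType) (A : algType K) := Fodc {
  fodc_sort :> lmodType K;
  lact : A -> fodc_sort -> fodc_sort;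
  ract : fodc_sort -> A -> fodc_sort;
  diff : A -> fodc_sort;
  lact_bilin : bilin lact;
  ract_bilin : bilin ract;
  diff_linear : linear diff;
  lact1 : forall w, lact 1 w = w;
  ract1 : forall w, ract w 1 = w;
  lactM : forall x y w, lact (x * y) w = lact x (lact y w);
  ractM : forall w x y, ract w (x * y) = ract (ract w x) y;
  lractA : forall x w y, ract (lact x w) y = lact x (ract w y);
  diffM : forall x y, diff (x * y) = lact x (diff y) + ract (diff x) y;
  diff_span : forall w, exists s : seq (A * A * A),
    w = \sum_(p <- s) lact p.1.1 (ract (diff p.1.2) p.2)
}.

Record star_fodc (C : numClosedFieldType) (A : starAlgType C) := StarFodc {
  star_fodc_sort :> fodc A;
  invol : star_fodc_sort -> star_fodc_sort;
  involD : forall (z : C) v w, invol (z *: v + w) = z^* *: invol v + invol w;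
  involK : involutive invol;
  invol_diff : forall x y z : A,
    invol (lact x (ract (diff star_fodc_sort y) z)) =
    lact (star z) (ract (diff star_fodc_sort (star y)) (star x))
}.

Definition star_fodc_hom (C : numClosedFieldType) (A : starAlgType C)
    (G1 G2 : star_fodc A) (rho : G1 -> G2) : Prop :=
  [/\ linear rho,
      forall x y z : A, rho (lact x (ract (diff G1 y) z)) =
                        lact x (ract (diff G2 y) z)
    & forall w, rho (invol w) = invol (rho w)].

Section LeftCovariance.
Variables (K : fieldType) (q : K) (G : fodc (OSU q)).
Local Notation A := (OSU q).

Definition id_tensor_diff : OSU2 q -> tensor A G :=
  tlift (fun x y => pure x (diff G y)).

Definition OSU2_act (s : OSU2 q) (t : tensor A G) : tensor A G :=
  tlift (fun x y => tlift (fun x' w => pure (x * x') (lact y w)) t) s.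

Definition left_covariant : Prop :=
  exists phi : G -> tensor A G, linear phi /\
    forall x y : A, phi (lact x (diff G y)) =
                    OSU2_act (coproduct x) (id_tensor_diff (coproduct y)).

(* S(x_(1)) d x_(2) *)
Definition omega : A -> G :=
  fun x => tlift (fun x1 x2 => lact (antipode x1) (diff G x2)) (coproduct x).

Definition Rideal : set A := [set x | counit x = 0 /\ omega x = 0].

Definition right_ideal_gen (gs : seq A) : set A :=
  [set x | exists y : nat -> A, x = \sum_(i < size gs) gs`_i * y i].

Definition is_3D : Prop :=
  left_covariant /\
  Rideal = right_ideal_gen
    [:: ub q ^+ 2; uc q ^+ 2; ub q * uc q;
        (ua q - 1) * ub q; (ua q - 1) * uc q;
        q ^+ 2 *: ua q + ud q - (q ^+ 2 + 1)%:A].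

End LeftCovariance.

(* A Hilbert space over R[i]; the inner product is linear in its first argument
   and every Cauchy sequence converges for the norm sqrtC (inner x x). *)
Record hilbert (R : realType) := Hilbert {
  hilbert_sort :> lmodType R[i];
  inner : {dot hilbert_sort for Num.conj};
  hilbert_complete : forall u : nat -> hilbert_sort,
    let norm x := sqrtC (inner x x) in
    (forall e : R[i], 0 < e ->
       exists N, forall m n, (N <= m)%N -> (N <= n)%N -> norm (u m - u n) < e) ->
    exists l, forall e : R[i], 0 < e ->
       exists N, forall n, (N <= n)%N -> norm (u n - l) < e
}.

Local Notation "'[ x , y ]" := (inner _ x y).

Definition hnorm (R : realType) (H : hilbert R) (x : H) : R[i] := sqrtC '[x, x].

Section Operators.
Variable R : realType.
Local Notation C := R[i].
Implicit Types H K : hilbert R.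

Definition hdense H (D : set H) : Prop :=
  forall (x : H) (e : C), 0 < e -> exists y, D y /\ hnorm (x - y) < e.

(* A partially defined operator; the values of app outside dom are junk. *)
Record pop H K := Pop { dom : set H; app :> H -> K }.

Definition linear_op H K (T : pop H K) : Prop :=
  subspace (dom T) /\
  forall (c : C) (x y : H), dom T x -> dom T y -> T (c *: x + y) = c *: T x + T y.

Definition symmetric_op H (T : pop H H) : Prop :=
  linear_op T /\ forall x y, dom T x -> dom T y -> '[T x, y] = '[x, T y].

(* The adjoint; for T densely defined, the value z below is unique. *)
Definition adj_set H K (T : pop H K) (y : K) : set H :=
  [set z | forall x, dom T x -> '[T x, y] = '[x, z]].

Definition adjoint H K (T : pop H K) : pop K H :=
  Pop [set y | exists z, adj_set T y z] (fun y => xget 0 (adj_set T y)).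

(* The graph of T lies in the closure of the graph of its restriction to D. *)
Definition is_core H K (D : set H) (T : pop H K) : Prop :=
  D `<=` dom T /\
  forall (x : H) (e : C), dom T x -> 0 < e ->
    exists y, [/\ D y, hnorm (x - y) < e & hnorm (T x - T y) < e].

Definition unitary H K (u : H -> K) : Prop :=
  [/\ linear u, forall x y, '[u x, u y] = '[x, y] & forall y, exists x, u x = y].

(* The adjoint of an everywhere defined operator. *)
Definition badj H K (u : H -> K) : K -> H := adjoint (Pop setT u).

End Operators.

Record is_star_rep (R : realType) (A : starAlgType R[i]) (K : hilbert R)
    (pi : A -> K -> K) : Prop := {
  rep_linear : forall x, linear (pi x);
  rep_bounded : forall x, exists M : R[i], forall v, hnorm (pi x v) <= M * hnorm v;
  repD : forall (z : R[i]) x y v, pi (z *: x + y) v = z *: pi x v + pi y v;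
  rep1 : forall v, pi 1 v = v;
  repM : forall x y v, pi (x * y) v = pi x (pi y v);
  rep_star : forall x v w, '[pi x v, w] = '[v, pi (star x) w]
}.

Section Dense.
Variables (R : realType) (H : hilbert R).

Lemma hdense_eq (D : set H) (y z : H) :
  hdense D -> (forall x, D x -> '[x, y] = '[x, z]) -> y = z.
Proof.
move=> dD h; apply/eqP; rewrite -subr_eq0; apply/negPn/negP => n0.
have p : 0 < hnorm (y - z) by rewrite /hnorm sqrt_dnorm_gt0.
have [x [Dx]] := dD (y - z) _ p.
move=> /lt_geF/negP; apply.
have o : '[x, y - z] = 0 by rewrite linearBr /= h // subrr.
rewrite /hnorm ler_sqrtC; [|exact: dnorm_ge0|exact: dnorm_ge0].
have o' : '[y - z, x] = 0 by rewrite hermC /= o rmorph0 mulr0.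
by rewrite (hnormBd o') lerDl dnorm_ge0.
Qed.

End Dense.

Section CommutatorCalculus.
Variables (R : realType) (A : starAlgType R[i]) (K : hilbert R).
Variables (pi : A -> K -> K) (F : pop K K) (D : set K).
Local Notation C := R[i].

(* D is the domain D_F to which the commutators are restricted. *)
Record comm_setting : Prop := {
  cs_rep : is_star_rep pi;
  cs_sym : symmetric_op F;
  cs_dom_dense : hdense (dom F);
  cs_subspace : subspace D;
  cs_dense : hdense D;
  cs_sub : D `<=` dom F;
  cs_inv : forall x v, D v -> dom F (pi x v)
}.

Definition gop (s : seq (A * A * A)) (v : K) : K :=
  \sum_(p <- s) pi p.1.1 (F (pi p.1.2 (pi p.2 v)) - pi p.1.2 (F (pi p.2 v))).

Definition restr (f : K -> K) : D -> K := fun v => f (val v).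

(* As pi is linear, these sums make up the linear span of the operators
   pi(x)(F pi(y) - pi(y) F)pi(z) restricted to D. *)
Definition in_gamma (_ : comm_setting) : {pred (D -> K)} :=
  fun T => `[< exists s, T = restr (gop s) >].

Definition gop_comb (z : C) (s t : seq (A * A * A)) :=
  [seq (z *: p.1.1, p.1.2, p.2) | p <- s] ++ t.
Definition gop_mulr (s : seq (A * A * A)) (x : A) :=
  [seq (p.1, p.2 * x) | p <- s].
Definition gop_star (s : seq (A * A * A)) :=
  [seq (- star p.2, star p.1.2, star p.1.1) | p <- s].

Hypothesis h : comm_setting.

Let piL x := rep_linear (cs_rep h) x.
Let pi0 x : pi x 0 = 0.
Proof. by have := piL x (-1) 0 0; rewrite scaler0 addr0 scaleN1r addNr. Qed.
Let piD x v w : pi x (v + w) = pi x v + pi x w.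
Proof. by have := piL x 1 v w; rewrite !scale1r. Qed.
Let piZ x z v : pi x (z *: v) = z *: pi x v.
Proof. by have := piL x z v 0; rewrite pi0 !addr0. Qed.
Let piN x v : pi x (- v) = - pi x v.
Proof. by rewrite -scaleN1r piZ scaleN1r. Qed.
Let pi0l v : pi 0 v = 0.
Proof.
by have := repD (cs_rep h) (-1) 0 0 v; rewrite scaler0 addr0 scaleN1r addNr.
Qed.
Let piDl x y v : pi (x + y) v = pi x v + pi y v.
Proof. by have := repD (cs_rep h) 1 x y v; rewrite !scale1r. Qed.
Let piZl z x v : pi (z *: x) v = z *: pi x v.
Proof. by have := repD (cs_rep h) z x 0 v; rewrite pi0l !addr0. Qed.
Let piNl x v : pi (- x) v = - pi x v.
Proof. by rewrite -(scaleN1r x) piZl scaleN1r. Qed.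
Let pi1 := rep1 (cs_rep h).
Let piM := repM (cs_rep h).
Let piS := rep_star (cs_rep h).

Let D' : set K := [set v | forall z, dom F (pi z v)].
Let DD' v : D v -> D' v. Proof. by move=> Dv z; exact: cs_inv. Qed.
Let D'pi x v : D' v -> D' (pi x v).
Proof. by move=> Dv z; rewrite -piM; exact: Dv. Qed.

Let FL z v w : dom F v -> dom F w -> F (z *: v + w) = z *: F v + F w.
Proof. by case: (cs_sym h) => -[_ FL] _; exact: FL. Qed.
Let domD z v w : dom F v -> dom F w -> dom F (z *: v + w).
Proof. by case: (cs_sym h) => -[[_ dF] _] _; exact: dF. Qed.
Let F0 : F 0 = 0.
Proof.
have d0 : dom F 0 by case: (cs_sym h) => -[[]].
by have := FL (-1) d0 d0; rewrite scaler0 addr0 scaleN1r addNr.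
Qed.
Let FZ z v : dom F v -> F (z *: v) = z *: F v.
Proof.
have d0 : dom F 0 by case: (cs_sym h) => -[[]].
by move=> dv; have := FL z dv d0; rewrite F0 !addr0.
Qed.
Let FS v w : dom F v -> dom F w -> '[F v, w] = '[v, F w].
Proof. by case: (cs_sym h) => _; apply. Qed.

Lemma gop_combE z s t v : gop (gop_comb z s t) v = z *: gop s v + gop t v.
Proof.
rewrite /gop big_cat big_map scaler_sumr; congr (_ + _).
by apply: eq_bigr => p _ /=; rewrite piZl.
Qed.

Lemma gop_mulrE s x v : gop (gop_mulr s x) v = gop s (pi x v).
Proof. by rewrite /gop big_map; apply: eq_bigr => p _ /=; rewrite !piM. Qed.

Lemma gop_linear s z v w :
  D' v -> D' w -> gop s (z *: v + w) = z *: gop s v + gop s w.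
Proof.
move=> Dv Dw; rewrite /gop scaler_sumr -big_split /=; apply: eq_bigr => p _.
have e1 : F (pi p.1.2 (pi p.2 (z *: v + w))) =
    z *: F (pi p.1.2 (pi p.2 v)) + F (pi p.1.2 (pi p.2 w)).
  by rewrite !piL FL // -piM; [exact: Dv|exact: Dw].
have e2 : F (pi p.2 (z *: v + w)) = z *: F (pi p.2 v) + F (pi p.2 w).
  by rewrite piL FL; [|exact: Dv|exact: Dw].
by rewrite e1 e2 !piL opprD addrACA -scalerBr piL.
Qed.

Lemma gop_adj s v w : D' v -> D' w -> '[gop s v, w] = '[v, gop (gop_star s) w].
Proof.
move=> Dv Dw; rewrite /gop big_map.
elim: s => [|p s IH]; first by rewrite !big_nil linear0l linear0r.
rewrite !big_cons linearDl linearDr /= IH; congr (_ + _).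
rewrite piS linearBl /= piNl -piN opprB piD piN linearBr /=.
congr (_ - _).
- rewrite FS; last 2 first.
  + by rewrite -piM; exact: Dv.
  + exact: Dw.
  by rewrite !piS.
- rewrite piS FS; last 2 first.
  + exact: Dv.
  + by rewrite -piM; exact: Dw.
  by rewrite !piS.
Qed.

Lemma gop_star_eq s t :
  (forall v, D v -> gop s v = gop t v) ->
  forall v, D' v -> gop (gop_star s) v = gop (gop_star t) v.
Proof.
move=> e v Dv; apply: (hdense_eq (cs_dense h)) => w Dw.
by rewrite -!gop_adj ?e //; exact: DD'.
Qed.

Lemma gop_eq s t :
  (forall v, D v -> gop s v = gop t v) -> forall v, D' v -> gop s v = gop t v.
Proof.
move=> e v Dv; apply: (hdense_eq (cs_dense h)) => w Dw.
rewrite hermC [RHS]hermC /= !gop_adj //; try exact: DD'.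
by rewrite (gop_star_eq e) //; exact: DD'.
Qed.

Lemma in_gamma_submod : submod_closed (in_gamma h).
Proof.
split=> [|z S T /asboolP[s ->] /asboolP[t ->]]; apply/asboolP.
  by exists [::]; apply/funext => v; rewrite /restr /gop big_nil.
by exists (gop_comb z s t); apply/funext => v; rewrite /restr gop_combE.
Qed.
HB.instance Definition _ :=
  GRing.isSubmodClosed.Build C (D -> K) (in_gamma h) in_gamma_submod.

Record gamma : Type := Gamma { gval : D -> K; gvalP : gval \in in_gamma h }.
HB.instance Definition _ := [isSub for gval].
HB.instance Definition _ := [Choice of gamma by <:].
HB.instance Definition _ := [SubChoice_isSubLmodule of gamma by <:].

Definition mkgamma (s : seq (A * A * A)) : gamma :=
  Gamma (introT (asboolP _) (ex_intro _ s erefl) : restr (gop s) \in in_gamma h).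

Definition grep (T : gamma) : seq (A * A * A) :=
  projT1 (cid (elimT (asboolP _) (gvalP T))).

Lemma grepK (T : gamma) (v : D) : gval T v = gop (grep T) (val v).
Proof. by rewrite /grep; case: cid => s /= ->. Qed.

Lemma glact_in x (T : gamma) : (fun v => pi x (gval T v)) \in in_gamma h.
Proof.
apply/asboolP; exists [seq (x * p.1.1, p.1.2, p.2) | p <- grep T].
apply/funext => v; rewrite grepK /restr /gop big_map.
elim: (grep T) => [|p s IH]; first by rewrite !big_nil pi0.
by rewrite !big_cons piD IH /= piM.
Qed.
Definition glact x (T : gamma) : gamma := Gamma (glact_in x T).

Lemma gdiff_in x :
  restr (fun v => 'i *: F (pi x v) - pi x ('i *: F v)) \in in_gamma h.
Proof.
apply/asboolP; exists [:: ('i%:A, x, 1)]; apply/funext => v.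
by rewrite /restr /gop big_seq1 /= piZl !pi1 scalerBr piZ.
Qed.
Definition gdiff x : gamma := Gamma (gdiff_in x).

Definition gract (T : gamma) (x : A) : gamma := mkgamma (gop_mulr (grep T) x).
Definition ginvol (T : gamma) : gamma := mkgamma (gop_star (grep T)).

(* gract and ginvol do not depend on the representing sum. *)
Lemma gractE (T : gamma) s x (v : D) :
  gval T = restr (gop s) -> gval (gract T x) v = gop s (pi x (val v)).
Proof.
move=> e; rewrite /= /restr gop_mulrE; apply: gop_eq.
  by move=> w Dw; have := grepK T (exist _ w (mem_set Dw)); rewrite e.
by apply/D'pi/DD'/set_mem/(valP v).
Qed.

Lemma ginvolE (T : gamma) s (v : D) :
  gval T = restr (gop s) -> gval (ginvol T) v = gop (gop_star s) (val v).
Proof.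
move=> e; rewrite /= /restr; apply: gop_star_eq.
  by move=> w Dw; have := grepK T (exist _ w (mem_set Dw)); rewrite e.
exact/DD'/set_mem/(valP v).
Qed.

Let valD (v : D) : D' (val v). Proof. exact/DD'/set_mem/(valP v). Qed.

Let gammaP (S T : gamma) : gval S =1 gval T -> S = T.
Proof. by move=> e; apply/val_inj/funext. Qed.

Let gvalD z (S T : gamma) v : gval (z *: S + T) v = z *: gval S v + gval T v.
Proof. by []. Qed.

Let gval_sum I (r : seq I) (f : I -> gamma) v :
  gval (\sum_(i <- r) f i) v = \sum_(i <- r) gval (f i) v.
Proof. by elim/big_rec2: _ => [|i y1 y2 _ <-]. Qed.

Let grepE (T : gamma) : gval T = restr (gop (grep T)).
Proof. by apply/funext => v; rewrite grepK. Qed.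

Let grep_comb z (S T : gamma) :
  gval (z *: S + T) = restr (gop (gop_comb z (grep S) (grep T))).
Proof. by apply/funext => v; rewrite gvalD /restr gop_combE !grepK. Qed.

Let glactE x (T : gamma) v : gval (glact x T) v = pi x (gval T v).
Proof. by []. Qed.

Lemma glact_bilin : bilin glact.
Proof.
split=> [T|x] z; [move=> x y|move=> S T]; apply: gammaP => v;
  rewrite gvalD /=.
- by rewrite (repD (cs_rep h)).
- exact: piL.
Qed.

Lemma gract_bilin : bilin gract.
Proof.
split=> [x|T] z; [move=> S T|move=> x y]; apply: gammaP => v; rewrite gvalD.
- by rewrite (gractE _ _ (grep_comb z S T)) !(gractE _ _ (grepE _)) gop_combE.
- rewrite !(gractE _ _ (grepE _)) (repD (cs_rep h)) gop_linear //;
  exact/D'pi/valD.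
Qed.

Lemma gdiff_linear : linear gdiff.
Proof.
move=> z x y; apply: gammaP => v; rewrite gvalD /= /restr !(repD (cs_rep h)).
rewrite FL; [|exact: valD|exact: valD].
by rewrite scalerDr scalerBr opprD addrACA !scalerA (mulrC z).
Qed.

Lemma gractM T x y : gract T (x * y) = gract (gract T x) y.
Proof.
apply: gammaP => v; rewrite (gractE _ _ (grepE T)).
by rewrite (gractE (T := gract T x) _ _ (erefl _)) gop_mulrE piM.
Qed.

Let gdiff_rep x : gval (gdiff x) = restr (gop [:: ('i%:A, x, 1)]).
Proof.
apply/funext => v.
by rewrite /= /restr /gop big_seq1 /= piZl !pi1 scalerBr piZ.
Qed.

Let glact_rep x T :
  gval (glact x T) = restr (gop [seq (x * p.1.1, p.1.2, p.2) | p <- grep T]).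
Proof.
apply/funext => v; rewrite /= grepK /restr /gop big_map.
elim: (grep T) => [|p s IH]; first by rewrite !big_nil pi0.
by rewrite !big_cons piD IH /= piM.
Qed.

Lemma glractA x T y : gract (glact x T) y = glact x (gract T y).
Proof.
apply: gammaP => v; rewrite [RHS]/= (gractE _ _ (glact_rep x T)).
rewrite /restr gop_mulrE /gop big_map.
elim: (grep T) => [|p s IH]; first by rewrite !big_nil pi0.
by rewrite !big_cons [RHS]piD IH /= piM.
Qed.

Lemma gdiff_mulr y z (v : D) : gval (gract (gdiff y) z) v =
  'i *: F (pi y (pi z (val v))) - pi y ('i *: F (pi z (val v))).
Proof.
rewrite (gractE _ _ (gdiff_rep y)) /gop big_seq1 /= piZl !pi1.
by rewrite scalerBr piZ.
Qed.

Lemma gdiffM x y : gdiff (x * y) = glact x (gdiff y) + gract (gdiff x) y.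
Proof.
apply: gammaP => v; rewrite -[glact _ _]scale1r gvalD scale1r gdiff_mulr /=.
by rewrite /restr !piM piD piN [RHS]addrC addrA subrK.
Qed.

Lemma gdiff_span (T : gamma) : exists s : seq (A * A * A),
  T = \sum_(p <- s) glact p.1.1 (gract (gdiff p.1.2) p.2).
Proof.
exists [seq (- 'i *: p.1.1, p.1.2, p.2) | p <- grep T].
apply: gammaP => v; rewrite gval_sum grepK big_map /gop; apply: eq_bigr => p _.
rewrite glactE gdiff_mulr piZl [pi p.1.2 ('i *: _)]piZ -scalerBr.
by rewrite piZ scalerA mulNr -expr2 sqrCi opprK scale1r.
Qed.

Let glact1 T : glact 1 T = T.
Proof. by apply: gammaP => v /=; rewrite pi1. Qed.
Let gract1 T : gract T 1 = T.
Proof. by apply: gammaP => v; rewrite (gractE _ _ (grepE T)) pi1 grepK. Qed.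
Let glactM x y T : glact (x * y) T = glact x (glact y T).
Proof. by apply: gammaP => v /=; rewrite piM. Qed.

Definition gamma_fodc : fodc A :=
  Fodc glact_bilin gract_bilin gdiff_linear glact1 gract1 glactM gractM
    glractA gdiffM gdiff_span.

Let star0 : star 0 = 0 :> A.
Proof.
by have := @starD _ A (-1) 0 0; rewrite !scaler0 addr0 rmorphN1 scaleN1r addNr.
Qed.
Let starZ z (x : A) : star (z *: x) = z^* *: star x.
Proof. by have := @starD _ A z x 0; rewrite star0 !addr0. Qed.
Let starN (x : A) : star (- x) = - star x.
Proof. by rewrite -(scaleN1r x) starZ rmorphN1 scaleN1r. Qed.
Let star1 : star 1 = 1 :> A.
Proof.
by have := starM (star (1 : A)) 1; rewrite mulr1 starK mulr1.
Qed.

Lemma ginvolD z (S T : gamma) :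
  ginvol (z *: S + T) = z^* *: ginvol S + ginvol T.
Proof.
apply: gammaP => v; rewrite gvalD (ginvolE _ (grep_comb z S T)) /= /restr.
rewrite /gop /gop_star /gop_comb !map_cat big_cat /= !big_map scaler_sumr.
congr (_ + _); apply: eq_bigr => p _ /=.
rewrite starZ !piZl (piZ (star p.1.2)).
rewrite !FZ; [|exact: valD|by rewrite -piM; exact: valD].
by rewrite piZ -scalerBr piZ.
Qed.

Lemma ginvolK : involutive ginvol.
Proof.
move=> T; apply: gammaP => v.
rewrite (ginvolE (T := ginvol T) _ (erefl _)) grepK /gop /gop_star !big_map.
apply: eq_bigr => p _ /=; rewrite !starN !starK !piNl (piN p.1.2).
have FN w : dom F w -> F (- w) = - F w.
  by move=> dw; rewrite -scaleN1r FZ // scaleN1r.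
rewrite !FN; [|exact: valD|by rewrite -piM; exact: valD].
by rewrite piN -opprD piN opprK.
Qed.

Lemma ginvol_diff x y z :
  ginvol (glact x (gract (gdiff y) z)) =
  glact (star z) (gract (gdiff (star y)) (star x)).
Proof.
have e : gval (glact x (gract (gdiff y) z)) = restr (gop [:: ('i *: x, y, z)]).
  apply/funext => v; rewrite glactE gdiff_mulr /restr /gop big_seq1 /=.
  by rewrite piZl [pi y ('i *: _)]piZ -scalerBr piZ.
apply: gammaP => v; rewrite (ginvolE _ e) glactE gdiff_mulr.
rewrite /gop /gop_star big_seq1 /= starZ conjCi !piZl !scaleNr !piN piNl.
have FN w : dom F w -> F (- w) = - F w.
  by move=> dw; rewrite -scaleN1r FZ // scaleN1r.
rewrite !piZ -!scaleNr.
rewrite !FZ; [|exact: valD|by rewrite -piM; exact: valD].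
by rewrite piZ -piN opprB !scaleNr opprK addrC.
Qed.

(* The calculus Gamma_{pi,F} with operator domain D. *)
Definition comm_calculus : star_fodc A :=
  @StarFodc _ A gamma_fodc ginvol ginvolD ginvolK ginvol_diff.

End CommutatorCalculus.

Lemma realC_conj (R : realType) (x : R) : (x%:C)%C^* = (x%:C)%C.
Proof. exact: conjc_real. Qed.

Lemma realC_neq0 (R : realType) (q : R) : 0 < q < 1 -> (q%:C)%C != 0.
Proof. by case/andP=> q0 _; rewrite eq_complex /= negb_and gt_eqF. Qed.

(* The Hopf *-algebra O(SU_q(2)). *)
Definition SUq2 (R : realType) (q : R) (hq : 0 < q < 1) : starAlgType R[i] :=
  OSU_starAlg (realC_neq0 hq) (realC_conj q).

Section Admissible.
Variables (R : realType) (q : R) (hq : 0 < q < 1).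
Local Notation A := (SUq2 hq).
Local Notation a := (ua (q%:C)%C : A).
Local Notation b := (ub (q%:C)%C : A).
Local Notation c := (uc (q%:C)%C : A).
Local Notation d := (ud (q%:C)%C : A).
Variables (G : star_fodc A) (K : hilbert R) (pi : A -> K -> K) (F : pop K K).

(* E + Lin{pi(d^n) eta : eta in D0, n in nat} *)
Definition core_domain (E D0 : set K) : set K :=
  [set x + y | x in E
             & y in lin [set z | exists n eta, D0 eta /\ z = pi (d ^+ n) eta]].

Definition admissible_comm_rep : Prop :=
  exists E D0 : set K,
    [/\ subspace E, subspace D0,
        forall x, E x -> [/\ pi c x = 0, E (pi a x) & E (pi d x)],
        forall x, D0 x -> [/\ pi a x = 0, D0 (pi b x) & D0 (pi c x)]
      & is_core (core_domain E D0) F /\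
        exists (h : comm_setting pi F (core_domain E D0))
               (rho : G -> comm_calculus h), star_fodc_hom rho].

End Admissible.

(* K is the Hilbert space direct sum of G and countably many copies of H0:
   inG and inH n are isometric embeddings with pairwise orthogonal ranges that
   together span a dense subspace; inH n eta is the vector eta_n. *)
Record hilbert_sum (R : realType) (G H0 K : hilbert R) := HilbertSum {
  inG : G -> K;
  inH : nat -> H0 -> K;
  inG_linear : linear inG;
  inH_linear : forall n, linear (inH n);
  inG_isom : forall x y, '[inG x, inG y] = '[x, y];
  inH_isom : forall n x y, '[inH n x, inH n y] = '[x, y];
  inH_orth : forall m n x y, m != n -> '[inH m x, inH n y] = 0;
  inGH_orth : forall n x y, '[inG x, inH n y] = 0;
  sum_dense : hdense
    [set inG x + y | x in setT & y in lin [set z | exists n eta, z = inH n eta]]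
}.

Section Model.
Variables (R : realType) (q : R) (hq : 0 < q < 1).
Local Notation C := R[i].
Local Notation A := (SUq2 hq).
Local Notation qC := ((q%:C)%C : C).
Local Notation a := (ua qC : A).
Local Notation b := (ub qC : A).
Local Notation c := (uc qC : A).
Local Notation d := (ud qC : A).
Variables (G H0 K : hilbert R) (S : hilbert_sum G H0 K).

Definition lambda (n : nat) : C := (Num.sqrt (1 - q ^+ (2 * n)))%:C%C.

(* eta_{n-1}, with eta_{-1} = 0 *)
Definition inHp (n : nat) (eta : H0) : K := if n is m.+1 then inH S m eta else 0.

Record model_rep (v : G -> G) (w : H0 -> H0) (pi : A -> K -> K) : Prop := {
  mr_v : unitary v;
  mr_w : unitary w;
  mr_rep : is_star_rep pi;
  mr_Ga : forall x, pi a (inG S x) = inG S (v x);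
  mr_Gd : forall x, pi d (inG S x) = inG S (badj v x);
  mr_Gb : forall x, pi b (inG S x) = 0;
  mr_Gc : forall x, pi c (inG S x) = 0;
  mr_Ha : forall n eta, pi a (inH S n eta) = lambda n *: inHp n eta;
  mr_Hd : forall n eta, pi d (inH S n eta) = lambda n.+1 *: inH S n.+1 eta;
  mr_Hc : forall n eta, pi c (inH S n eta) = qC ^+ n *: inH S n (w eta);
  mr_Hb : forall n eta, pi b (inH S n eta) = - qC ^+ n.+1 *: inH S n (badj w eta)
}.

Definition data_a (w : H0 -> H0) (T Rop : pop H0 H0) (D0 : set H0) : Prop :=
  [/\ linear_op T, symmetric_op Rop, subspace D0 /\ hdense D0,
      D0 `<=` dom T `&` dom (adjoint T) `&` dom Rop /\ w @` D0 = D0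
    & forall eta, D0 eta ->
        w (T (badj w eta)) = qC *: T eta /\
        w (w (Rop (badj w (badj w eta)))) + qC ^+ 2 *: Rop eta =
          (1 + qC ^+ 2) *: w (Rop (badj w eta))].

Definition data_b (v : G -> G) (Q : pop G G) (E : set G) : Prop :=
  [/\ symmetric_op Q, subspace E /\ hdense E, E `<=` dom Q, v @` E = E
    & forall eta, E eta ->
        v (v (Q (badj v (badj v eta)))) + qC ^+ 2 *: Q eta =
          (1 + qC ^+ 2) *: v (Q (badj v eta))].

Definition model_domain (D0 : set H0) (E : set G) : set K :=
  [set x + y | x in [set inG S e | e in E]
             & y in lin [set z | exists n eta, D0 eta /\ z = inH S n eta]].

Definition data_c (w : H0 -> H0) (T Rop : pop H0 H0) (D0 : set H0)
    (Q : pop G G) (E : set G) (F : pop K K) : Prop :=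
  [/\ linear_op F, is_core (model_domain D0 E) F,
      forall eta n, D0 eta ->
        F (inH S n eta) =
          lambda n *: inHp n (T eta)
          + inH S n (iter n w (Rop (iter n (badj w) eta)))
          + lambda n.+1 *: inH S n.+1 (adjoint T eta)
    & forall eta, E eta -> F (inG S eta) = inG S (Q eta)].

(* The pair (pi, F) arises from the model and from data (a), (b), (c). *)
Definition model_pair (pi : A -> K -> K) (F : pop K K) : Prop :=
  exists (v : G -> G) (w : H0 -> H0) (T Rop : pop H0 H0) (D0 : set H0)
         (Q : pop G G) (E : set G),
    [/\ model_rep v w pi, data_a w T Rop D0, data_b v Q E
      & data_c w T Rop D0 Q E F].

End Model.

Definition unitarily_equivalent (R : realType) (A : starAlgType R[i])
    (K K' : hilbert R) (pi : A -> K -> K) (F : pop K K)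
    (pi' : A -> K' -> K') (F' : pop K' K') : Prop :=
  exists U : K -> K',
    [/\ unitary U, forall x v, U (pi x v) = pi' x (U v),
        forall v, dom F' (U v) <-> dom F v
      & forall v, dom F v -> U (F v) = F' (U v)].

(* Main.v *)
From HB Require Import structures.
Require Import Defs.
From mathcomp Require Import all_boot all_order all_algebra.
From mathcomp Require Import complex reals sesquilinear boolp classical_sets ring.

Set Implicit Arguments.
Unset Strict Implicit.
Unset Printing Implicit Defensive.
Import Order.TTheory GRing.Theory Num.Theory.
Local Open Scope classical_set_scope.
Local Open Scope ring_scope.
Local Notation "'[ x , y ]" := (inner _ x y).

(** The theorem translates a statement on calculi into one on operators.

    In any calculus put [omega x] = S(x_1) d x_2.  The generators [om_a], [om_b],
    [om_c], [om_d] recover [diff] on a, b, c, d.  In the 3D-calculus the defining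
    right ideal says that om_d = - q^2 om_a and that each of om_a, om_b, om_c
    commutes with the generators of the algebra up to powers of q; this is
    [relations_3D], derived in [is_3D_relations].  Conversely, these rules
    characterise the calculi to which the 3D-calculus maps
    ([hom_of_relations]): by left-covariance a form of the 3D-calculus has
    coefficients with respect to om_a, om_b, om_c ([coefficient_exists]), and
    the homomorphism copies them.  Hence (pi, F) is a commutator representation
    precisely when the commutators of F satisfy the rules ([op_relationsP]).

    It remains to solve the rules for F.  On ker pi(a) the operator pi(c) is
    unitary, with inverse - q^-1 pi(b), and the vectors pi(d)^n eta with eta in
    ker pi(a), called shells, span a dense part of the orthogonal complement of
    ker pi(c).  The invariant forms commute with pi(d) up to a scalar, so they are
    determined by their action on ker pi(a), which they preserve.  The formulas
    for the commutators with pi(a) and pi(d) then express F through them, shell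
    by shell: F has a diagonal part, which om_a lets vary with the shell, and two
    adjacent diagonals, given by om_b and om_c.  This is [op_form_of_relations];
    the converse computation is [op_relations_of_form].  On ker pi(c) the forms
    om_b, om_c vanish and the rules reduce to the second order relation for Q.

    Working with the unnormalised vectors pi(d)^n eta keeps this part free of
    square roots.  They enter only when the result is compared with the model:
    [model_admissible] gives the first half of the theorem, and [backward_model]
    the second.  There no unitary transformation is necessary, because ker pi(c)
    and ker pi(a) themselves serve as the spaces of the model, and the two
    adjacent diagonals of F are adjoint to each other because F is symmetric
    ([form_adjoint], [form_symmetric]). *)

(** * Linear identities in modules by commutative ring normalisation *)

Section SquareZero.
Variables (K : comNzRingType) (V : lmodType K).

(** The square-zero extension of [K] by [V].  It is a commutative ring which
    contains [V], so that identities between linear combinations in [V] become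
    ring identities. *)
Definition sqzero : Type := (K * V)%type.
HB.instance Definition _ := GRing.Zmodule.on sqzero.

Definition sqz_mul (x y : sqzero) : sqzero :=
  (x.1 * y.1, x.1 *: y.2 + y.1 *: x.2).

Let mulA : associative sqz_mul.
Proof.
move=> x y z; congr pair; rewrite /= ?mulrA // !scalerDr !scalerA addrA.
by rewrite [y.1 * z.1]mulrC [z.1 * x.1]mulrC [x.1 * z.1]mulrC.
Qed.
Let mulC : commutative sqz_mul.
Proof. by move=> x y; congr pair; [exact: mulrC | exact: addrC]. Qed.
Let mul1 : left_id ((1, 0) : sqzero) sqz_mul.
Proof. by case=> x v; congr pair; rewrite /= ?mul1r // scale1r scaler0 addr0. Qed.
Let mulDl : left_distributive sqz_mul +%R.
Proof.
move=> x y z; congr pair; rewrite /= ?mulrDl // scalerDl scalerDr.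
by rewrite addrACA.
Qed.
Let one0 : ((1, 0) : sqzero) != 0.
Proof. by apply/eqP => -[/eqP]; rewrite oner_eq0. Qed.

HB.instance Definition _ :=
  GRing.Zmodule_isComNzRing.Build sqzero mulA mulC mul1 mulDl one0.

Definition sqz_scal (c : K) : sqzero := (c, 0).
Definition sqz_vec (v : V) : sqzero := (0, v).

Let scal_zmod : zmod_morphism sqz_scal.
Proof. by move=> x y; congr pair; rewrite /= subr0. Qed.
Let scal_mon : monoid_morphism sqz_scal.
Proof. by split=> // x y; congr pair; rewrite /= !scaler0 addr0. Qed.
HB.instance Definition _ := GRing.isZmodMorphism.Build K sqzero sqz_scal scal_zmod.
HB.instance Definition _ := GRing.isMonoidMorphism.Build K sqzero sqz_scal scal_mon.

Let vec_zmod : zmod_morphism sqz_vec.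
Proof. by move=> x y; congr pair; rewrite /= subr0. Qed.
HB.instance Definition _ := GRing.isZmodMorphism.Build V sqzero sqz_vec vec_zmod.

Lemma sqz_vecZ c v : sqz_vec (c *: v) = sqz_scal c * sqz_vec v.
Proof. by congr pair; rewrite /= ?mulr0 // scale0r addr0. Qed.
Lemma sqz_vecD u v : sqz_vec (u + v) = sqz_vec u + sqz_vec v.
Proof. exact: raddfD. Qed.
Lemma sqz_vecN v : sqz_vec (- v) = - sqz_vec v.
Proof. exact: raddfN. Qed.
Lemma sqz_vec0 : sqz_vec 0 = 0.
Proof. by []. Qed.
Lemma sqz_inj u v : sqz_vec u = sqz_vec v -> u = v.
Proof. by case. Qed.

End SquareZero.

Definition sqz_vecE := (sqz_vecD, sqz_vecN, sqz_vecZ, sqz_vec0).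


Ltac lmod := apply: sqz_inj; rewrite !sqz_vecE; ring.
(** The relation [e] between coefficients, usually that a scalar and its inverse
    have product 1, is carried along because [ring] has no rule for inverses of
    images in the square-zero extension. *)
Tactic Notation "lmod" "using" constr(e) :=
  let h := fresh in
  apply: sqz_inj; rewrite !sqz_vecE;
  match goal with |- ?x = _ :> sqzero ?V =>
    have h := congr1 (@sqz_scal _ V) e; ring: h end.

(** * Linear and bilinear maps, tensors *)

Section LinearMaps.
Variables (K : nzRingType) (U V : lmodType K) (f : U -> V) (lf : linear f).

Lemma lin_add x y : f (x + y) = f x + f y.
Proof. by have := lf 1 x y; rewrite !scale1r. Qed.
Lemma lin_zero : f 0 = 0.
Proof. by apply: (addrI (f 0)); rewrite -lin_add !addr0. Qed.
Lemma lin_scale z x : f (z *: x) = z *: f x.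
Proof. by have := lf z x 0; rewrite lin_zero !addr0. Qed.
Lemma lin_opp x : f (- x) = - f x.
Proof. by rewrite -scaleN1r lin_scale scaleN1r. Qed.
Lemma lin_sub x y : f (x - y) = f x - f y.
Proof. by rewrite lin_add lin_opp. Qed.
Lemma lin_sum I (r : seq I) F :
  f (\sum_(i <- r) F i) = \sum_(i <- r) f (F i).
Proof. by elim/big_rec2: _ => [|i x y _ <-]; rewrite ?lin_zero ?lin_add. Qed.

Definition linE := (lin_add, lin_opp, lin_scale, lin_zero).

End LinearMaps.

Section BilinearMaps.
Variables (K : comNzRingType) (U V W : lmodType K) (f : U -> V -> W).
Hypothesis bf : bilin f.

Lemma bilinDl x y v : f (x + y) v = f x v + f y v.
Proof. exact: (lin_add (bf.1 v)). Qed.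
Lemma bilinZl z x v : f (z *: x) v = z *: f x v.
Proof. exact: (lin_scale (bf.1 v)). Qed.
Lemma bilinNl x v : f (- x) v = - f x v.
Proof. exact: (lin_opp (bf.1 v)). Qed.
Lemma bilin0l v : f 0 v = 0.
Proof. exact: (lin_zero (bf.1 v)). Qed.
Lemma bilinDr x u v : f x (u + v) = f x u + f x v.
Proof. exact: (lin_add (bf.2 x)). Qed.
Lemma bilinZr z x v : f x (z *: v) = z *: f x v.
Proof. exact: (lin_scale (bf.2 x)). Qed.
Lemma bilinNr x v : f x (- v) = - f x v.
Proof. exact: (lin_opp (bf.2 x)). Qed.
Lemma bilin0r x : f x 0 = 0.
Proof. exact: (lin_zero (bf.2 x)). Qed.

Definition bilinE :=
  (bilinDl, bilinZl, bilinNl, bilin0l, bilinDr, bilinZr, bilinNr, bilin0r).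

Lemma tliftD s t : tlift f (s + t) = tlift f s + tlift f t.
Proof. exact: (lin_add (tlift_linear bf)). Qed.
Lemma tliftZ z t : tlift f (z *: t) = z *: tlift f t.
Proof. exact: (lin_scale (tlift_linear bf)). Qed.

End BilinearMaps.

Lemma bilin_tensor_ext (K : comNzRingType) (U V U' V' W : lmodType K)
    (f g : tensor U V -> tensor U' V' -> W) :
  bilin f -> bilin g ->
  (forall u v u' v', f (pure u v) (pure u' v') = g (pure u v) (pure u' v')) ->
  forall s t, f s t = g s t.
Proof.
move=> bf bg e s t.
apply: (tensor_ext (f := f^~ t) (g := g^~ t)); [exact: bf.1|exact: bg.1|].
move=> u v; apply: (tensor_ext (bf.2 _) (bg.2 _)); exact: e.
Qed.

Lemma tensor_ind (K : comNzRingType) (U V : lmodType K) (P : tensor U V -> Prop) :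
  P 0 -> (forall u v, P (pure u v)) -> (forall s t, P s -> P t -> P (s + t)) ->
  forall t, P t.
Proof.
move=> P0 Pp PD t; rewrite (tensorE t); elim/big_rec: _ => // p s _ Ps.
exact: PD.
Qed.

(** * Calculi over the quantum group algebra *)

Section Calculus.
Variables (K : fieldType) (q : K) (q0 : q != 0).
Local Notation A := (OSU q).
Local Notation a := (ua q).
Local Notation b := (ub q).
Local Notation c := (uc q).
Local Notation d := (ud q).

Let ab : a * b = q *: (b * a). Proof. by case: (qrel_gen q). Qed.
Let ac : a * c = q *: (c * a). Proof. by case: (qrel_gen q). Qed.
Let bd : b * d = q *: (d * b). Proof. by case: (qrel_gen q). Qed.
Let cd : c * d = q *: (d * c). Proof. by case: (qrel_gen q). Qed.
Let cb : c * b = b * c. Proof. by case: (qrel_gen q). Qed.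
Let ad : a * d = 1 + q *: (b * c).
Proof. by have <- := qrel_det (qrel_gen q); rewrite subrK. Qed.
Let da : d * a = 1 + q^-1 *: (b * c).
Proof. by have <- := qrel_det' (qrel_gen q); rewrite subrK. Qed.

Section TliftCoproduct.
Variables (W : lmodType K) (f : A -> A -> W) (bf : bilin f).

Lemma tlift_coproduct_a : tlift f (coproduct a) = f a a + f b c.
Proof.
by rewrite /coproduct (qlift_a (qrel_coproduct q0)) (tliftD bf) !(tlift_pure bf).
Qed.
Lemma tlift_coproduct_b : tlift f (coproduct b) = f a b + f b d.
Proof.
by rewrite /coproduct (qlift_b (qrel_coproduct q0)) (tliftD bf) !(tlift_pure bf).
Qed.
Lemma tlift_coproduct_c : tlift f (coproduct c) = f c a + f d c.
Proof.
by rewrite /coproduct (qlift_c (qrel_coproduct q0)) (tliftD bf) !(tlift_pure bf).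
Qed.
Lemma tlift_coproduct_d : tlift f (coproduct d) = f c b + f d d.
Proof.
by rewrite /coproduct (qlift_d (qrel_coproduct q0)) (tliftD bf) !(tlift_pure bf).
Qed.
End TliftCoproduct.

Lemma coproduct_linear : linear (@coproduct K q).
Proof. by case: (qliftP (qrel_coproduct q0)) => + _ _; apply. Qed.
Lemma coproductM x y : coproduct (x * y) = coproduct x * coproduct y :> OSU2 q.
Proof. by case: (qliftP (qrel_coproduct q0)) => _ _; apply. Qed.
Lemma coproduct1 : coproduct 1 = 1 :> OSU2 q.
Proof. by case: (qliftP (qrel_coproduct q0)) => _ + _; apply. Qed.

Lemma counit_linear : linear (@counit K q : A -> K^o).
Proof. by case: (qliftP (qrel_counit q)) => + _ _; apply. Qed.
Lemma counitD (x y : A) : counit (x + y) = counit x + counit y.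
Proof. exact: (lin_add counit_linear). Qed.
Lemma counitZ z (x : A) : counit (z *: x) = z * counit x.
Proof. exact: (lin_scale counit_linear). Qed.
Lemma counitM (x y : A) : counit (x * y) = counit x * counit y.
Proof. by case: (qliftP (qrel_counit q)) => _ _; apply. Qed.
Lemma counit1 : counit (1 : A) = 1.
Proof. by case: (qliftP (qrel_counit q)) => _ + _; apply. Qed.
Lemma counit_gen :
  [/\ counit a = 1, counit b = 0, counit c = 0 & counit d = 1].
Proof.
by rewrite /counit; split; [rewrite qlift_a | rewrite qlift_b | rewrite qlift_c
  | rewrite qlift_d] => //; exact: qrel_counit.
Qed.

Lemma antipode_linear : linear (@antipode K q).
Proof. by case: (qliftP (qrel_antipode q0)) => + _ _; apply. Qed.
Lemma antipodeM (x y : A) : antipode (x * y) = antipode y * antipode x.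
Proof. by case: (qliftP (qrel_antipode q0)) => _ _; apply. Qed.
Lemma antipode1 : antipode (1 : A) = 1.
Proof. by case: (qliftP (qrel_antipode q0)) => _ + _; apply. Qed.
Lemma antipode_a : antipode a = d.
Proof. exact: (qlift_a (qrel_antipode q0)). Qed.
Lemma antipode_b : antipode b = - q^-1 *: b.
Proof. exact: (qlift_b (qrel_antipode q0)). Qed.
Lemma antipode_c : antipode c = - q *: c.
Proof. exact: (qlift_c (qrel_antipode q0)). Qed.
Lemma antipode_d : antipode d = a.
Proof. exact: (qlift_d (qrel_antipode q0)). Qed.
Definition antipodeE := (antipode_a, antipode_b, antipode_c, antipode_d).

Lemma tmulE (x y x' y' : A) :
  (pure x y : OSU2 q) * pure x' y' = pure (x * x') (y * y').
Proof. exact: tmul_pure. Qed.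

Section Adjoint.
Variables (W : lmodType K) (l : A -> W -> W) (r : W -> A -> W).
Hypotheses (bl : bilin l) (br : bilin r).

(** This is what makes S(t_1) w t_2 meaningful for a tensor [t]; the right adjoint
    action of [x] on a bimodule is the case [t = coproduct x]. *)
Lemma adj_bilin w : bilin (fun u v : A => l (antipode u) (r w v)).
Proof.
split=> [v|u] z x y /=.
  by rewrite antipode_linear !(bilinE bl).
by rewrite !(bilinE br) !(bilinE bl).
Qed.
End Adjoint.

Definition antimul (t : OSU2 q) : A := tlift (fun u v : A => antipode u * v) t.

Lemma mul_bilin (B : algType K) : bilin (fun x y : B => x * y).
Proof.
by split=> [v|u] z x y; rewrite ?mulrDl ?mulrDr -?scalerAl -?scalerAr.
Qed.

Lemma antimul_bilin : bilin (fun u v : A => antipode u * v).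
Proof.
split=> [v|u] z x y; last by rewrite mulrDr scalerAr.
by rewrite antipode_linear mulrDl scalerAl.
Qed.

Lemma antimulM s t :
  antimul (s * t) = tlift (fun u v : A => antipode u * (antimul s * v)) t.
Proof.
have bf s' : bilin (fun u v : A => antipode u * (antimul s' * v)).
  exact: (adj_bilin (mul_bilin _) (mul_bilin _)).
elim/tensor_ind: t => [|u v|x y ex ey].
- by rewrite mulr0 /antimul !(lin_zero (tlift_linear _)) //; exact: antimul_bilin.
- rewrite (tlift_pure (bf s)).
  elim/tensor_ind: s => [|u' v'|x y ex ey].
  + rewrite mul0r /antimul !(lin_zero (tlift_linear _)) ?mul0r ?mulr0 //.
    exact: antimul_bilin.
  + by rewrite tmulE /antimul !(tlift_pure antimul_bilin) antipodeM !mulrA.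
  + rewrite mulrDl /antimul !(tliftD antimul_bilin) -/(antimul _) mulrDl mulrDr.
    by rewrite -/(antimul x) -/(antimul y) -ex -ey.
- by rewrite mulrDr /antimul (tliftD antimul_bilin) (tliftD (bf s)) -ex -ey.
Qed.

(** The antipode axiom S(x_1) x_2 = eps(x).  It passes from generators to products
    since S is anti-multiplicative: the inner factor collapses to a scalar. *)
Lemma antimul_coproduct x : antimul (coproduct x) = (counit x)%:A.
Proof.
have [ea eb ec ed] := counit_gen.
elim/OSU_ind: x => [||||z|x y ex ey|x y ex ey].
- rewrite /antimul (tlift_coproduct_a antimul_bilin) !antipodeE ea da scale1r.
  by rewrite -scalerAl scaleNr addrK.
- rewrite /antimul (tlift_coproduct_b antimul_bilin) !antipodeE eb scale0r.
  by rewrite -scalerAl bd scalerA mulNr mulVf // scaleN1r subrr.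
- rewrite /antimul (tlift_coproduct_c antimul_bilin) !antipodeE ec scale0r.
  by rewrite -scalerAl ac scaleNr addNr.
- rewrite /antimul (tlift_coproduct_d antimul_bilin) !antipodeE ed ad scale1r.
  by rewrite -scalerAl cb scaleNr addrC addrK.
- rewrite (lin_scale coproduct_linear) coproduct1 /antimul (tliftZ antimul_bilin).
  rewrite (tlift_pure antimul_bilin) antipode1 mulr1.
  by rewrite counitZ counit1 mulr1.
- rewrite (lin_add coproduct_linear) /antimul (tliftD antimul_bilin) -!/(antimul _).
  by rewrite ex ey counitD scalerDl.
- rewrite coproductM antimulM ex counitM -scalerA -ey /antimul.
  rewrite -(tliftZ antimul_bilin).
  elim/tensor_ind: (coproduct y) => [|u v|s t es et].
  + by rewrite scaler0 !(lin_zero (tlift_linear _)) //;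
      [exact: antimul_bilin | exact: (adj_bilin (mul_bilin _) (mul_bilin _))].
  + rewrite (tliftZ antimul_bilin) (tlift_pure antimul_bilin).
    rewrite (tlift_pure (adj_bilin (mul_bilin _) (mul_bilin _) _)).
    by rewrite mulr_algl -scalerAr.
  + rewrite scalerDr (tliftD antimul_bilin) -es -et.
    by rewrite (tliftD (adj_bilin (mul_bilin _) (mul_bilin _) _)).
Qed.

Section Forms.
Variable G : fodc A.
Local Notation "x '\l' w" := (lact (f := G) x w) (at level 40).
Local Notation "w '\r' x" := (ract (f := G) w x) (at level 40).
Let D := diff G.

Lemma fodc_ind (P : G -> Prop) :
  (forall v w, P v -> P w -> P (v + w)) -> P 0 ->
  (forall x y z, P (x \l (D y \r z))) -> forall w, P w.
Proof.
move=> PD P0 Pg w; have [s ->] := diff_span w.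
by elim/big_rec: _ => // p v _ Pv; apply: PD.
Qed.

Definition om_a : G := d \l D a - q^-1 *: (b \l D c).
Definition om_b : G := d \l D b - q^-1 *: (b \l D d).
Definition om_c : G := a \l D c - q *: (c \l D a).
Definition om_d : G := a \l D d - q *: (c \l D b).

Let lE := bilinE (lact_bilin G).
Let rE := bilinE (ract_bilin G).

Lemma diff_a : D a = a \l om_a + b \l om_c.
Proof.
rewrite !lE -!lactM ab ad !lE lact1; lmod using (mulVf q0).
Qed.
Lemma diff_b : D b = a \l om_b + b \l om_d.
Proof.
rewrite !lE -!lactM ab ad !lE lact1; lmod using (mulVf q0).
Qed.
Lemma diff_c : D c = c \l om_a + d \l om_c.
Proof.
rewrite !lE -!lactM cb cd da !lE lact1; lmod using (mulVf q0).
Qed.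
Lemma diff_d : D d = c \l om_b + d \l om_d.
Proof.
rewrite !lE -!lactM cb cd da !lE lact1; lmod using (mulVf q0).
Qed.

Lemma diff1 : D 1 = 0.
Proof.
have := diffM G (1 : A) 1; rewrite mulr1 lact1 ract1 -/D => e.
by apply: (addrI (D 1)); rewrite -e addr0.
Qed.

Lemma omega_bilin : bilin (fun x1 x2 => antipode x1 \l D x2).
Proof.
split=> [v|u] z x y; first by rewrite antipode_linear !lE.
by rewrite /D diff_linear !lE.
Qed.

Lemma omega_linear : linear (@omega K q G).
Proof.
move=> z x y; rewrite /omega coproduct_linear.
exact: (tlift_linear omega_bilin).
Qed.

Lemma omega_gen :
  [/\ omega G a = om_a, omega G b = om_b, omega G c = om_c & omega G d = om_d].
Proof.
split; rewrite /omega ?(tlift_coproduct_a omega_bilin)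
  ?(tlift_coproduct_b omega_bilin) ?(tlift_coproduct_c omega_bilin)
  ?(tlift_coproduct_d omega_bilin) !antipodeE !lE ?scaleNr //; exact: addrC.
Qed.

(** Up to a counit term, this is how right multiplication by [x] inside [omega]
    acts on invariant forms; see [omegaM]. *)
Definition adjoint_act (x : A) (w : G) : G :=
  tlift (fun u v => antipode u \l (w \r v)) (coproduct x).

Let adjW w : bilin (fun u v => antipode u \l (w \r v)).
Proof. exact: adj_bilin (lact_bilin G) (ract_bilin G) w. Qed.

Lemma adjoint_act_gen w :
  [/\ adjoint_act a w = d \l (w \r a) - q^-1 *: (b \l (w \r c)),
      adjoint_act b w = d \l (w \r b) - q^-1 *: (b \l (w \r d)),
      adjoint_act c w = a \l (w \r c) - q *: (c \l (w \r a))
    & adjoint_act d w = a \l (w \r d) - q *: (c \l (w \r b))].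
Proof.
split; rewrite /adjoint_act ?(tlift_coproduct_a (adjW w))
  ?(tlift_coproduct_b (adjW w)) ?(tlift_coproduct_c (adjW w))
  ?(tlift_coproduct_d (adjW w)) !antipodeE !lE ?scaleNr //; exact: addrC.
Qed.

(** w x = x_1 (S(x_2) w x_3): right multiplication is recovered from the adjoint
    action, so commutation rules can be read off the latter. *)
Lemma ract_gen w :
  [/\ w \r a = a \l adjoint_act a w + b \l adjoint_act c w,
      w \r b = a \l adjoint_act b w + b \l adjoint_act d w,
      w \r c = c \l adjoint_act a w + d \l adjoint_act c w
    & w \r d = c \l adjoint_act b w + d \l adjoint_act d w].
Proof.
have [-> -> -> ->] := adjoint_act_gen w.
by split; rewrite !lE -!lactM ?ab ?ad ?cb ?cd ?da !lE lact1;
  lmod using (mulVf q0).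
Qed.

Lemma omega_scal z y :
  tlift (fun u v => antipode u \l (z%:A \l D v)) (coproduct y) = z *: omega G y.
Proof.
have bL : bilin (fun u v => antipode u \l (z%:A \l D v)).
  by split=> [v|u] z' x' y'; rewrite ?antipode_linear /D ?diff_linear !lE; lmod.
rewrite /omega -(tliftZ omega_bilin).
elim/tensor_ind: (coproduct y) => [|u v|s t es et].
- by rewrite scaler0 !(lin_zero (tlift_linear _)) //; exact: omega_bilin.
- by rewrite (tliftZ omega_bilin) (tlift_pure omega_bilin) (tlift_pure bL) !lE lact1.
- by rewrite scalerDr (tliftD omega_bilin) -es -et (tliftD bL).
Qed.

(** The Leibniz rule inside S(t_1) d t_2 gives one term for each factor; in the
    second one S(x_1) x_2 collapses to eps(x). *)
Lemma omegaM x y :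
  omega G (x * y) = adjoint_act y (omega G x) + counit x *: omega G y.
Proof.
pose Om (t : OSU2 q) := tlift (fun x1 x2 => antipode x1 \l D x2) t.
pose N s := fun u v : A => antipode u \l (antimul s \l D v).
have bN s : bilin (N s).
  split=> [v|u] z x' y'; rewrite /N.
    by rewrite antipode_linear !lE.
  by rewrite /D diff_linear !lE.
have OmM s t : Om (s * t) =
    tlift (fun u v => antipode u \l (Om s \r v)) t + tlift (N s) t.
  elim/tensor_ind: t => [|u v|t t' e e'].
  - by rewrite mulr0 /Om !(lin_zero (tlift_linear _)) ?addr0 //; exact: omega_bilin.
  - rewrite (tlift_pure (adjW _)) (tlift_pure (bN s)) /N.
    elim/tensor_ind: s => [|u' v'|s s' e e'].
    + rewrite mul0r /Om /antimul !(lin_zero (tlift_linear _)) ?rE ?lE ?addr0 //.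
        exact: antimul_bilin.
      exact: omega_bilin.
    + rewrite tmulE /Om /antimul !(tlift_pure omega_bilin) !(tlift_pure antimul_bilin).
      rewrite antipodeM /D diffM !lE lractA -!lactM.
      by rewrite addrC !mulrA.
    + rewrite mulrDl /Om /antimul !(tliftD antimul_bilin) !(tliftD omega_bilin).
      by rewrite -!/(Om _) e e' !rE !lE -!/(antimul _) addrACA.
  - rewrite mulrDr /Om (tliftD omega_bilin) -!/(Om _) e e'.
    by rewrite (tliftD (adjW _)) (tliftD (bN s)) addrACA.
rewrite /omega coproductM -!/(Om _) OmM; congr (_ + _).
by rewrite /N antimul_coproduct // omega_scal.
Qed.

(** The shape of all commutation rules of the 3D-calculus: [a] and [c] share one
    weight, [b] and [d] share another. *)
Definition q_central (s t : K) (w : G) : Prop :=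
  [/\ w \r a = s *: (a \l w), w \r b = t *: (b \l w),
      w \r c = s *: (c \l w) & w \r d = t *: (d \l w)].

Definition relations_3D : Prop :=
  [/\ om_d = - q ^+ 2 *: om_a, q_central (q ^- 2) (q ^+ 2) om_a,
      q_central q^-1 q om_b & q_central q^-1 q om_c].

Lemma q_central_adjoint s t w :
  adjoint_act a w = s *: w -> adjoint_act d w = t *: w ->
  adjoint_act b w = 0 -> adjoint_act c w = 0 -> q_central s t w.
Proof.
move=> ea ed eb ec; rewrite /q_central; have [-> -> -> ->] := ract_gen w.
by rewrite ea eb ec ed !lE !addr0 !add0r.
Qed.

Lemma right_ideal_gen_mem (gs : seq A) i :
  (i < size gs)%N -> right_ideal_gen gs gs`_i.
Proof.
move=> ilt; exists (fun j => if j == i then 1 else 0).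
rewrite (bigD1 (Ordinal ilt)) //= eqxx mulr1 big1 ?addr0 // => j.
by rewrite -val_eqE /= => /negPf ->; rewrite mulr0.
Qed.

(** The commutation rules of the 3D-calculus.  The defining generators of its
    right ideal make the adjoint action on the invariant forms triangular, and
    the eigenvalue on [d] follows from that on [a] because ad - qbc = 1. *)
Lemma is_3D_relations : is_3D G -> relations_3D.
Proof.
move=> [_ hR]; have [ea eb ec ed] := counit_gen.
have [oa ob oc od] := omega_gen.
have om0 i : (i < 6)%N -> omega G [:: b ^+ 2; c ^+ 2; b * c; (a - 1) * b;
    (a - 1) * c; q ^+ 2 *: a + d - (q ^+ 2 + 1)%:A]`_i = 0.
  by move=> ilt; have /(_ ilt) := @right_ideal_gen_mem [:: b ^+ 2; c ^+ 2; b * c;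
    (a - 1) * b; (a - 1) * c; q ^+ 2 *: a + d - (q ^+ 2 + 1)%:A] i;
    rewrite -hR => -[].
have om1 : omega G 1 = 0.
  by rewrite /omega coproduct1 (tlift_pure omega_bilin) diff1 !lE.
have oE := linE omega_linear.
have obb : omega G (b * b) = 0 := om0 0%N isT.
have occ : omega G (c * c) = 0 := om0 1%N isT.
have obc : omega G (b * c) = 0 := om0 2%N isT.
have oab : omega G (a * b) = om_b.
  by have := om0 3%N isT; rewrite /= mulrBl mul1r !oE ob => /subr0_eq.
have oac : omega G (a * c) = om_c.
  by have := om0 4%N isT; rewrite /= mulrBl mul1r !oE oc => /subr0_eq.
have rel_d : om_d = - q ^+ 2 *: om_a.
  have := om0 5%N isT; rewrite /= !oE om1 oa od scaler0 subr0 => e.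
  by apply/eqP; rewrite scaleNr -addr_eq0 addrC e.
have oba : omega G (b * a) = q^-1 *: om_b.
  by rewrite -oab ab oE scalerA mulVf // scale1r.
have oca : omega G (c * a) = q^-1 *: om_c.
  by rewrite -oac ac oE scalerA mulVf // scale1r.
have ad0 x : adjoint_act x 0 = 0.
  rewrite /adjoint_act (tensorE (coproduct x)).
  rewrite (lin_sum (tlift_linear (adjW 0))) big1 // => p _.
  by rewrite (tlift_pure (adjW 0)) !rE !lE.
have adZ x z w : adjoint_act x (z *: w) = z *: adjoint_act x w.
  rewrite /adjoint_act (tensorE (coproduct x)).
  rewrite (lin_sum (tlift_linear (adjW _))) (lin_sum (tlift_linear (adjW w))).
  rewrite scaler_sumr; apply: eq_bigr => p _.
  by rewrite !(tlift_pure (adjW _)) !rE !lE.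
have adE x y : adjoint_act y (omega G x) = omega G (x * y) - counit x *: omega G y.
  by rewrite omegaM addrK.
have obd : omega G (b * d) = q *: om_b.
  have <- : omega G (a * b * d) = omega G (b * d).
    by rewrite omegaM oab [RHS]omegaM ob counitM eb mulr0.
  rewrite ab -scalerAl -mulrA ad mulrDr mulr1 -scalerAr mulrA !oE ob.
  by rewrite [omega G (b * b * c)]omegaM obb ad0 counitM eb mul0r scale0r addr0
    scaler0 addr0.
have ocd : omega G (c * d) = q *: om_c.
  have <- : omega G (a * c * d) = omega G (c * d).
    by rewrite omegaM oac [RHS]omegaM oc counitM ec mulr0.
  rewrite ac -scalerAl -mulrA ad mulrDr mulr1 -scalerAr mulrA cb !oE oc.
  by rewrite [omega G (b * c * c)]omegaM obc ad0 counitM ec mulr0 scale0r addr0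
    scaler0 addr0.
have ada_d : adjoint_act d om_a = q ^+ 2 *: om_a.
  by rewrite -oa adE ad !oE om1 obc ea od rel_d oa; lmod.
split=> //; apply: q_central_adjoint => //.
- apply: (scalerI (expf_neq0 2 q0)); rewrite -adZ.
  have -> : q ^+ 2 *: om_a = - om_d by rewrite rel_d scaleNr opprK.
  rewrite -scaleN1r adZ -od adE da !oE om1 obc ed oa scalerA divff ?expf_neq0 //.
  lmod.
- by rewrite -oa adE oab ea ob; lmod.
- by rewrite -oa adE oac ea oc; lmod.
- by rewrite -ob adE oba eb ob; lmod.
- by rewrite -ob adE obd eb ob; lmod.
- by rewrite -ob adE obb eb; lmod.
- by rewrite -ob adE obc eb; lmod.
- by rewrite -oc adE oca ec oc; lmod.
- by rewrite -oc adE ocd ec oc; lmod.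
- by rewrite -oc adE cb obc ec; lmod.
- by rewrite -oc adE occ ec; lmod.
Qed.

End Forms.

End Calculus.

(** * Homomorphisms out of the 3D-calculus *)

Section Upper.
Variable K : fieldType.

Definition upper2 (x y z : K) : 'M[K]_2 :=
  \matrix_(i, j) if i == 0 then if j == 0 then x else y
                 else if j == 0 then 0 else z.

Lemma upper2M x y z x' y' z' :
  upper2 x y z * upper2 x' y' z' = upper2 (x * x') (x * y' + y * z') (z * z').
Proof.
apply/matrixP => i j; rewrite !mxE big_ord_recl big_ord1 !mxE.
by case: i j => [[|[|//]] ?] [[|[|//]] ?] //=; rewrite ?mulr0 ?mul0r ?addr0 ?add0r.
Qed.
Lemma upper2D x y z x' y' z' :
  upper2 x y z + upper2 x' y' z' = upper2 (x + x') (y + y') (z + z').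
Proof.
apply/matrixP => i j; rewrite !mxE.
by case: i j => [[|[|//]] ?] [[|[|//]] ?] //=; rewrite addr0.
Qed.
Lemma upper2Z k x y z : k *: upper2 x y z = upper2 (k * x) (k * y) (k * z).
Proof.
apply/matrixP => i j; rewrite !mxE.
by case: i j => [[|[|//]] ?] [[|[|//]] ?] //=; rewrite mulr0.
Qed.
Lemma upper2_1 : 1 = upper2 1 0 1.
Proof.
by apply/matrixP => i j; rewrite !mxE; case: i j => [[|[|//]] ?] [[|[|//]] ?].
Qed.
End Upper.

Section Coefficient.
Variables (K : fieldType) (q : K) (q0 : q != 0).
Local Notation A := (OSU q).
Local Notation a := (ua q).
Local Notation b := (ub q).
Local Notation c := (uc q).
Local Notation d := (ud q).
Variables al be ga s t : K.
Hypotheses (st : s * t = 1) (be_s : be = q * s * be) (ga_s : ga = q * s * ga)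
  (al_t : q ^+ 2 * al = t * al).

Let Xa := upper2 1 al s.
Let Xb := upper2 0 be 0.
Let Xc := upper2 0 ga 0.
Let Xd := upper2 1 (- (t * al)) t.

Lemma qrel_upper2 : qrel q Xa Xb Xc Xd.
Proof.
have be_t : be * t = q * be.
  by rewrite {1}be_s mulrAC -[q * s * t]mulrA st mulr1.
have ga_t : ga * t = q * ga.
  by rewrite {1}ga_s mulrAC -[q * s * t]mulrA st mulr1.
split; rewrite /Xa /Xb /Xc /Xd ?upper2_1 -?scaleNr !(upper2M, upper2Z, upper2D);
  congr upper2; try ring.
- by rewrite {1}be_s; ring.
- by rewrite {1}ga_s; ring.
- by rewrite mul0r add0r be_t; ring.
- by rewrite mul0r add0r ga_t; ring.
- by ring: st.
- by ring: st.
- by ring: st.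
Qed.

(** The diagonal of [chi] consists of two characters and its corner is a twisted
    derivation.  The corner kills the right ideal of the 3D-calculus, because the
    first row of [chi r] vanishes for each generator [r]; so it is a linear
    functional on invariant forms.  The values [al], [be], [ga] at [a], [b], [c]
    single out one of three basis forms. *)
Definition chi (x : A) : 'M[K]_2 := qlift Xa Xb Xc Xd x.

Let chi_lin : linear chi. Proof. by case: (qliftP qrel_upper2). Qed.
Let chi1 : chi 1 = 1. Proof. by case: (qliftP qrel_upper2). Qed.
Let chiM x y : chi (x * y) = chi x * chi y.
Proof. by case: (qliftP qrel_upper2) => _ _; apply. Qed.
Let chi_a : chi a = Xa. Proof. exact: (qlift_a qrel_upper2). Qed.
Let chi_b : chi b = Xb. Proof. exact: (qlift_b qrel_upper2). Qed.
Let chi_c : chi c = Xc. Proof. exact: (qlift_c qrel_upper2). Qed.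
Let chi_d : chi d = Xd. Proof. exact: (qlift_d qrel_upper2). Qed.
Let chiE := (chi_a, chi_b, chi_c, chi_d).

Lemma chi_upper x : chi x 0 0 = counit x /\ chi x 1 0 = 0.
Proof.
have [ea eb ec ed] := counit_gen q.
elim/OSU_ind: x => [||||z|x y [ex0 ex1] [ey0 ey1]|x y [ex0 ex1] [ey0 ey1]].
- by rewrite chiE ea !mxE.
- by rewrite chiE eb !mxE.
- by rewrite chiE ec !mxE.
- by rewrite chiE ed !mxE.
- rewrite (lin_scale chi_lin) chi1 counitZ counit1 !mxE.
  by rewrite /= mulr0.
- by rewrite (lin_add chi_lin) counitD !mxE ex0 ex1 ey0 ey1 addr0.
- rewrite chiM counitM !mxE !big_ord_recl !big_ord0 !addr0.
  have -> : lift ord0 ord0 = 1 :> 'I_2 by apply/val_inj.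
  by rewrite ex0 ex1 ey0 ey1 !mulr0 mul0r !addr0.
Qed.

(** For [w = coproduct x] this is x_1 chi_ij(x_2). *)
Definition ext (i j : 'I_2) (w : OSU2 q) : A :=
  tlift (fun u v : A => chi v i j *: u) w.

Lemma ext_bilin i j : bilin (fun u v : A => chi v i j *: u).
Proof.
split=> [v|u] z x y; first by lmod.
by rewrite chi_lin !mxE scalerDl scalerA.
Qed.

Lemma extM i j w w' :
  ext i j (w * w') = ext i 0 w * ext 0 j w' + ext i 1 w * ext 1 j w'.
Proof.
elim/tensor_ind: w => [|u v|w1 w2 e1 e2].
- by rewrite mul0r /ext !(lin_zero (tlift_linear (ext_bilin _ _))) !mul0r addr0.
- elim/tensor_ind: w' => [|u' v'|w1 w2 e1 e2].
  + by rewrite mulr0 /ext !(lin_zero (tlift_linear (ext_bilin _ _))) !mulr0 addr0.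
  + rewrite tmulE /ext !(tlift_pure (ext_bilin _ _)) chiM !mxE.
    rewrite !big_ord_recl !big_ord0 !addr0.
    have -> : lift ord0 ord0 = 1 :> 'I_2 by apply/val_inj.
    by rewrite scalerDl -!scalerAl -!scalerAr !scalerA.
  + rewrite mulrDr /ext !(tliftD (ext_bilin _ _)) -!/(ext _ _ _) e1 e2 !mulrDr.
    by rewrite addrACA.
- rewrite mulrDl /ext !(tliftD (ext_bilin _ _)) -!/(ext _ _ _) e1 e2 !mulrDl.
  by rewrite addrACA.
Qed.

Definition ext_coproduct i j (x : A) : A := ext i j (coproduct x).
Local Notation E := ext_coproduct.

Lemma ext_coproductM i j x y : E i j (x * y) = E i 0 x * E 0 j y + E i 1 x * E 1 j y.
Proof. by rewrite /E coproductM // extM. Qed.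
Lemma ext_coproduct_linear i j : linear (E i j).
Proof.
move=> z x y; rewrite /E (coproduct_linear q0); exact: (tlift_linear (ext_bilin _ _)).
Qed.
Lemma ext_coproduct1 i j : E i j 1 = (i == j)%:R.
Proof.
by rewrite /E coproduct1 // /ext (tlift_pure (ext_bilin _ _)) chi1 !mxE scaler_nat.
Qed.
Lemma ext_coproduct_gen i j :
  [/\ E i j a = Xa i j *: a + Xc i j *: b, E i j b = Xb i j *: a + Xd i j *: b,
      E i j c = Xa i j *: c + Xc i j *: d & E i j d = Xb i j *: c + Xd i j *: d].
Proof.
by split; rewrite /E /ext ?(tlift_coproduct_a q0 (ext_bilin _ _))
  ?(tlift_coproduct_b q0 (ext_bilin _ _)) ?(tlift_coproduct_c q0 (ext_bilin _ _))
  ?(tlift_coproduct_d q0 (ext_bilin _ _)) !chiE.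
Qed.

Lemma ext_coproduct00 x : E 0 0 x = x /\ E 1 0 x = 0.
Proof.
elim/OSU_ind: x => [||||z|x y [ex0 ex1] [ey0 ey1]|x y [ex0 ex1] [ey0 ey1]].
- have [-> _ _ _] := ext_coproduct_gen 0 0; have [-> _ _ _] := ext_coproduct_gen 1 0.
  by rewrite !mxE /=; split; lmod.
- have [_ -> _ _] := ext_coproduct_gen 0 0; have [_ -> _ _] := ext_coproduct_gen 1 0.
  by rewrite !mxE /=; split; lmod.
- have [_ _ -> _] := ext_coproduct_gen 0 0; have [_ _ -> _] := ext_coproduct_gen 1 0.
  by rewrite !mxE /=; split; lmod.
- have [_ _ _ ->] := ext_coproduct_gen 0 0; have [_ _ _ ->] := ext_coproduct_gen 1 0.
  by rewrite !mxE /=; split; lmod.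
- by rewrite !(lin_scale (ext_coproduct_linear _ _)) !ext_coproduct1 scaler0.
- by rewrite !(lin_add (ext_coproduct_linear _ _)) ex0 ex1 ey0 ey1 addr0.
- by rewrite !ext_coproductM ex0 ex1 ey0 ey1 !mulr0 mul0r !addr0.
Qed.

(** The second diagonal entry is the twist by which a form with weights [s], [t]
    commutes with arbitrary elements. *)
Lemma q_central_ract (G : fodc A) (w : G) x :
  q_central s t w -> ract w x = lact (E 1 1 x) w.
Proof.
case=> wa wb wc wd; have lE := bilinE (lact_bilin G).
have rE := bilinE (ract_bilin G).
elim/OSU_ind: x => [||||z|x y ex ey|x y ex ey].
- by have [-> _ _ _] := ext_coproduct_gen 1 1; rewrite !mxE /= wa !lE; lmod.
- by have [_ -> _ _] := ext_coproduct_gen 1 1; rewrite !mxE /= wb !lE; lmod.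
- by have [_ _ -> _] := ext_coproduct_gen 1 1; rewrite !mxE /= wc !lE; lmod.
- by have [_ _ _ ->] := ext_coproduct_gen 1 1; rewrite !mxE /= wd !lE; lmod.
- by rewrite (lin_scale (ext_coproduct_linear _ _)) ext_coproduct1 lE rE ract1 lact1.
- by rewrite (lin_add (ext_coproduct_linear _ _)) rE lE ex ey.
- by rewrite ext_coproductM (ext_coproduct00 _).2 mul0r add0r ractM ex lractA ey lactM.
Qed.

Lemma ext_coproduct01M x y : E 0 1 (x * y) = x * E 0 1 y + E 0 1 x * E 1 1 y.
Proof. by rewrite ext_coproductM (ext_coproduct00 _).1. Qed.

Section Functional.
Variables (G : fodc A) (h3 : is_3D G).
Let lE := bilinE (lact_bilin G).
Let rE := bilinE (ract_bilin G).
Let D := diff G.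

Lemma fodc_lind (P : G -> Prop) :
  (forall v w, P v -> P w -> P (v + w)) -> P 0 ->
  (forall x y, P (lact x (D y))) -> forall w, P w.
Proof.
move=> PD P0 Pg; apply: fodc_ind => // x y z.
have -> : lact x (ract (D y) z) = lact x (D (y * z)) + lact (- (x * y)) (D z).
  by rewrite /D diffM !lE lactM; lmod.
by apply: PD.
Qed.

Lemma omega1 : omega G 1 = 0.
Proof.
by rewrite /omega coproduct1 // (tlift_pure (omega_bilin q0 G)) diff1 !lE.
Qed.

Lemma chi01_omega x y : omega G x = omega G y -> chi x 0 1 = chi y 0 1.
Proof.
move=> exy; pose z := x - y.
have oz : omega G z = 0.
  by rewrite !(linE (omega_linear q0 G)) exy subrr.
suff : chi (z - (counit z)%:A) 0 1 = 0.
  rewrite /z !(linE chi_lin) chi1 !mxE /= mulr0 subr0.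
  by move/subr0_eq.
have : Rideal G (z - (counit z)%:A).
  split; first by rewrite counitD -scaleNr counitZ counit1 mulr1 subrr.
  rewrite (lin_sub (omega_linear q0 G)) oz (lin_scale (omega_linear q0 G)).
  by rewrite omega1 scaler0 subr0.
case: h3 => _ -> [y' ->].
rewrite (lin_sum chi_lin) summxE big1 // => i _; rewrite chiM.
set r := nth _ _ _; have [r0 r1] : chi r 0 0 = 0 /\ chi r 0 1 = 0.
  rewrite {}/r; case: i => [[|[|[|[|[|[|//]]]]]] ?] /=;
    rewrite ?expr2 ?mulrBl ?mul1r ?(linE chi_lin) ?chiM ?chi1 ?chiE ?upper2_1
      -?scaleNr ?upper2M ?upper2Z ?upper2D -?scaleN1r ?upper2Z ?upper2D !mxE /=;
    split; try ring.
  by rewrite al_t; ring.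
rewrite !mxE !big_ord_recl !big_ord0 addr0.
have -> : lift ord0 ord0 = 1 :> 'I_2 by apply/val_inj.
by rewrite r0 r1 !mul0r addr0.
Qed.

(** Coefficient of a form with respect to the left-module basis of invariant
    forms.  Applying S(u) w to the coaction of [w] projects onto the invariant
    forms, and left-covariance is what makes this well defined. *)
Lemma coefficient_exists :
  exists f : G -> A, linear f /\ forall x y, f (lact x (D y)) = x * E 0 1 y.
Proof.
case: (h3) => -[phi [phi_lin phiE]] _.
have bP : bilin (fun (u : A) (w : G) => lact (antipode u) w).
  split=> [v|u] z x y; last by rewrite !lE.
  by rewrite (antipode_linear q0) !lE.
pose P w := tlift (fun (u : A) (w : G) => lact (antipode u) w) (phi w).
have P_lin : linear P.
  by move=> z v w; rewrite /P phi_lin; exact: (tlift_linear bP).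
have bD : bilin (fun x y : A => pure x (D y)).
  split=> [v|u] z x y; first exact: (pure_bilin _ _).1.
  by rewrite /D diff_linear; exact: ((pure_bilin _ _).2 u z).
pose act (x y : OSU2 q) := OSU2_act x (id_tensor_diff G y).
have act_in (x y : A) : bilin (fun (x' : A) (w : G) => pure (x * x') (lact y w)).
  split=> [w|u] z v v' /=.
    rewrite mulrDr -scalerAr; exact: ((pure_bilin _ _).1 _ z).
  rewrite !lE; exact: ((pure_bilin _ _).2 _ z).
have act_out T : bilin (fun x y : A =>
    tlift (fun (x' : A) (w : G) => pure (x * x') (lact y w)) T).
  split=> [v|u] z x y /=; elim/tensor_ind: T => [|u' v'|w1 w2 e1 e2].
  - by rewrite !(lin_zero (tlift_linear (act_in _ _))) scaler0 addr0.
  - rewrite !(tlift_pure (act_in _ _)) mulrDl -scalerAl.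
    exact: ((pure_bilin _ _).1 _ z).
  - by rewrite !(tliftD (act_in _ _)) e1 e2; lmod.
  - by rewrite !(lin_zero (tlift_linear (act_in _ _))) scaler0 addr0.
  - rewrite !(tlift_pure (act_in _ _)) !lE; exact: ((pure_bilin _ _).2 _ z).
  - by rewrite !(tliftD (act_in _ _)) e1 e2; lmod.
have act_bilin : bilin act.
  split=> [y|x] z v w; first exact: (tlift_linear (act_out _)).
  rewrite /act /id_tensor_diff (tlift_linear bD).
  elim/tensor_ind: x => [|u' v'|w1 w2 e1 e2].
  - by rewrite /OSU2_act !(lin_zero (tlift_linear (act_out _))) scaler0 addr0.
  - by rewrite /OSU2_act !(tlift_pure (act_out _)); exact: (tlift_linear (act_in _ _)).
  - by rewrite /OSU2_act !(tliftD (act_out _)) -!/(OSU2_act _ _) e1 e2; lmod.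
have act_pure x y x' y' : act (pure x y) (pure x' y') = pure (x * x') (lact y (D y')).
  rewrite /act /OSU2_act (tlift_pure (act_out _)) /id_tensor_diff.
  by rewrite (tlift_pure bD) (tlift_pure (act_in _ _)).
have P_diff x y : P (lact x (D y)) = counit x *: omega G y.
  rewrite /P phiE -/(act _ _) -omega_scal // -antimul_coproduct //.
  pose N X := fun u v : A => lact (antipode u) (lact (antimul X) (D v)).
  have bN X : bilin (N X).
    split=> [v|u] z x' y'; rewrite /N.
      by rewrite (antipode_linear q0) !lE.
    by rewrite /D diff_linear !lE.
  move: (coproduct x) (coproduct y).
  have antimul_lin : linear (@antimul K q) := tlift_linear (antimul_bilin q0).
  apply: (bilin_tensor_ext (f := fun s t => tlift (fun u w => lact (antipode u) w)
    (act s t)) (g := fun s t => tlift (N s) t)).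
  - by split=> [v|u] z x' y'; rewrite ?act_bilin.1 ?act_bilin.2;
      exact: (tlift_linear bP).
  - split=> [v|u] z x' y'; last exact: (tlift_linear (bN _)).
    elim/tensor_ind: v => [|u' v'|w1 w2 e1 e2].
    + by rewrite !(lin_zero (tlift_linear (bN _))) scaler0 addr0.
    + by rewrite !(tlift_pure (bN _)) /N antimul_lin !lE.
    + by rewrite !(tliftD (bN _)) e1 e2; lmod.
  - move=> u v u' v'; rewrite act_pure (tlift_pure bP) (tlift_pure (bN _)) /N.
    by rewrite /antimul (tlift_pure (antimul_bilin q0)) antipodeM // -!lactM mulrA.
have P_inv w : exists y, P w = omega G y.
  elim/fodc_lind: w => [v w [y ey] [z ez]||x y].
  - by exists (y + z); rewrite (lin_add P_lin) ey ez (lin_add (omega_linear q0 G)).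
  - by exists 0; rewrite (lin_zero P_lin) (lin_zero (omega_linear q0 G)).
  - by exists (counit x *: y); rewrite P_diff (lin_scale (omega_linear q0 G)).
pose zeta w := chi (projT1 (cid (P_inv w))) 0 1.
have zetaE w y : P w = omega G y -> zeta w = chi y 0 1.
  by move=> e; apply: chi01_omega; rewrite -e; case: cid.
have zeta_lin : linear (zeta : G -> K^o).
  move=> z v w; have [y ey] := P_inv v; have [y' ey'] := P_inv w.
  rewrite (zetaE _ _ ey) (zetaE _ _ ey') (zetaE _ (z *: y + y')).
    by rewrite chi_lin !mxE.
  by rewrite P_lin ey ey' omega_linear.
have bZ : bilin (fun (u : A) w => zeta w *: u).
  split=> [w|u] z x y; first by lmod.
  by rewrite zeta_lin scalerDl scalerA.
exists (fun w => tlift (fun (u : A) w => zeta w *: u) (phi w)); split.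
  by move=> z v w; rewrite phi_lin; exact: (tlift_linear bZ).
move=> x y; rewrite phiE -/(act _ _) -[x in RHS](ext_coproduct00 x).1.
rewrite /ext_coproduct; move: (coproduct x) (coproduct y).
apply: (bilin_tensor_ext (f := fun s t => tlift (fun (u : A) w => zeta w *: u) (act s t))
    (g := fun s t => ext 0 0 s * ext 0 1 t)).
- by split=> [v|u] z x' y'; rewrite ?act_bilin.1 ?act_bilin.2;
    exact: (tlift_linear bZ).
- by split=> [v|u] z x' y'; rewrite /ext (tlift_linear (ext_bilin _ _))
    ?mulrDl ?mulrDr -?scalerAl -?scalerAr.
- move=> u v u' v'; rewrite act_pure (tlift_pure bZ).
  rewrite /ext !(tlift_pure (ext_bilin _ _)).
  rewrite (zetaE _ (counit v *: v')); last first.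
    by rewrite P_diff (lin_scale (omega_linear q0 G)).
  rewrite (lin_scale chi_lin) mxE (chi_upper v).1.
  by rewrite -scalerAl -scalerAr scalerA.
Qed.

(** The only properties of [f] and of its values on exact forms that the
    construction of homomorphisms uses. *)
Lemma coefficient_derivation :
  exists (f : G -> A) (pd : A -> A),
  [/\ linear f, forall x y, f (lact x (D y)) = x * pd y, linear pd /\ pd 1 = 0,
      [/\ pd a = al *: a + ga *: b, pd b = be *: a - (t * al) *: b,
          pd c = al *: c + ga *: d & pd d = be *: c - (t * al) *: d]
    & forall (G' : fodc A) (w : G') x y, q_central s t w ->
        lact (pd (x * y)) w = lact x (lact (pd y) w) + ract (lact (pd x) w) y].
Proof.
have [f [f_lin fE]] := coefficient_exists.
exists f, (E 0 1); split=> //.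
- by split; [exact: ext_coproduct_linear | rewrite ext_coproduct1].
- by have [-> -> -> ->] := ext_coproduct_gen 0 1; rewrite !mxE /= !scaleNr.
- move=> G' w x y /q_central_ract wE.
  by rewrite ext_coproduct01M (bilinDl (lact_bilin G')) lractA wE !lactM.
Qed.

End Functional.

End Coefficient.

Section Hom.
Variables (K : fieldType) (q : K) (q0 : q != 0).
Local Notation A := (OSU q).
Local Notation a := (ua q).
Local Notation b := (ub q).
Local Notation c := (uc q).
Local Notation d := (ud q).
Variables (G G' : fodc A).

(** The 3D-calculus is free as a left module on three invariant forms, and its
    bimodule structure is dictated by their commutation rules: sending these
    forms to those of another calculus with the same rules is a homomorphism. *)
Lemma hom_of_relations : is_3D G -> relations_3D G' ->
  exists rho : G -> G', linear rho /\ forall x y z : A,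
    rho (lact x (ract (diff G y) z)) = lact x (ract (diff G' y) z).
Proof.
move=> h3 [rd ra rb rc].
have st1 : q ^- 2 * q ^+ 2 = 1 by rewrite mulVf ?expf_neq0.
have st2 : q^-1 * q = 1 by rewrite mulVf.
have z s : 0 = q * s * 0 :> K by rewrite mulr0.
have z' t : q ^+ 2 * 0 = t * 0 :> K by rewrite !mulr0.
have o : 1 = q * q^-1 * 1 :> K by rewrite mulr1 divff.
(* The three choices of the corner of [chi] are dual to [om_a], [om_b], [om_c]. *)
have [fa [da [fa_lin faE [da_lin da1] [daa dab dac dad] daM]]] :=
  coefficient_derivation (al := 1) q0 st1 (z _) (z _) erefl h3.
have [fb [db [fb_lin fbE [db_lin db1] [dba dbb dbc dbd] dbM]]] :=
  coefficient_derivation q0 st2 o (z _) (z' _) h3.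
have [fc [dc [fc_lin fcE [dc_lin dc1] [dca dcb dcc dcd] dcM]]] :=
  coefficient_derivation q0 st2 (z _) o (z' _) h3.
have lE := bilinE (lact_bilin G'); have rE := bilinE (ract_bilin G').
have diffE y : diff G' y =
    lact (da y) (om_a G') + lact (db y) (om_b G') + lact (dc y) (om_c G').
  elim/OSU_ind: y => [||||k|x y ex ey|x y ex ey].
  - by rewrite diff_a // daa dba dca !lE; lmod.
  - by rewrite diff_b // dab dbb dcb rd !lE; lmod.
  - by rewrite diff_c // dac dbc dcc !lE; lmod.
  - by rewrite diff_d // dad dbd dcd rd !lE; lmod.
  - rewrite (lin_scale (diff_linear G')) (lin_scale da_lin) (lin_scale db_lin).
    by rewrite (lin_scale dc_lin) diff1 da1 db1 dc1 !lE; lmod.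
  - rewrite (lin_add (diff_linear G')) (lin_add da_lin) (lin_add db_lin).
    by rewrite (lin_add dc_lin) ex ey !lE; lmod.
  - by rewrite diffM ex ey daM // dbM // dcM // !lE !rE; lmod.
exists (fun w => lact (fa w) (om_a G') + lact (fb w) (om_b G')
    + lact (fc w) (om_c G')).
split=> [k v w|x y w]; first by rewrite fa_lin fb_lin fc_lin !lE; lmod.
have e (H : fodc A) : lact x (ract (diff H y) w) =
    lact x (diff H (y * w)) - lact (x * y) (diff H w) :> H.
  by rewrite diffM (bilinDr (lact_bilin H)) lactM; lmod.
rewrite !e !(lin_sub fa_lin) !(lin_sub fb_lin) !(lin_sub fc_lin).
by rewrite faE fbE fcE faE fbE fcE !diffE !lE !lactM; lmod.
Qed.

End Hom.

Section Transfer.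
Variables (K : fieldType) (q : K) (q0 : q != 0) (G G' : fodc (OSU q)).
Variable rho : G -> G'.
Hypotheses (rho_lin : linear rho) (rhoE : forall x y z : OSU q,
  rho (lact x (ract (diff G y) z)) = lact x (ract (diff G' y) z)).

Lemma hom_lact x w : rho (lact x w) = lact x (rho w).
Proof.
have lE := bilinE (lact_bilin G); have lE' := bilinE (lact_bilin G').
elim/fodc_ind: w => [v w ev ew||y z t].
- by rewrite lE !(lin_add rho_lin) lE' ev ew.
- by rewrite lE !(lin_zero rho_lin) lE'.
- by rewrite -lactM !rhoE lactM.
Qed.

Lemma hom_ract x w : rho (ract w x) = ract (rho w) x.
Proof.
have lE := bilinE (ract_bilin G); have lE' := bilinE (ract_bilin G').
elim/fodc_ind: w => [v w ev ew||y z t].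
- by rewrite lE !(lin_add rho_lin) lE' ev ew.
- by rewrite lE !(lin_zero rho_lin) lE'.
- by rewrite lractA -ractM !rhoE lractA ractM.
Qed.

Lemma hom_diff x : rho (diff G x) = diff G' x.
Proof. by have := rhoE 1 x 1; rewrite !lact1 !ract1. Qed.

(** The rules are written with [diff] and the bimodule structure alone, and a
    homomorphism respects both. *)
Lemma relations_3D_hom : relations_3D G -> relations_3D G'.
Proof.
have rE := linE rho_lin.
have ea : rho (om_a G) = om_a G' by rewrite /om_a !rE !hom_lact !hom_diff.
have eb : rho (om_b G) = om_b G' by rewrite /om_b !rE !hom_lact !hom_diff.
have ec : rho (om_c G) = om_c G' by rewrite /om_c !rE !hom_lact !hom_diff.
have ed : rho (om_d G) = om_d G' by rewrite /om_d !rE !hom_lact !hom_diff.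
have qc s t w : q_central s t w -> q_central s t (rho w).
  by case=> ? ? ? ?; split; rewrite -hom_ract -hom_lact -(lin_scale rho_lin);
    congr rho.
case=> rd ra rb rc; split; rewrite -?ea -?eb -?ec; do ?exact: qc.
by rewrite -ed rd rE.
Qed.

End Transfer.

(** * Representations of the quantum group algebra *)

Section Subspaces.
Variables (K : nzRingType) (V : lmodType K) (D : set V) (sD : subspace D).

Lemma subspaceD x y : D x -> D y -> D (x + y).
Proof. by move=> Dx Dy; rewrite -[x]scale1r; apply: sD.2. Qed.
Lemma subspaceZ z x : D x -> D (z *: x).
Proof. by move=> Dx; rewrite -[z *: x]addr0; apply: sD.2 => //; exact: sD.1. Qed.

End Subspaces.

Section Lin.
Variables (K : nzRingType) (V : lmodType K) (X : set V).

Lemma lin_subspace : subspace (lin X).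
Proof.
split; first by exists [::]; split=> //; rewrite big_nil.
move=> z _ _ [s [sX ->]] [t [tX ->]].
exists ([seq (z * p.1, p.2) | p <- s] ++ t); split.
  by move=> p; rewrite mem_cat => /orP[/mapP[p' /sX ? ->]|/tX].
rewrite big_cat big_map scaler_sumr; congr (_ + _).
by apply: eq_bigr => p _; rewrite scalerA.
Qed.

Lemma sub_lin x : X x -> lin X x.
Proof.
move=> Xx; exists [:: (1, x)]; rewrite big_seq1 scale1r; split=> // p.
by rewrite inE => /eqP ->.
Qed.

Lemma lin_ind (P : V -> Prop) : P 0 ->
  (forall k x y, X x -> lin X y -> P y -> P (k *: x + y)) ->
  forall x, lin X x -> P x.
Proof.
move=> P0 PD x [s [sX ->]].
elim: s sX => [|p s IH] sX; first by rewrite big_nil.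
have sX' p' : p' \in s -> X p'.2 by move=> ps; apply: sX; rewrite inE ps orbT.
rewrite big_cons; apply: PD; first by apply: sX; rewrite mem_head.
  by exists s.
exact: IH.
Qed.

End Lin.

Section Rep.
Variables (R : realType) (q : R) (hq : 0 < q < 1).
Local Notation C := R[i].
Local Notation A := (SUq2 hq).
Local Notation qC := ((q%:C)%C : C).
Local Notation a := (ua qC : A).
Local Notation b := (ub qC : A).
Local Notation c := (uc qC : A).
Local Notation d := (ud qC : A).
Variables (K : hilbert R) (pi : A -> K -> K) (hpi : is_star_rep pi).

Lemma qC_neq0 : qC != 0. Proof. exact: realC_neq0. Qed.
Let q0 := qC_neq0.

Lemma qC_pow_neq1 n : 1 - (qC ^+ n.+1) ^+ 2 != 0.
Proof.
case/andP: hq => q_gt0 q_lt1; rewrite -exprM -rmorphXn /= subr_eq0 eq_sym.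
rewrite -(rmorph1 (real_complex R)) (inj_eq (fmorph_inj _)) lt_eqF //.
by rewrite exprn_ilt1 // ltW.
Qed.

Lemma qC2_neqN1 : 1 + qC ^+ 2 != 0.
Proof.
case/andP: hq => q_gt0 _; rewrite -rmorphXn /= -(rmorph1 (real_complex R)).
rewrite -rmorphD fmorph_eq0 gt_eqF // addr_gt0 // ?ltr01 ?exprn_gt0 //.
Qed.

Definition pi_lin x := rep_linear hpi x.
Lemma piDl x y v : pi (x + y) v = pi x v + pi y v.
Proof. by have := repD hpi 1 x y v; rewrite !scale1r. Qed.
Lemma pi0l v : pi 0 v = 0.
Proof. by apply: (addrI (pi 0 v)); rewrite -piDl !addr0. Qed.
Lemma piZl z x v : pi (z *: x) v = z *: pi x v.
Proof. by have := repD hpi z x 0 v; rewrite pi0l !addr0. Qed.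
Definition piM := repM hpi.
Definition pi1 := rep1 hpi.
Lemma pi_linE x : 
  (forall v w, pi x (v + w) = pi x v + pi x w) *
  (forall v, pi x (- v) = - pi x v) *
  (forall k v, pi x (k *: v) = k *: pi x v) * (pi x 0 = 0).
Proof. exact: (linE (pi_lin x)). Qed.

Lemma pi_ab v : pi a (pi b v) = qC *: pi b (pi a v).
Proof. by rewrite -!piM -piZl; congr (pi _ v); case: (qrel_gen qC). Qed.
Lemma pi_ac v : pi a (pi c v) = qC *: pi c (pi a v).
Proof. by rewrite -!piM -piZl; congr (pi _ v); case: (qrel_gen qC). Qed.
Lemma pi_bd v : pi b (pi d v) = qC *: pi d (pi b v).
Proof. by rewrite -!piM -piZl; congr (pi _ v); case: (qrel_gen qC). Qed.
Lemma pi_cd v : pi c (pi d v) = qC *: pi d (pi c v).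
Proof. by rewrite -!piM -piZl; congr (pi _ v); case: (qrel_gen qC). Qed.
Lemma pi_cb v : pi c (pi b v) = pi b (pi c v).
Proof. by rewrite -!piM; congr (pi _ v); case: (qrel_gen qC). Qed.
Lemma pi_ad v : pi a (pi d v) = v + qC *: pi b (pi c v).
Proof.
rewrite -!piM -piZl -[X in X + _]pi1 -piDl; congr (pi _ v).
by apply/eqP; rewrite -subr_eq; apply/eqP; case: (qrel_gen qC).
Qed.
Lemma pi_da v : pi d (pi a v) = v + qC^-1 *: pi b (pi c v).
Proof.
rewrite -!piM -piZl -[X in X + _]pi1 -piDl; congr (pi _ v).
by apply/eqP; rewrite -subr_eq; apply/eqP; case: (qrel_gen qC).
Qed.

Lemma pi_adj_a v w : '[pi a v, w] = '[v, pi d w].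
Proof.
rewrite (rep_star hpi); congr ('[_, pi _ w]).
exact: (qlift_a (qrel_star q0 (realC_conj q))).
Qed.
Lemma pi_adj_d v w : '[pi d v, w] = '[v, pi a w].
Proof.
rewrite (rep_star hpi); congr ('[_, pi _ w]).
exact: (qlift_d (qrel_star q0 (realC_conj q))).
Qed.
Lemma pi_adj_b v w : '[pi b v, w] = '[v, - qC *: pi c w].
Proof.
rewrite (rep_star hpi) -piZl; congr ('[_, pi _ w]).
exact: (qlift_b (qrel_star q0 (realC_conj q))).
Qed.
Lemma pi_adj_c v w : '[pi c v, w] = '[v, - qC^-1 *: pi b w].
Proof.
rewrite (rep_star hpi) -piZl; congr ('[_, pi _ w]).
exact: (qlift_c (qrel_star q0 (realC_conj q))).
Qed.

Lemma inner_ext (H : hilbert R) (u v : H) : (forall y, '[u, y] = '[v, y]) -> u = v.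
Proof.
move=> e; apply/eqP; rewrite -subr_eq0 -(dnorm_eq0 (@inner R H)).
by rewrite linearBl /= e subrr.
Qed.

(** [b] and [c] are proportional to each other's adjoint and commute, hence have
    the same kernel. *)
Lemma ker_bc v : (pi b v = 0) <-> (pi c v = 0).
Proof.
split=> e; apply/eqP; rewrite -(dnorm_eq0 (@inner R K)).
  by rewrite pi_adj_c -pi_cb e (pi_linE c) scaler0 linear0r.
by rewrite pi_adj_b pi_cb e (pi_linE b) scaler0 linear0r.
Qed.

(** The kernel of [c] is orthogonal to the ranges of [b] and [c]. *)
Lemma ker_c_range_b v z : pi c v = 0 -> v = pi b z -> v = 0.
Proof.
move=> cv e; apply/eqP; rewrite -(dnorm_eq0 (@inner R K)) {1}e pi_adj_b cv.
by rewrite scaler0 linear0r.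
Qed.
Lemma ker_c_range_c v z : pi c v = 0 -> v = pi c z -> v = 0.
Proof.
move=> /ker_bc bv e; apply/eqP; rewrite -(dnorm_eq0 (@inner R K)) {1}e pi_adj_c bv.
by rewrite scaler0 linear0r.
Qed.

(** On ker pi(a) the relation da = 1 + q^-1 bc makes [b] and [c] invertible: there
    [c] is unitary with inverse -q^-1 b. *)
Lemma ker_a_bc v : pi a v = 0 -> pi b (pi c v) = - qC *: v.
Proof.
move=> e; have := pi_da v; rewrite e (pi_linE d) => /esym/eqP.
by rewrite addr_eq0 => /eqP {2}->; rewrite scalerN scaleNr opprK scalerA divff ?scale1r.
Qed.

Lemma ker_a_c v : pi a v = 0 -> pi a (pi c v) = 0.
Proof. by move=> e; rewrite pi_ac e (pi_linE c) scaler0. Qed.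
Lemma ker_a_b v : pi a v = 0 -> pi a (pi b v) = 0.
Proof. by move=> e; rewrite pi_ab e (pi_linE b) scaler0. Qed.
Lemma ker_c_a v : pi c v = 0 -> pi c (pi a v) = 0.
Proof.
move=> e; apply: (scalerI q0); rewrite -pi_ac e (pi_linE a) scaler0 //.
Qed.
Lemma ker_c_d v : pi c v = 0 -> pi c (pi d v) = 0.
Proof. by move=> e; rewrite pi_cd e (pi_linE d) scaler0. Qed.
Lemma ker_c_ad v : pi c v = 0 -> pi a (pi d v) = v.
Proof. by move=> e; rewrite pi_ad e (pi_linE b) scaler0 addr0. Qed.
Lemma ker_c_da v : pi c v = 0 -> pi d (pi a v) = v.
Proof. by move=> e; rewrite pi_da e (pi_linE b) scaler0 addr0. Qed.

(** For [v] in ker pi(a) this is a multiple of the vector v_n of the model.  The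
    normalisation is postponed, so that no square roots occur. *)
Definition shell n v : K := iter n (pi d) v.
Local Notation f := shell.

Lemma shellE n v : f n v = pi (d ^+ n) v.
Proof. by elim: n => [|n IH]; rewrite ?expr0 ?pi1 // exprS piM -IH. Qed.
Lemma shell_lin n : linear (f n).
Proof. by move=> z x y; rewrite !shellE pi_lin. Qed.
Lemma shell_linE n :
  (forall v w, f n (v + w) = f n v + f n w) *
  (forall v, f n (- v) = - f n v) *
  (forall k v, f n (k *: v) = k *: f n v) * (f n 0 = 0).
Proof. exact: (linE (shell_lin n)). Qed.
Lemma shell0 v : f 0 v = v. Proof. by []. Qed.
Lemma pi_d_shell n v : pi d (f n v) = f n.+1 v. Proof. by []. Qed.
Lemma pi_c_shell n v : pi c (f n v) = qC ^+ n *: f n (pi c v).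
Proof.
elim: n => [|n IH]; first by rewrite expr0 scale1r.
by rewrite -!pi_d_shell pi_cd IH (pi_linE d) scalerA exprS.
Qed.
Lemma pi_b_shell n v : pi b (f n v) = qC ^+ n *: f n (pi b v).
Proof.
elim: n => [|n IH]; first by rewrite expr0 scale1r.
by rewrite -!pi_d_shell pi_bd IH (pi_linE d) scalerA exprS.
Qed.
(** At [n = 0] the coefficient vanishes, hence the truncated predecessor. *)
Lemma pi_a_shell n v : pi a v = 0 ->
  pi a (f n v) = (1 - (qC ^+ n) ^+ 2) *: f n.-1 v.
Proof.
case: n => [|n] e; first by rewrite expr0 expr1n subrr scale0r.
rewrite -pi_d_shell pi_ad pi_c_shell (pi_linE b) pi_b_shell ker_a_bc //= [qC ^+ n.+1]exprS.
rewrite (lin_scale (shell_lin n)); move: (qC ^+ n) => Q; lmod.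
Qed.

(** * The core domain *)

Section Core.
Variables E D0 : set K.
Hypothesis sE : subspace E.
Hypothesis hE : forall x, E x -> [/\ pi c x = 0, E (pi a x) & E (pi d x)].
Hypothesis hD0 : forall x, D0 x -> [/\ pi a x = 0, D0 (pi b x) & D0 (pi c x)].
Local Notation D := (core_domain pi E D0).

Let X := [set z | exists n eta, D0 eta /\ z = pi (d ^+ n) eta].

Lemma core_subspace : subspace D.
Proof.
have [l0 lD] := lin_subspace X.
split; first by exists 0; [exact: sE.1|exists 0 => //; rewrite addr0].
move=> z _ _ [x Ex [y Xy <-]] [x' Ex' [y' Xy' <-]].
exists (z *: x + x'); first exact: sE.2.
exists (z *: y + y'); first exact: lD.
by rewrite scalerDr addrACA.
Qed.

Lemma core_E x : E x -> D x.
Proof.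
move=> Ex; exists x => //; exists 0; last by rewrite addr0.
exact: (lin_subspace X).1.
Qed.

Lemma core_shell n x : D0 x -> D (f n x).
Proof.
move=> Dx; exists 0; first exact: sE.1.
exists (f n x); last by rewrite add0r.
by apply: sub_lin; exists n, x; rewrite shellE.
Qed.

(** Closure under linear combinations is asked only for vectors of the core, since
    [F] is linear only there. *)
Lemma core_ind (P : K -> Prop) :
  (forall k u v, D u -> D v -> P u -> P v -> P (k *: u + v)) -> 
  (forall x, E x -> P x) -> (forall n x, D0 x -> P (f n x)) ->
  forall v, D v -> P v.
Proof.
move=> PD PE Pf _ [x Ex [y Xy <-]].
suff [Dy Py] : D y /\ P y.
  by rewrite -[x]scale1r; apply: PD => //; [exact: core_E | exact: PE].
elim/lin_ind: Xy => [|k x' {}y [n [eta [eta0 ->]]] _ [Dy Py]].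
  by split; [exact: core_subspace.1 | apply: PE; exact: sE.1].
rewrite -shellE; split.
  by apply: core_subspace.2 => //; exact: core_shell.
by apply: PD => //; [exact: core_shell | exact: Pf].
Qed.

Lemma core_stable (x : A) v : D v -> D (pi x v).
Proof.
have sD := core_subspace.
have ext (y : A) : (forall e, E e -> D (pi y e)) ->
    (forall n eta, D0 eta -> D (pi y (f n eta))) -> forall v, D v -> D (pi y v).
  move=> yE yf; apply: core_ind => // k u w _ _ Du Dw.
  by rewrite pi_lin; exact: sD.2.
elim/OSU_ind: x v => [||||z|x y ex ey|x y ex ey].
- apply: ext => [e /hE[_ ae _]|n eta /[dup] Deta /hD0[aeta _ _]].
    exact: core_E.
  by rewrite pi_a_shell //; apply: subspaceZ => //; exact: core_shell.
- apply: ext => [e /hE[/ker_bc be _ _]|n eta /hD0[_ beta _]].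
    by rewrite be; exact: sD.1.
  by rewrite pi_b_shell; apply: subspaceZ => //; exact: core_shell.
- apply: ext => [e /hE[ce _ _]|n eta /hD0[_ _ ceta]].
    by rewrite ce; exact: sD.1.
  by rewrite pi_c_shell; apply: subspaceZ => //; exact: core_shell.
- apply: ext => [e /hE[_ _ de]|n eta Deta].
    exact: core_E.
  by rewrite pi_d_shell; exact: core_shell.
- by move=> v Dv; rewrite piZl pi1; exact: subspaceZ.
- by move=> v Dv; rewrite piDl; apply: subspaceD; [|exact: ex|exact: ey].
- by move=> v Dv; rewrite piM; apply/ex/ey.
Qed.

End Core.

End Rep.

(* Unfolding a shell to its outermost [pi d] would let linearity of [pi d]
   compete with that of the shell. *)
#[global] Opaque shell.

(** * The 3D relations for operators *)

Section Operators.
Variables (R : realType) (q : R) (hq : 0 < q < 1).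
Local Notation C := R[i].
Local Notation A := (SUq2 hq).
Local Notation qC := ((q%:C)%C : C).
Local Notation a := (ua qC : A).
Local Notation b := (ub qC : A).
Local Notation c := (uc qC : A).
Local Notation d := (ud qC : A).
Variables (K : hilbert R) (pi : A -> K -> K) (F : pop K K).

(** S(x_1) F x_2 - eps(x) F for the four generators [x]: the invariant forms of the
    commutator calculus, up to the factor ['i]. *)
Definition Fa v : K := pi d (F (pi a v)) - qC^-1 *: pi b (F (pi c v)) - F v.
Definition Fb v : K := pi d (F (pi b v)) - qC^-1 *: pi b (F (pi d v)).
Definition Fc v : K := pi a (F (pi c v)) - qC *: pi c (F (pi a v)).
Definition Fd v : K := pi a (F (pi d v)) - qC *: pi c (F (pi b v)) - F v.

Definition op_central (s t : C) (X : K -> K) (v : K) : Prop :=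
  [/\ X (pi a v) = s *: pi a (X v), X (pi b v) = t *: pi b (X v),
      X (pi c v) = s *: pi c (X v) & X (pi d v) = t *: pi d (X v)].

Definition op_relations (v : K) : Prop :=
  [/\ Fd v = - qC ^+ 2 *: Fa v, op_central (qC ^- 2) (qC ^+ 2) Fa v,
      op_central qC^-1 qC Fb v & op_central qC^-1 qC Fc v].

Section Calculus.
Variables (D : set K) (h : comm_setting pi F D).
Hypothesis stable : forall x v, D v -> D (pi x v).
Local Notation G := (comm_calculus h).
Let hpi := cs_rep h.

Let represents (T : G) (X : K -> K) := forall v : D, gval T v = 'i *: X (val v).

Let rep_eq (S T : G) X Y : represents S X -> represents T Y ->
  S = T <-> forall v, D v -> X v = Y v.
Proof.
move=> SX TY; split=> [e v Dv|e].
  have := SX (exist _ v (mem_set Dv)); rewrite e TY /= => /scalerI -> //.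
  exact: neq0Ci.
apply/val_inj/funext => v /=; rewrite SX TY e //; exact/set_mem/(valP v).
Qed.

(* The right action is composition with [pi x] because the core is stable. *)
Let rep_ract T X x : represents T X -> represents (ract T x) (X \o pi x).
Proof.
move=> TX v; have Dv : D (val v) by exact/set_mem/(valP v).
have e : gval T = restr (D := D) (gop pi F (grep T)).
  by apply/funext => u; rewrite grepK.
rewrite [gval _ v](gractE x v e).
have := TX (exist (fun u => u \in D) (pi x (val v)) (mem_set (stable x Dv))); rewrite grepK /= => ->.
by [].
Qed.

Let rep_lact T X x : represents T X -> represents (lact x T) (pi x \o X).
Proof. by move=> TX v; rewrite /= TX (pi_linE hpi). Qed.

Let rep_sub S T X Y z : represents S X -> represents T Y ->
  represents (S - z *: T) (fun v => X v - z *: Y v).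
Proof.
move=> SX TY v; rewrite -[gval _ v]/(gval S v - z *: gval T v) SX TY; lmod.
Qed.

Let rep_scale T X z : represents T X -> represents (z *: T) (fun v => z *: X v).
Proof. by move=> TX v; rewrite -[gval _ v]/(z *: gval T v) TX; lmod. Qed.

Let rep_diff x : represents (diff G x) (fun v => F (pi x v) - pi x (F v)).
Proof. by move=> v; rewrite /= /restr (pi_linE hpi); lmod. Qed.

(** The invariant forms of the commutator calculus are represented by the operators
    above, so equality of forms is equality of operators on the core. *)
Lemma op_relationsP : relations_3D G <-> forall v, D v -> op_relations v.
Proof.
have qN0 := qC_neq0 hq.
have rep_ext T X Y : represents T X -> (forall v, X v = Y v) -> represents T Y.
  by move=> TX e v; rewrite TX e.
have rFa : represents (om_a G) Fa.
  apply: rep_ext (rep_sub _ (rep_lact _ (rep_diff _)) (rep_lact _ (rep_diff _))) _.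
  move=> v /=; rewrite /Fa !(pi_linE hpi) !(pi_da hpi); lmod.
have rFb : represents (om_b G) Fb.
  apply: rep_ext (rep_sub _ (rep_lact _ (rep_diff _)) (rep_lact _ (rep_diff _))) _.
  move=> v /=; rewrite /Fb !(pi_linE hpi) !(pi_bd hpi); lmod using (mulVf qN0).
have rFc : represents (om_c G) Fc.
  apply: rep_ext (rep_sub _ (rep_lact _ (rep_diff _)) (rep_lact _ (rep_diff _))) _.
  move=> v /=; rewrite /Fc !(pi_linE hpi) !(pi_ac hpi); lmod.
have rFd : represents (om_d G) Fd.
  apply: rep_ext (rep_sub _ (rep_lact _ (rep_diff _)) (rep_lact _ (rep_diff _))) _.
  move=> v /=; rewrite /Fd !(pi_linE hpi) !(pi_ad hpi) !(pi_cb hpi); lmod.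
have qc s t T X : represents T X ->
    q_central s t T <-> forall v, D v -> op_central s t X v.
  move=> TX; split=> [[ra rb rc rd] v Dv|e].
    split; [move: ra|move: rb|move: rc|move: rd];
      move/(rep_eq (rep_ract _ TX) (rep_scale _ (rep_lact _ TX))); exact.
  by split; apply/(rep_eq (rep_ract _ TX) (rep_scale _ (rep_lact _ TX)))
    => v /e [].
split=> [[/(rep_eq rFd (rep_scale _ rFa)) rd /(qc _ _ _ _ rFa) ra
    /(qc _ _ _ _ rFb) rb /(qc _ _ _ _ rFc) rc] v Dv|e].
  by split; [exact: rd | exact: ra | exact: rb | exact: rc].
split; first by apply/(rep_eq rFd (rep_scale _ rFa)) => v /e [].
- by apply/(qc _ _ _ _ rFa) => v /e [].
- by apply/(qc _ _ _ _ rFb) => v /e [].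
- by apply/(qc _ _ _ _ rFc) => v /e [].
Qed.

End Calculus.
End Operators.

(** * The form of the operator *)

(** [lmod] in the presence of a nonzero scalar and its inverse, which [ring] takes
    as indeterminates with product 1. *)
Ltac lmodq k0 :=
  apply: sqz_inj; rewrite !sqz_vecE;
  match goal with |- ?x = _ :> sqzero ?V =>
    have := congr1 (@sqz_scal _ V) (mulVf k0);
    rewrite ?(rmorphB, rmorphM, rmorphD, rmorphN, rmorph1, rmorphXn) /=;
    match type of k0 with is_true (?k != 0) =>
      generalize (@sqz_scal _ V k) (@sqz_scal _ V k^-1) end end;
  let x := fresh in let y := fresh in let h := fresh in
  intros x y h; ring: h.

Section Form.
Variables (R : realType) (q : R) (hq : 0 < q < 1).
Local Notation C := R[i].
Local Notation A := (SUq2 hq).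
Local Notation qC := ((q%:C)%C : C).
Local Notation a := (ua qC : A).
Local Notation b := (ub qC : A).
Local Notation c := (uc qC : A).
Local Notation d := (ud qC : A).
Variables (K : hilbert R) (pi : A -> K -> K) (hpi : is_star_rep pi).
Variable F : pop K K.
Variables E D0 : set K.
Hypothesis sE : subspace E.
Hypothesis hE : forall x, E x -> [/\ pi c x = 0, E (pi a x) & E (pi d x)].
Hypothesis hD0 : forall x, D0 x -> [/\ pi a x = 0, D0 (pi b x) & D0 (pi c x)].
Local Notation D := (core_domain pi E D0).
Local Notation f := (shell pi).
Hypothesis F_lin : forall k x y, D x -> D y -> F (k *: x + y) = k *: F x + F y.

Let q0 := qC_neq0 hq.
Let sD := core_subspace pi D0 sE.
Let D_pi x v : D v -> D (pi x v). Proof. exact: core_stable. Qed.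
Let F0 : F 0 = 0.
Proof.
by have := F_lin (-1) sD.1 sD.1; rewrite scaler0 addr0 scaleN1r addNr.
Qed.
Let FZ k x : D x -> F (k *: x) = k *: F x.
Proof. by move=> Dx; have := F_lin k Dx sD.1; rewrite F0 !addr0. Qed.

Let lE := pi_linE hpi.

Section DLinear.
Variable X : K -> K.
Hypothesis X_lin : forall k x y, D x -> D y -> X (k *: x + y) = k *: X x + X y.
Variables (s t : C) (Y : K -> K).
Hypothesis st : s * t = 1.
Hypothesis X_E : forall e, E e ->
  [/\ X (pi a e) = s *: pi a (X e), pi c (X e) = 0 & X (pi d e) = t *: pi d (X e)].
Hypothesis X_shell : forall n x, D0 x -> X (f n x) = t ^+ n *: f n (Y x).
Hypothesis Y_ker : forall x, D0 x ->
  [/\ pi a (Y x) = 0, Y (pi b x) = t *: pi b (Y x) & Y (pi c x) = s *: pi c (Y x)].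

Let X0 : X 0 = 0.
Proof.
by have := X_lin (-1) sD.1 sD.1; rewrite scaler0 addr0 scaleN1r addNr.
Qed.
Let XZ k x : D x -> X (k *: x) = k *: X x.
Proof. by move=> Dx; have := X_lin k Dx sD.1; rewrite X0 !addr0. Qed.

(** An operator which is diagonal on shells, with ratio [t], commutes with the
    generators up to [s] and [t] as soon as its initial entry [Y] does: [a] lowers
    and [d] raises the shell, [b] and [c] only act on its argument. *)
Lemma op_central_core v : D v -> op_central (hq := hq) pi s t X v.
Proof.
move: v; apply: (core_ind hpi sE) => [k u v Du Dv [ua ub uc ud] [va vb vc vd]|e Ee|n x Dx].
- have XD x : X (pi x (k *: u + v)) = k *: X (pi x u) + X (pi x v).
    by rewrite (pi_lin hpi) X_lin //; exact: D_pi.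
  split; rewrite XD X_lin // ?(ua, ub, uc, ud) ?(va, vb, vc, vd) !lE; lmod.
- have [ca Ea Ed] := hE Ee; have [xa xc xd] := X_E Ee.
  split=> //.
    by rewrite (ker_bc hpi _).2 // X0 (ker_bc hpi _).2 // scaler0.
  by rewrite ca xc X0 scaler0.
have [ax Db Dc] := hD0 Dx; have [ya yb yc] := Y_ker Dx.
have Df m : D (f m x) by exact: core_shell.
split.
- rewrite (pi_a_shell hpi) // XZ // X_shell // X_shell // lE (pi_a_shell hpi) //.
  case: n => [|n]; first by rewrite expr0 expr1n subrr !scale0r !scaler0.
  rewrite /= [t ^+ n.+1]exprS; move: (t ^+ n) (qC ^+ _) => T Q; lmod using st.
- rewrite (pi_b_shell hpi) // XZ; last exact: core_shell.
  rewrite !X_shell // lE (pi_b_shell hpi) // yb !(lin_scale (shell_lin hpi n)).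
  move: (t ^+ n) (qC ^+ _) => T Q; lmod.
- rewrite (pi_c_shell hpi) // XZ; last exact: core_shell.
  rewrite !X_shell // lE (pi_c_shell hpi) // yc !(lin_scale (shell_lin hpi n)).
  move: (t ^+ n) (qC ^+ _) => T Q; lmod.
- by rewrite pi_d_shell !X_shell // exprS lE pi_d_shell scalerA.
Qed.

End DLinear.

(** With [T], [U] in place of T, T*, with [Rn n] for w^n R w^*n and with [P] for
    w* R w - R, this is the form of F on vectors pi(d^n) eta, free of the square
    roots by which these differ from eta_n. *)
Record op_form (T U P : K -> K) (Rn : nat -> K -> K) : Prop := OpForm {
  form_E : forall e, E e -> pi c (F e) = 0 /\
    pi a (F (pi d e)) + qC ^+ 2 *: pi d (F (pi a e)) = (1 + qC ^+ 2) *: F e;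
  form_shell : forall n x, D0 x ->
    F (f n x) = (1 - (qC ^+ n) ^+ 2) *: f n.-1 (T x) + f n (Rn n x) + f n.+1 (U x);
  form_T : forall x, D0 x -> [/\ pi a (T x) = 0, T (pi b x) = qC *: pi b (T x)
    & T (pi c x) = qC^-1 *: pi c (T x)];
  form_U : forall x, D0 x -> [/\ pi a (U x) = 0, U (pi b x) = qC *: pi b (U x)
    & U (pi c x) = qC^-1 *: pi c (U x)];
  form_P : forall x, D0 x -> [/\ pi a (P x) = 0, P (pi b x) = qC ^+ 2 *: pi b (P x)
    & P (pi c x) = qC ^- 2 *: pi c (P x)];
  form_R : forall n x, D0 x ->
    [/\ pi a (Rn n x) = 0, Rn n.+1 x = Rn n x - (qC ^+ 2 * (qC ^+ n) ^+ 2) *: P x,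
        Rn n (pi b x) = pi b (Rn n.+1 x) & Rn n.+1 (pi c x) = pi c (Rn n x)]
}.

Section FromForm.
Variables (T U P : K -> K) (Rn : nat -> K -> K).
Hypothesis form : op_form T U P Rn.
Let F_E := form_E form.
Let F_shell := form_shell form.
Let T_ker := form_T form.
Let U_ker := form_U form.
Let P_ker := form_P form.
Let R_ker := form_R form.

Let fL := shell_linE hpi.

Let R_c n x : D0 x -> Rn n (pi c x) = pi c (Rn n x + (qC ^+ n) ^+ 2 *: P x).
Proof.
move=> Dx; have [_ Db Dc] := hD0 Dx.
have [_ e1 _ _] := R_ker n Dc; have [_ _ _ e2] := R_ker n Dx; have [_ _ e3] := P_ker Dx.
rewrite !lE -e2 e1 e3; move: (qC ^+ n) => Q.
have st : qC ^+ 2 * qC ^- 2 = 1 by rewrite divff ?expf_neq0.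
move: st; move: (qC ^- 2) => p st; lmod using st.
Qed.

Let R_b n x : D0 x ->
  Rn n (pi b x) = pi b (Rn n x - (qC ^+ 2 * (qC ^+ n) ^+ 2) *: P x).
Proof. by move=> Dx; have [_ <- -> _] := R_ker n Dx. Qed.

Let F_E0 e : E e -> [/\ F (pi b e) = 0, F (pi c e) = 0 & pi b (F e) = 0].
Proof.
move=> Ee; have [ce _ _] := hE Ee; have [cF _] := F_E Ee.
by rewrite ce ((ker_bc hpi _).2 ce) F0; split=> //; apply/ker_bc.
Qed.

(* The coefficient 1 - q^2n of the lowest term of [F_shell] vanishes when its
   index is truncated, at [n = 0]; with it, [c] and [d] may be moved past. *)
Let c_pred n x : (1 - (qC ^+ n) ^+ 2) *: pi c (f n.-1 x) =
  ((1 - (qC ^+ n) ^+ 2) * (qC^-1 * qC ^+ n)) *: f n.-1 (pi c x).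
Proof.
case: n => [|n]; first by rewrite expr0 expr1n subrr scale0r mul0r scale0r.
by rewrite (pi_c_shell hpi) scalerA /= -[qC ^+ n in LHS](mulKf q0) -exprS.
Qed.
Let d_pred n x : (1 - (qC ^+ n) ^+ 2) *: pi d (f n.-1 x) =
  (1 - (qC ^+ n) ^+ 2) *: f n x.
Proof. by case: n => [|n] //; rewrite expr0 expr1n subrr !scale0r. Qed.

(** [F] has three diagonals with respect to the shells, but each of the forms keeps
    one only: in [Fb] the contributions of [U] and [Rn] cancel, in [Fc] those of
    [T] and [Rn], in [Fa] and [Fd] those of [T] and [U]. *)
Lemma Fb_shell n x : D0 x ->
  Fb (hq := hq) pi F (f n x) = qC ^+ n *: f n ((qC - qC^-1) *: pi b (T x)).
Proof.
move=> Dx; have [ax Db Dc] := hD0 Dx.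
have [aT Tb Tc] := T_ker Dx; have [aU Ub Uc] := U_ker Dx.
rewrite /Fb (pi_b_shell hpi) // FZ; last exact: core_shell.
rewrite pi_d_shell !F_shell // !lE d_pred !pi_d_shell /=.
rewrite !(pi_b_shell hpi) // R_b // Tb Ub.
have [_ -> _ _] := R_ker n Dx.
rewrite !fL ?[qC ^+ n.+1]exprS ?[qC ^+ n.+2]exprS ?[qC ^+ n.+1]exprS.
move: (qC ^+ n) => Q; lmodq q0.
Qed.

Lemma Fc_shell n x : D0 x ->
  Fc (hq := hq) pi F (f n x) = qC ^+ n *: f n ((qC^-1 - qC) *: pi c (U x)).
Proof.
move=> Dx; have [ax Db Dc] := hD0 Dx.
have [aT Tb Tc] := T_ker Dx; have [aU Ub Uc] := U_ker Dx.
have [aTc _ _] := T_ker Dc; have [aUc _ _] := U_ker Dc.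
rewrite /Fc (pi_c_shell hpi) FZ; last exact: core_shell.
rewrite (pi_a_shell hpi) // FZ; last exact: core_shell.
case: n => [|n]; rewrite !F_shell //.
  have [aRc _ _ _] := R_ker 0 Dc.
  rewrite !expr0 !expr1n subrr !scale0r !lE !(pi_a_shell hpi) //= Uc.
  rewrite expr0 expr1n subrr expr1 !fL; lmodq q0.
have [aRc _ _ e] := R_ker n.+1 Dc; have [_ _ _ {}e] := R_ker n Dx.
rewrite !lE c_pred !(pi_c_shell hpi) !(pi_a_shell hpi) // e Tc Uc /= !fL.
rewrite ?[qC ^+ n.+2]exprS ?[qC ^+ n.+1]exprS.
move: (qC ^+ n) => Q; lmodq q0.
Qed.

Lemma Fa_shell n x : D0 x ->
  Fa (hq := hq) pi F (f n x) = (qC ^+ 2) ^+ n *: f n (P x).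
Proof.
move=> Dx; have [ax Db Dc] := hD0 Dx.
have [aT Tb Tc] := T_ker Dx; have [aU Ub Uc] := U_ker Dx.
have [aP _ _] := P_ker Dx; have [aR _ _ _] := R_ker n Dx.
rewrite /Fa (pi_c_shell hpi) FZ; last exact: core_shell.
rewrite (pi_a_shell hpi) // FZ; last exact: core_shell.
have -> : (qC ^+ 2) ^+ n = (qC ^+ n) ^+ 2 by rewrite exprAC.
have bcR : pi b (f n (pi c (Rn n x + (qC ^+ n) ^+ 2 *: P x))) =
    qC ^+ n *: (- qC *: f n (Rn n x + (qC ^+ n) ^+ 2 *: P x)).
  by rewrite (pi_b_shell hpi) (ker_a_bc hpi) ?(fL, lE) // aR aP scaler0 addr0.
rewrite [F (f n (pi c x))]F_shell // [F (f n x)]F_shell //.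
rewrite Tc R_c // Uc !(pi_linE hpi b) bcR !(pi_b_shell hpi) !(pi_linE hpi b) !(ker_a_bc hpi) //.
case: n => [|n] in aR bcR *.
  rewrite !expr0 !expr1n subrr !scale0r !fL !shell0 expr1 lE; lmodq q0.
have [_ eR _ _] := R_ker n Dx.
rewrite /= F_shell // !lE d_pred !pi_d_shell eR.
rewrite !fL ?[qC ^+ n.+2]exprS ?[qC ^+ n.+1]exprS.
move: (qC ^+ n) => Q; lmodq q0.
Qed.

Lemma Fd_shell n x : D0 x ->
  Fd (hq := hq) pi F (f n x) = - qC ^+ 2 *: ((qC ^+ 2) ^+ n *: f n (P x)).
Proof.
move=> Dx; have [ax Db Dc] := hD0 Dx.
have [aT Tb Tc] := T_ker Dx; have [aU Ub Uc] := U_ker Dx.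
have [aP _ _] := P_ker Dx; have [aR eR _ _] := R_ker n Dx.
have [aR1 _ _ _] := R_ker n.+1 Dx.
rewrite /Fd (pi_b_shell hpi) FZ; last exact: core_shell.
rewrite pi_d_shell !F_shell // Tb R_b // Ub -eR.
have -> : (qC ^+ 2) ^+ n = (qC ^+ n) ^+ 2 by rewrite exprAC.
have cbR : pi c (pi b (Rn n.+1 x)) = - qC *: Rn n.+1 x.
  by rewrite (pi_cb hpi) (ker_a_bc hpi).
rewrite !(pi_linE hpi a) !(pi_linE hpi c) !(pi_a_shell hpi) // c_pred.
rewrite !(pi_c_shell hpi) cbR !lE !(pi_cb hpi) !(ker_a_bc hpi) // eR /= !fL.
rewrite ?[qC ^+ n.+2]exprS ?[qC ^+ n.+1]exprS.
move: (qC ^+ n) => Q; lmodq q0.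
Qed.

Let F_comb x k u v : D u -> D v ->
  F (pi x (k *: u + v)) = k *: F (pi x u) + F (pi x v).
Proof. by move=> Du Dv; rewrite (pi_lin hpi) F_lin //; exact: D_pi. Qed.

Let Fa_E e : E e -> Fa (hq := hq) pi F e = pi d (F (pi a e)) - F e.
Proof.
by move=> Ee; have [_ Fc0 _] := F_E0 Ee; rewrite /Fa Fc0 lE scaler0 subr0.
Qed.
Let Fb_E e : E e -> Fb (hq := hq) pi F e = 0.
Proof.
move=> Ee; have [_ _ Ed] := hE Ee; have [Fb0 _ _] := F_E0 Ee.
by have [_ _ bF] := F_E0 Ed; rewrite /Fb Fb0 bF lE scaler0 subr0.
Qed.
Let Fc_E e : E e -> Fc (hq := hq) pi F e = 0.
Proof.
move=> Ee; have [_ Ea _] := hE Ee; have [_ Fc0 _] := F_E0 Ee.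
by have [cF _] := F_E Ea; rewrite /Fc Fc0 cF lE scaler0 subr0.
Qed.
Let Fd_E e : E e -> Fd (hq := hq) pi F e = pi a (F (pi d e)) - F e.
Proof.
by move=> Ee; have [Fb0 _ _] := F_E0 Ee; rewrite /Fd Fb0 lE scaler0 subr0.
Qed.

(** On shells the forms are diagonal, and on [E] only [Fa] and [Fd] survive, where
    the rules amount to the second order relation for [F]. *)
Lemma op_relations_of_form v : D v -> op_relations (hq := hq) pi F v.
Proof.
have q1 : qC^-1 * qC = 1 by rewrite mulVf.
have q2 : qC ^- 2 * qC ^+ 2 = 1 by rewrite mulVf ?expf_neq0.
move=> Dv; split.
- move: v Dv; apply: (core_ind hpi sE) => [k u v Du Dv eu ev|e Ee|n x Dx].
  + rewrite /Fd /Fa !F_comb ?F_lin // in eu ev *.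
    have -> w : pi a (k *: F (pi d u) + F (pi d v)) - qC *: w =
      k *: pi a (F (pi d u)) + pi a (F (pi d v)) - qC *: w by rewrite !lE.
    move: eu ev => /(canRL (subrK _)) + /(canRL (subrK _)).
    move=> /(canRL (subrK _)) -> /(canRL (subrK _)) ->.
    by rewrite !lE; lmod.
  + have [_ /(canRL (addrK _)) e1] := F_E Ee.
    by rewrite Fd_E // Fa_E // e1; lmod.
  + by rewrite Fd_shell // Fa_shell.
- apply: (op_central_core _ (Y := P)) => // [k x y Dx Dy|e Ee|n x Dx].
  + by rewrite /Fa !F_comb ?F_lin // !lE; lmod.
  + have [ce Ea Ed] := hE Ee; have [cF e1] := F_E Ee.
    have [cFa e2] := F_E Ea; have [cFd _] := F_E Ed.
    rewrite !Fa_E //; split.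
    * rewrite (ker_c_da hpi ce) in e2.
      rewrite !lE (ker_c_ad hpi cFa).
      apply: (scalerI (expf_neq0 2 q0)); rewrite scalerA divff ?expf_neq0 // scale1r.
      by move: e2 => /(canRL (addKr _)) e2; rewrite scalerBr e2; lmod.
    * by rewrite !lE cF (ker_c_d hpi cFa) subr0.
    * rewrite (ker_c_ad hpi ce).
      have := congr1 (pi d) e1; rewrite !lE (ker_c_da hpi cFd).
      by move/(canRL (addrK _)) ->; lmod.
  + exact: Fa_shell.
- apply: (op_central_core _ (Y := fun x => (qC - qC^-1) *: pi b (T x)))
    => // [k x y Dx Dy|e Ee|n x Dx|x Dx].
  + by rewrite /Fb !F_comb // !lE; lmod.
  + have [_ Ea Ed] := hE Ee.
    by rewrite !Fb_E // !lE !scaler0.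
  + exact: Fb_shell.
  + have [aT Tb Tc] := T_ker Dx; split.
    * by rewrite lE (ker_a_b hpi) // scaler0.
    * by rewrite Tb !lE; lmod.
    * by rewrite Tc !lE (pi_cb hpi); lmod.
- apply: (op_central_core _ (Y := fun x => (qC^-1 - qC) *: pi c (U x)))
    => // [k x y Dx Dy|e Ee|n x Dx|x Dx].
  + by rewrite /Fc !F_comb // !lE; lmod.
  + have [_ Ea Ed] := hE Ee.
    by rewrite !Fc_E // !lE !scaler0.
  + exact: Fc_shell.
  + have [aU Ub Uc] := U_ker Dx; split.
    * by rewrite lE (ker_a_c hpi) // scaler0.
    * by rewrite Ub !lE (pi_cb hpi); lmod.
    * by rewrite Uc !lE; lmod.
Qed.

End FromForm.

Section ToForm.
Hypothesis rel : forall v, D v -> op_relations (hq := hq) pi F v.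
(* Locked, because linearity of [pi] must not split these into their terms. *)
Let FA := locked (Fa (hq := hq) pi F).
Let FB := locked (Fb (hq := hq) pi F).
Let FC := locked (Fc (hq := hq) pi F).
Let FDD := locked (Fd (hq := hq) pi F).
Let relL v : D v -> [/\ FDD v = - qC ^+ 2 *: FA v,
  op_central (hq := hq) pi (qC ^- 2) (qC ^+ 2) FA v,
  op_central (hq := hq) pi qC^-1 qC FB v & op_central (hq := hq) pi qC^-1 qC FC v].
Proof. by rewrite /FA /FB /FC /FDD -!lock; exact: rel. Qed.

Let F_a v : F (pi a v) = pi a (F v) + pi a (FA v) + pi b (FC v).
Proof.
rewrite /FA /FC -!lock /Fa /Fc !lE (pi_ad hpi) (pi_ab hpi); lmodq q0.
Qed.
Let F_b v : F (pi b v) = pi b (F v) + pi a (FB v) + pi b (FDD v).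
Proof.
rewrite /FB /FDD -!lock /Fb /Fd !lE (pi_ad hpi) (pi_ab hpi); lmodq q0.
Qed.
Let F_c v : F (pi c v) = pi c (F v) + pi c (FA v) + pi d (FC v).
Proof.
rewrite /FA /FC -!lock /Fa /Fc !lE (pi_da hpi) (pi_cd hpi) (pi_cb hpi); lmodq q0.
Qed.
Let F_d v : F (pi d v) = pi d (F v) + pi c (FB v) + pi d (FDD v).
Proof.
rewrite /FB /FDD -!lock /Fb /Fd !lE (pi_da hpi) (pi_cd hpi) (pi_cb hpi); lmodq q0.
Qed.

Let FX0 : [/\ FA 0 = 0, FB 0 = 0 & FC 0 = 0].
Proof. by rewrite /FA /FB /FC -!lock /Fa /Fb /Fc !lE F0 !lE !scaler0 !subr0. Qed.

Let Fa_Fd_ker e : pi c e = 0 ->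
  FA e = pi d (F (pi a e)) - F e /\ FDD e = pi a (F (pi d e)) - F e.
Proof.
move=> ce; have be : pi b e = 0 by apply/ker_bc.
by rewrite /FA /FDD -!lock /Fa /Fd be ce F0 !lE !scaler0 !subr0.
Qed.

(** Commuting with [a] up to a nonzero scalar preserves the kernel of [a], and
    commuting with [d] propagates the action from there to all shells. *)
Let central_ker s t (X : K -> K) : X 0 = 0 -> s != 0 ->
  (forall v, D v -> op_central (hq := hq) pi s t X v) ->
  forall x, D0 x -> [/\ pi a (X x) = 0, X (pi b x) = t *: pi b (X x),
    X (pi c x) = s *: pi c (X x) & forall n, X (f n x) = t ^+ n *: f n (X x)].
Proof.
move=> X0 s0 XE x Dx; have [ax Db Dc] := hD0 Dx.
have Df n : D (f n x) by exact: core_shell.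
have [ea eb ec _] := XE _ (Df 0%N); rewrite !shell0 in ea eb ec.
split=> //.
  by apply: (scalerI s0); rewrite -ea ax X0 scaler0.
elim=> [|n IH]; first by rewrite expr0 scale1r.
have [_ _ _ ed] := XE _ (Df n).
by rewrite -!pi_d_shell ed IH lE scalerA exprS.
Qed.

Let qn : qC^-1 != 0. Proof. by rewrite invr_eq0. Qed.
Let qn2 : qC ^- 2 != 0. Proof. by rewrite invr_eq0 expf_neq0. Qed.

Let FA_ker x : D0 x -> [/\ pi a (FA x) = 0, FA (pi b x) = qC ^+ 2 *: pi b (FA x),
  FA (pi c x) = qC ^- 2 *: pi c (FA x)
  & forall n, FA (f n x) = (qC ^+ 2) ^+ n *: f n (FA x)].
Proof. by have [e _ _] := FX0; apply: (central_ker e qn2) => v /relL[]. Qed.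
Let FB_ker x : D0 x -> [/\ pi a (FB x) = 0, FB (pi b x) = qC *: pi b (FB x),
  FB (pi c x) = qC^-1 *: pi c (FB x)
  & forall n, FB (f n x) = qC ^+ n *: f n (FB x)].
Proof. by have [_ e _] := FX0; apply: (central_ker e qn) => v /relL[]. Qed.
Let FC_ker x : D0 x -> [/\ pi a (FC x) = 0, FC (pi b x) = qC *: pi b (FC x),
  FC (pi c x) = qC^-1 *: pi c (FC x)
  & forall n, FC (f n x) = qC ^+ n *: f n (FC x)].
Proof. by have [_ _ e] := FX0; apply: (central_ker e qn) => v /relL[]. Qed.

(* On the initial shell [F_a] reads a F x = - b FC x.  Since a d = k on ker pi(a),
   this determines the component U x of F x on the next shell, and what is left is
   the diagonal part.  Comparing with [Fb_shell] gives T. *)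
Let k := 1 - qC ^+ 2.
Let k0 : k != 0. Proof. exact: (qC_pow_neq1 hq 0). Qed.
Let T := locked (fun x => k^-1 *: pi c (FB x)).
Let U := locked (fun x => - k^-1 *: pi b (FC x)).
Let Fixpoint Rn n x :=
  if n is m.+1 then Rn m x - (qC ^+ 2 * (qC ^+ m) ^+ 2) *: FA x
  else F x - pi d (U x).

Let U_ker x : D0 x -> [/\ pi a (U x) = 0, U (pi b x) = qC *: pi b (U x)
  & U (pi c x) = qC^-1 *: pi c (U x)].
Proof.
move=> Dx; have [aC Cb Cc _] := FC_ker Dx; rewrite /U -lock; split.
- by rewrite lE (ker_a_b hpi) // scaler0.
- by rewrite Cb !lE; lmod.
- by rewrite Cc !lE (pi_cb hpi); lmod.
Qed.

Let b_FC x : pi b (FC x) = - k *: U x.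
Proof. by rewrite /U -lock scalerA mulrNN divff // scale1r. Qed.
Let c_FB x : pi c (FB x) = k *: T x.
Proof. by rewrite /T -lock scalerA divff // scale1r. Qed.

Let R_ker n x : D0 x ->
    [/\ pi a (Rn n x) = 0, Rn n.+1 x = Rn n x - (qC ^+ 2 * (qC ^+ n) ^+ 2) *: FA x,
        Rn n (pi b x) = pi b (Rn n.+1 x) & Rn n.+1 (pi c x) = pi c (Rn n x)].
Proof.
move=> Dx; have [ax Db Dc] := hD0 Dx; have Dx' : D x := core_shell hpi sE 0 Dx.
have [aA Ab Ac _] := FA_ker Dx; have [aB Bb Bc _] := FB_ker Dx.
have [aC Cb Cc _] := FC_ker Dx; have [aU Ub Uc] := U_ker Dx.
have [rd _ _ _] := relL Dx'.
elim: n => [|n [IHa _ IHb IHc]]; last first.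
  split=> //.
  - by rewrite /= in IHa *; rewrite !lE IHa aA scaler0 subr0.
  - rewrite [LHS]/= -/(Rn _ _) IHb Ab /= !lE [qC ^+ n.+1]exprS.
    move: (qC ^+ n) => Q; lmod.
  - rewrite -[Rn n.+2 _]/(Rn n.+1 _ - _) IHc Ac /= !lE [qC ^+ n.+1]exprS -exprVn.
    move: (qC ^+ n) => Q; lmodq q0.
split=> //.
- have := F_a x; rewrite ax F0 aA addr0 b_FC => /eqP.
  rewrite scaleNr eq_sym subr_eq0 => /eqP e.
  rewrite /= !lE e (pi_ad hpi) (ker_a_bc hpi) // /k; lmod.
- rewrite /= F_b Ub aB rd !lE (pi_bd hpi) expr0 expr1n.
  by lmod.
- rewrite /= F_c Ac Uc !lE (pi_cd hpi) expr0 expr1n.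
  have -> : FC x = - qC^-1 *: pi c (pi b (FC x)).
    by rewrite (pi_cb hpi) (ker_a_bc hpi) // scalerA mulrNN mulVf // scale1r.
  rewrite b_FC !lE /k -exprVn; lmodq q0.
Qed.

(** The rule for F d = d F + [F, d] computes [F] on each shell from the previous one,
    starting from the decomposition of [F] on the initial shell.  On [E], the vectors
    a FB e and d FC e lie both in ker pi(c) and in its orthogonal complement, hence
    vanish; this forces F e into ker pi(c). *)
Lemma op_form_of_relations : exists T' U' P Rn', op_form T' U' P Rn'.
Proof.
exists T, U, FA, Rn; split.
- move=> e Ee; have [ce Ea Ed] := hE Ee.
  have De : D e by exact: core_E.
  have [rd rA rB rC] := relL De; have [_ FB0 FC0] := FX0.
  have cB : pi c (FB e) = 0.
    by case: rB => _ _ + _; rewrite ce FB0 => /esym/eqP;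
      rewrite scaler_eq0 (negPf qn) => /eqP.
  have cC : pi c (FC e) = 0.
    by case: rC => _ _ + _; rewrite ce FC0 => /esym/eqP;
      rewrite scaler_eq0 (negPf qn) => /eqP.
  have be : pi b e = 0 by apply/ker_bc.
  have eB : pi a (FB e) = pi b (- (F e + FDD e)).
    by have := F_b e; rewrite be F0 !lE => e'; apply/eqP; rewrite -subr_eq0 e'; apply/eqP; lmod.
  have eC : pi d (FC e) = pi c (- (F e + FA e)).
    by have := F_c e; rewrite ce F0 !lE => e'; apply/eqP; rewrite -subr_eq0 e'; apply/eqP; lmod.
  have aB := ker_c_range_b hpi (ker_c_a hpi cB) eB.
  have dC := ker_c_range_c hpi (ker_c_d hpi cC) eC.
  have {}eB : pi c (- (F e + FDD e)) = 0 by apply: (ker_bc hpi _).1; rewrite -eB.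
  rewrite dC in eC; split.
    have rd' : FDD e = - qC ^+ 2 *: FA e by [].
    apply: (scalerI (qC2_neqN1 hq)); rewrite scaler0.
    have -> : (1 + qC ^+ 2) *: pi c (F e) =
      - (pi c (- (F e + FDD e)) + qC ^+ 2 *: pi c (- (F e + FA e))).
      by rewrite rd' !lE; lmod.
    by rewrite eB -eC scaler0 addr0 oppr0.
  have [eA eD] := Fa_Fd_ker ce.
  by move: rd; rewrite eA eD => /(canRL (subrK _)) ->; lmod.
- move=> n x Dx; have Dm m : D (f m x) by exact: core_shell.
  elim: n => [|n IH].
    by rewrite expr0 expr1n subrr scale0r add0r !shell0 -pi_d_shell shell0 subrK.
  have [_ _ _ Bf] := FB_ker Dx; have [_ _ _ Af] := FA_ker Dx.
  have [rd _ _ _] := relL (Dm n).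
  rewrite -pi_d_shell F_d IH rd Bf Af.
  have -> : (qC ^+ 2) ^+ n = (qC ^+ n) ^+ 2 by rewrite exprAC.
  rewrite !lE (pi_c_shell hpi) c_FB !pi_d_shell.
  have -> : (1 - (qC ^+ n) ^+ 2) *: pi d (f n.-1 (T x)) =
      (1 - (qC ^+ n) ^+ 2) *: f n (T x).
    by case: (n) => [|m] //; rewrite expr0 expr1n subrr !scale0r.
  rewrite /= !(shell_linE hpi) [qC ^+ n.+1]exprS /k; move: (qC ^+ n) => Q; lmod.
- move=> x Dx; have [aB Bb Bc _] := FB_ker Dx; rewrite /T -lock; split.
  + by rewrite lE (ker_a_c hpi) // scaler0.
  + by rewrite Bb !lE (pi_cb hpi); lmod.
  + by rewrite Bc !lE; lmod.
- exact: U_ker.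
- by move=> x /FA_ker[].
- exact: R_ker.
Qed.

End ToForm.
End Form.

(** * Hilbert spaces *)

Section Hilbert.
Variables (R : realType) (H : hilbert R).
Local Notation C := R[i].
Implicit Types (x y z : H) (D : set H).

Lemma innerC x y : '[x, y] = ('[y, x])^*.
Proof. by rewrite hermC /= expr0 mul1r. Qed.
Lemma innerDl x y z : '[x + y, z] = '[x, z] + '[y, z].
Proof. exact: linearDl. Qed.
Lemma innerDr x y z : '[x, y + z] = '[x, y] + '[x, z].
Proof. exact: linearDr. Qed.
Lemma innerNl x z : '[- x, z] = - '[x, z].
Proof. exact: linearNl. Qed.
Lemma innerNr x z : '[x, - z] = - '[x, z].
Proof. exact: linearNr. Qed.
Lemma innerZl k x z : '[k *: x, z] = k * '[x, z].
Proof. exact: linearZl_LR. Qed.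
Lemma innerZr k x z : '[x, k *: z] = k^* * '[x, z].
Proof. exact: linearZr_LR. Qed.
Lemma inner0l x : '[0, x] = 0 :> C.
Proof. exact: linear0l. Qed.
Lemma inner0r x : '[x, 0] = 0 :> C.
Proof. exact: linear0r. Qed.
Definition innerE := (innerDl, innerDr, innerNl, innerNr, innerZl, innerZr,
  inner0l, inner0r).

Lemma hnorm_ge0 x : 0 <= hnorm x.
Proof. by rewrite sqrtC_ge0 dnorm_ge0. Qed.
Lemma hnorm_sqr x : hnorm x ^+ 2 = '[x, x].
Proof. exact: sqrtCK. Qed.
Lemma hnorm0 : hnorm (0 : H) = 0.
Proof. by rewrite /hnorm inner0l sqrtC0. Qed.
Lemma hnormZ k x : hnorm (k *: x) = `|k| * hnorm x.
Proof.
rewrite /hnorm !innerE mulrA -normCK rootCMl ?exprn_ge0 ?normr_ge0 // sqrCK ?normr_ge0 //.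
Qed.
Lemma cauchy_schwarz x y : `|'[x, y]| <= hnorm x * hnorm y.
Proof.
have [->|y0] := eqVneq y 0; first by rewrite inner0r hnorm0 mulr0 normr0.
have p : 0 < '[y, y] by rewrite (dnorm_gt0 (@inner R H)).
rewrite -ler_sqr ?nnegrE ?mulr_ge0 ?hnorm_ge0 // exprMn !hnorm_sqr.
have yR : ('[y, y])^* = '[y, y] by rewrite -innerC.
pose t := '[x, y] / '[y, y].
have : 0 <= '[x - t *: y, x - t *: y] by exact: (dnorm_ge0 (@inner R H)).
have -> : '[x - t *: y, x - t *: y] = '[x, x] - `|'[x, y]| ^+ 2 / '[y, y].
  rewrite !innerE normCK /t rmorphM fmorphV /= yR [in '[y, x]]innerC.
  have := mulfV (lt0r_neq0 p); move: ('[y, y]^-1) => p1 e.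
  by ring: e.
by rewrite subr_ge0 ler_pdivrMr.
Qed.

Lemma hnorm_triangle x y : hnorm (x + y) <= hnorm x + hnorm y.
Proof.
rewrite -ler_sqr ?nnegrE ?addr_ge0 ?hnorm_ge0 // sqrrD !hnorm_sqr !innerE.
rewrite [in '[y, x]]innerC.
have : '[x, y] + ('[x, y])^* <= hnorm x * hnorm y *+ 2.
  rewrite -(ler_pM2r (x := 2^-1)) ?invr_gt0 ?ltr0n //.
  have <- : 'Re '[x, y] = ('[x, y] + ('[x, y])^*) / 2 by rewrite ReE.
  rewrite -mulr_natr mulfK ?pnatr_eq0 //.
  apply: le_trans (cauchy_schwarz x y).
  exact: (leif_Re_Creal _).1.
move=> e; rewrite -!addrA lerD2l !addrA lerD2r //.
Qed.

Definition hclosure D : set H :=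
  [set x | forall e : C, 0 < e -> exists y, D y /\ hnorm (x - y) < e].

Lemma sub_hclosure D : D `<=` hclosure D.
Proof. by move=> x Dx e e0; exists x; rewrite subrr hnorm0. Qed.

Lemma half_gt0 (e : C) : 0 < e -> 0 < e / 2.
Proof. by move=> e0; rewrite divr_gt0 ?ltr0n. Qed.

Lemma hnorm_split x y z (e : C) :
  hnorm (x - y) < e / 2 -> hnorm (y - z) < e / 2 -> hnorm (x - z) < e.
Proof.
move=> h1 h2; rewrite [e]splitr; apply: le_lt_trans (ltrD h1 h2).
by have := hnorm_triangle (x - y) (y - z); rewrite addrA subrK.
Qed.

Lemma hclosure_trans D D' : D `<=` hclosure D' -> hclosure D `<=` hclosure D'.
Proof.
move=> DD x Dx e /half_gt0 e0; have [y [/DD /(_ _ e0)[z [D'z yz]] xy]] := Dx _ e0.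
by exists z; split=> //; exact: hnorm_split yz.
Qed.

Lemma hclosure_subspace D : subspace D -> subspace (hclosure D).
Proof.
move=> sD; split; first exact/sub_hclosure/sD.1.
move=> k x y Dx Dy e /half_gt0 e0.
have k0 : 0 < `|k| + 1 by rewrite ltr_wpDl ?normr_ge0.
have [x' [Dx' xx']] := Dx _ (divr_gt0 e0 k0); have [y' [Dy' yy']] := Dy _ e0.
exists (k *: x' + y'); split; first exact: sD.2.
have -> : k *: x + y - (k *: x' + y') = k *: (x - x') + (y - y') by lmod.
rewrite [e]splitr; apply: le_lt_trans (hnorm_triangle _ _) _.
apply: ltr_leD => //; last exact: ltW.
rewrite hnormZ; apply: le_lt_trans (_ : (`|k| + 1) * hnorm (x - x') < _).
  by rewrite ler_wpM2r ?hnorm_ge0 // lerDl.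
by rewrite mulrC -ltr_pdivlMr.
Qed.

Lemma eq0_of_le_eps (z M : C) : 0 <= M ->
  (forall e : C, 0 < e -> `|z| <= M * e) -> z = 0.
Proof.
move=> M0 h; apply/eqP; rewrite -normr_eq0; apply/negPn/negP => z0.
have zp : 0 < `|z| by rewrite lt_def z0 normr_ge0.
have M1 : 0 < M + 1 by rewrite ltr_wpDl.
have := h _ (divr_gt0 zp M1); rewrite mulrA ler_pdivlMr // mulrC.
by rewrite ler_pM2r // gerDl => /(lt_le_trans ltr01); rewrite ltxx.
Qed.

(** Approximating both arguments in the graph norm, one after the other. *)
Lemma core_symmetric (F : pop H H) D : linear_op F -> is_core D F ->
  (forall x y, D x -> D y -> '[F x, y] = '[x, F y]) -> symmetric_op F.
Proof.
move=> lF [DF cF] sF; split=> //.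
have B x y : dom F x -> dom F y -> F (x - y) = F x - F y.
  by move=> Fx Fy; have := lF.2 (-1) y x Fy Fx; rewrite !scaleN1r addrC => ->;
    rewrite addrC.
have half x y : dom F x -> D y -> '[F x, y] = '[x, F y].
  move=> Fx Dy; apply/eqP; rewrite -subr_eq0; apply/eqP.
  apply: (@eq0_of_le_eps _ (hnorm y + hnorm (F y))).
    by rewrite addr_ge0 ?hnorm_ge0.
  move=> e e0; have [x' [Dx' xx' Fxx']] := cF _ _ Fx e0.
  have -> : '[F x, y] - '[x, F y] = '[F x - F x', y] - '[x - x', F y].
    by rewrite !innerE (sF x') //; ring.
  apply: le_trans (ler_normB _ _) _; rewrite mulrC mulrDr lerD //.
    by apply: le_trans (cauchy_schwarz _ _) _; rewrite ler_wpM2r ?hnorm_ge0 ?ltW.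
  by apply: le_trans (cauchy_schwarz _ _) _; rewrite ler_wpM2r ?hnorm_ge0 ?ltW.
move=> x y Fx Fy; apply/eqP; rewrite -subr_eq0; apply/eqP.
apply: (@eq0_of_le_eps _ (hnorm x + hnorm (F x))).
  by rewrite addr_ge0 ?hnorm_ge0.
move=> e e0; have [y' [Dy' yy' Fyy']] := cF _ _ Fy e0.
have -> : '[F x, y] - '[x, F y] = '[F x, y - y'] - '[x, F y - F y'].
  by rewrite !innerE (half x y') //; ring.
apply: le_trans (ler_normB _ _) _; rewrite mulrDl addrC lerD //.
  by apply: le_trans (cauchy_schwarz _ _) _; rewrite ler_wpM2l ?hnorm_ge0 ?ltW.
by apply: le_trans (cauchy_schwarz _ _) _; rewrite ler_wpM2l ?hnorm_ge0 ?ltW.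
Qed.

End Hilbert.

Section Adjoints.
Variables (R : realType) (H K : hilbert R).

Lemma adjoint_unique (T : pop H K) y z : hdense (dom T) ->
  adj_set T y z -> adjoint T y = z.
Proof.
move=> dT zy; apply: (hdense_eq dT) => x Tx.
by rewrite -(zy _ Tx) -(xgetPex 0 (ex_intro (adj_set T y) z zy)).
Qed.

Variables (u : H -> K) (hu : unitary u).

Lemma unitary_lin : linear u. Proof. by case: hu. Qed.
Lemma unitary_inner x y : '[u x, u y] = '[x, y]. Proof. by case: hu. Qed.
Lemma unitary_inj : injective u.
Proof.
move=> x y e; apply: inner_ext => z.
by rewrite -!unitary_inner e.
Qed.

Lemma unitary_adj y : u (badj u y) = y.
Proof.
case: hu => _ _ /(_ y)[x <-]; congr u; apply: adjoint_unique.
  by move=> z e e0; exists z; rewrite subrr hnorm0.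
by move=> z _; exact: unitary_inner.
Qed.
Lemma adj_unitary x : badj u (u x) = x.
Proof. by apply: unitary_inj; exact: unitary_adj. Qed.
Lemma unitary_adjE x y : '[u x, y] = '[x, badj u y].
Proof. by rewrite -{1}(unitary_adj y) unitary_inner. Qed.
Lemma badj_lin : linear (badj u).
Proof.
by move=> k x y; apply: unitary_inj; rewrite unitary_lin !unitary_adj.
Qed.

End Adjoints.

(** * Orthogonal complements as Hilbert spaces *)

(** An orthogonality condition is automatically closed, so every set [S] gives a
    Hilbert space; kernels of bounded operators are of this form. *)
Section Perp.
Variables (R : realType) (K : hilbert R) (S : set K).
Local Notation C := R[i].

Definition in_perp : {pred K} := fun v => `[< forall s, S s -> '[v, s] = 0 >].

Lemma in_perp_submod : submod_closed in_perp.
Proof.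
split=> [|z v w /asboolP vS /asboolP wS]; apply/asboolP => s Ss.
  by rewrite inner0l.
by rewrite !innerE vS // wS // mulr0 addr0.
Qed.
HB.instance Definition _ :=
  GRing.isSubmodClosed.Build C K in_perp in_perp_submod.

Record perp : Type := Perp { pval : K; pvalP : pval \in in_perp }.
HB.instance Definition _ := [isSub for pval].
HB.instance Definition _ := [Choice of perp by <:].
HB.instance Definition _ := [SubChoice_isSubLmodule of perp by <:].

Lemma pval_linear : linear pval. Proof. by []. Qed.
Lemma pval_inj : injective pval. Proof. exact: val_inj. Qed.

Definition perp_inner (x y : perp) : C := '[pval x, pval y].

Let inner_bilinear : bilinear_for
  (GRing.Scale.Law.clone _ _ *%R _) (GRing.Scale.Law.clone _ _ (Num.conj \; *%R) _)
  perp_inner.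
Proof.
by split=> [u|u] z x y; rewrite /perp_inner pval_linear !innerE.
Qed.
HB.instance Definition _ :=
  bilinear_isBilinear.Build C perp perp C _ _ perp_inner inner_bilinear.
Let inner_herm (x y : perp) : perp_inner x y = (-1) ^+ false * (perp_inner y x)^*.
Proof. by rewrite expr0 mul1r; exact: innerC. Qed.
HB.instance Definition _ :=
  isHermitianSesquilinear.Build C perp false Num.conj perp_inner inner_herm.
Let inner_pos (x : perp) : x != 0 -> 0 < perp_inner x x.
Proof.
move=> x0; rewrite (dnorm_gt0 (@inner R K)); apply: contraNneq x0 => e.
exact/eqP/pval_inj.
Qed.
HB.instance Definition _ := isDotProduct.Build C perp perp_inner inner_pos.

Lemma perp_complete (u : nat -> perp) :
  let norm x := sqrtC (perp_inner x x) in
  (forall e : C, 0 < e ->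
     exists N, forall m n, (N <= m)%N -> (N <= n)%N -> norm (u m - u n) < e) ->
  exists l, forall e : C, 0 < e ->
     exists N, forall n, (N <= n)%N -> norm (u n - l) < e.
Proof.
move=> /= cu; have [l ul] := @hilbert_complete R K (pval \o u) cu.
have lS : l \in in_perp.
  apply/asboolP => s Ss; apply: (@eq0_of_le_eps _ _ (hnorm s)).
    exact: hnorm_ge0.
  move=> e e0; have [N /(_ N (leqnn N)) uN] := ul _ e0.
  have -> : '[l, s] = - '[pval (u N) - l, s].
    have /asboolP/(_ _ Ss) := pvalP (u N); rewrite !innerE => ->.
    by rewrite sub0r opprK.
  rewrite normrN mulrC; apply: le_trans (cauchy_schwarz _ _) _.
  by rewrite ler_wpM2r ?hnorm_ge0 // ltW.
by exists (Perp lS).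
Qed.

Definition perp_hilbert : hilbert R :=
  @Hilbert R perp perp_inner perp_complete.

Lemma perpP (v : K) : (forall s, S s -> '[v, s] = 0) -> exists x : perp_hilbert, pval x = v.
Proof. by move=> vS; exists (Perp (introT (asboolP _) vS : v \in in_perp)). Qed.

End Perp.

(** * Inner products of shells and symmetry *)

Section ShellInner.
Variables (R : realType) (q : R) (hq : 0 < q < 1).
Local Notation C := R[i].
Local Notation A := (SUq2 hq).
Local Notation qC := ((q%:C)%C : C).
Local Notation a := (ua qC : A).
Local Notation b := (ub qC : A).
Local Notation c := (uc qC : A).
Local Notation d := (ud qC : A).
Variables (K : hilbert R) (pi : A -> K -> K) (hpi : is_star_rep pi).
Local Notation f := (shell pi).
Let q0 := qC_neq0 hq.

Lemma shell_coef_conj n : (1 - (qC ^+ n) ^+ 2)^* = 1 - (qC ^+ n) ^+ 2.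
Proof. by rewrite rmorphB rmorph1 !rmorphXn /= realC_conj. Qed.

Lemma shell_innerS m n x y : pi a y = 0 ->
  '[f m.+1 x, f n.+1 y] = (1 - (qC ^+ n.+1) ^+ 2) * '[f m x, f n y].
Proof.
move=> ay; rewrite -pi_d_shell (pi_adj_d hpi) (pi_a_shell hpi) // innerZr.
by rewrite shell_coef_conj.
Qed.

Lemma shell_orth m n x y : pi a x = 0 -> pi a y = 0 -> m != n ->
  '[f m x, f n y] = 0.
Proof.
move=> ax ay; elim: m n => [|m IH] [|n] //=; last first.
- by rewrite eqSS => /IH mn; rewrite shell_innerS // mn mulr0.
- by rewrite -pi_d_shell (pi_adj_d hpi) shell0 ay inner0r.
- by rewrite -pi_d_shell shell0 -(pi_adj_a hpi) ax inner0l.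
Qed.

Lemma shell_inner_eq n u v x y : pi a v = 0 -> pi a y = 0 ->
  '[u, y] = '[x, v] -> '[f n u, f n y] = '[f n x, f n v].
Proof.
move=> av ay e; elim: n => [|n IH]; first by rewrite !shell0.
by rewrite !shell_innerS // IH.
Qed.

(** Moving the powers of [d] to the other side leaves ker pi(a), which lies in the
    range of [b]. *)
Lemma ker_c_shell_orth n g x : pi c g = 0 -> pi a x = 0 -> '[g, f n x] = 0.
Proof.
move=> cg ax; elim: n g cg => [|n IH] g cg.
  have -> : x = - qC^-1 *: pi b (pi c x).
    by rewrite (ker_a_bc hpi) // scalerA mulrNN mulVf // scale1r.
  by rewrite shell0 innerZr innerC (pi_adj_b hpi) cg scaler0 inner0r rmorph0 mulr0.
by rewrite -pi_d_shell -(pi_adj_a hpi); apply/IH/ker_c_a.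
Qed.

Section Symmetry.
Variables (F : pop K K) (E D0 : set K).
Hypothesis sE : subspace E.
Hypothesis hE : forall x, E x -> [/\ pi c x = 0, E (pi a x) & E (pi d x)].
Hypothesis hD0 : forall x, D0 x -> [/\ pi a x = 0, D0 (pi b x) & D0 (pi c x)].
Local Notation D := (core_domain pi E D0).
Hypothesis F_lin : forall k x y, D x -> D y -> F (k *: x + y) = k *: F x + F y.
Variables (T U P : K -> K) (Rn : nat -> K -> K).
Hypothesis form : op_form pi F E D0 T U P Rn.

Let shift_adj m n x y : D0 x -> D0 y -> '[T x, y] = '[x, U y] ->
  '[(1 - (qC ^+ m) ^+ 2) *: f m.-1 (T x), f n y] = '[f m x, f n.+1 (U y)].
Proof.
move=> Dx Dy e; have [ax _ _] := hD0 Dx; have [ay _ _] := hD0 Dy.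
have [aT _ _] := form_T form Dx; have [aU _ _] := form_U form Dy.
case: m => [|m].
  by rewrite expr0 expr1n subrr scale0r inner0l shell_orth.
rewrite innerZl /= shell_innerS //; have [->|mn] := eqVneq m n; last first.
  by rewrite !shell_orth // !mulr0.
by congr (_ * _); exact: shell_inner_eq.
Qed.

(** The upper and the lower diagonal of [F] are interchanged by taking adjoints;
    [shift_adj] matches their coefficients through the norms of the shells. *)
Lemma form_symmetric :
  (forall x y, E x -> E y -> '[F x, y] = '[x, F y]) ->
  (forall x y, D0 x -> D0 y -> '[T x, y] = '[x, U y]) ->
  (forall n x y, D0 x -> D0 y -> '[Rn n x, y] = '[x, Rn n y]) ->
  forall x y, D x -> D y -> '[F x, y] = '[x, F y].
Proof.
move=> symE symT symR.
have E_shell n e x : E e -> D0 x ->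
    ('[F e, f n x] = 0) * ('[e, F (f n x)] = 0).
  move=> Ee Dx; have [ax _ _] := hD0 Dx; have [ce _ _] := hE Ee.
  have [aT _ _] := form_T form Dx; have [aU _ _] := form_U form Dx.
  have [aR _ _ _] := form_R form n Dx.
  have [cF _] := form_E form Ee.
  rewrite (form_shell form) // !innerE !ker_c_shell_orth //.
  by rewrite mulr0 !addr0.
have base (z : K) : D z -> (forall e, E e -> '[F e, z] = '[e, F z]) ->
    (forall n x, D0 x -> '[F (f n x), z] = '[f n x, F z]) ->
    forall x, D x -> '[F x, z] = '[x, F z].
  move=> Dz zE zf; apply: (core_ind hpi sE) => // k u v Du Dv eu ev.
  by rewrite F_lin // !innerE eu ev.
move=> x y Dx Dy; rewrite [LHS]innerC [RHS]innerC; congr (_^*); apply/esym.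
move: y Dy; apply: (base x Dx) => [e Ee|n y Dy].
  rewrite [LHS]innerC [RHS]innerC; congr (_^*); apply/esym.
  move: x Dx; apply: base => [|e' Ee'|n x Dx]; first exact: core_E.
    exact: symE.
  have [e1 e2] := E_shell n e x Ee Dx.
  by rewrite innerC e2 [RHS]innerC e1.
rewrite [LHS]innerC [RHS]innerC; congr (_^*); apply/esym.
move: x Dx; apply: base => [|e Ee|m x Dx]; first exact: core_shell.
  by rewrite !E_shell.
have [ax _ _] := hD0 Dx; have [ay _ _] := hD0 Dy.
have [aRx _ _ _] := form_R form m Dx; have [aRy _ _ _] := form_R form n Dy.
rewrite !(form_shell form) // !innerDl !innerDr shift_adj ?symT //.
have -> : '[f m.+1 (U x), f n y] = '[f m x, (1 - (qC ^+ n) ^+ 2) *: f n.-1 (T y)].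
  rewrite [LHS]innerC [RHS]innerC; congr (_^*); apply/esym.
  by rewrite shift_adj ?symT.
have -> : '[f m (Rn m x), f n y] = '[f m x, f n (Rn n y)].
  have [->|mn] := eqVneq m n; last by rewrite !shell_orth.
  have {}aRx : pi a (Rn n x) = 0 by have [] := form_R form n Dx.
  exact/shell_inner_eq/symR.
by ring.
Qed.

(** It suffices to test [F] between the shells 1 and 0, and within shell 0. *)
Lemma form_adjoint :
  (forall x y, D x -> D y -> '[F x, y] = '[x, F y]) ->
  forall x y, D0 x -> D0 y -> '[T x, y] = '[x, U y] /\ '[Rn 0 x, y] = '[x, Rn 0 y].
Proof.
move=> symF x y Dx Dy; have [ax _ _] := hD0 Dx; have [ay _ _] := hD0 Dy.
have [aTx _ _] := form_T form Dx; have [aUx _ _] := form_U form Dx.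
have [aTy _ _] := form_T form Dy; have [aUy _ _] := form_U form Dy.
have [aRx _ _ _] := form_R form 0 Dx; have [aRy _ _ _] := form_R form 0 Dy.
have [aRx1 _ _ _] := form_R form 1 Dx.
have Df n z : D0 z -> D (f n z) by move=> Dz; exact: core_shell.
split.
  have := symF _ _ (Df 1%N x Dx) (Df 0%N y Dy).
  rewrite !(form_shell form) // expr0 expr1n subrr scale0r add0r !innerDl !innerDr.
  rewrite (@shell_orth 1 0 (Rn 1 x)) // (@shell_orth 2 0) // (@shell_orth 1 0 x) //.
  rewrite !addr0 add0r shell_innerS // innerZl !shell0.
  exact/mulfI/qC_pow_neq1.
have := symF _ _ (Df 0%N x Dx) (Df 0%N y Dy).
rewrite !(form_shell form) // expr0 expr1n subrr !scale0r !add0r !innerDl !innerDr.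
by rewrite (@shell_orth 1 0) // (@shell_orth 0 1) // !addr0 !shell0.
Qed.

End Symmetry.
End ShellInner.

(** * From the model to admissible representations *)

Section StarHom.
Variables (R : realType) (q : R) (hq : 0 < q < 1).
Variables (G G' : star_fodc (SUq2 hq)).

Lemma star_hom_of_relations : is_3D G -> relations_3D G' ->
  exists rho : G -> G', star_fodc_hom rho.
Proof.
move=> h3 rel; have [rho [rho_lin rhoE]] := hom_of_relations (qC_neq0 hq) h3 rel.
exists rho; split=> // w.
elim/fodc_ind: w => [v w ev ew||x y z].
- have inv2 (H : star_fodc (SUq2 hq)) (v' w' : H) : invol (v' + w') = invol v' + invol w'.
    by have := involD 1 v' w'; rewrite rmorph1 !scale1r.
  by rewrite inv2 !(lin_add rho_lin) inv2 ev ew.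
- have inv0 (H : star_fodc (SUq2 hq)) : invol (0 : H) = 0.
    by have := @involD _ _ H 1 0 0; rewrite rmorph1 !scale1r addr0 => /(canLR (addrK _));
      rewrite subrr.
  by rewrite inv0 !(lin_zero rho_lin) inv0.
- by rewrite invol_diff !rhoE invol_diff.
Qed.

Lemma relations_of_star_hom (rho : G -> G') :
  is_3D G -> star_fodc_hom rho -> relations_3D G'.
Proof.
move=> h3 [rho_lin rhoE _].
exact/(relations_3D_hom rho_lin rhoE)/(is_3D_relations (qC_neq0 hq)).
Qed.

End StarHom.

Section Lambda.
Variables (R : realType) (q : R) (hq : 0 < q < 1).
Local Notation qC := ((q%:C)%C : R[i]).

Lemma lambda_sqr n : lambda q n ^+ 2 = 1 - (qC ^+ n) ^+ 2.
Proof.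
case/andP: hq => q0 q1; rewrite /lambda -rmorphXn /= sqr_sqrtr; last first.
  by rewrite subr_ge0 exprn_ile1 // ltW.
by rewrite rmorphB rmorph1 rmorphXn -exprM mulnC.
Qed.

Lemma lambda_conj n : (lambda q n)^* = lambda q n.
Proof. exact: realC_conj. Qed.

Lemma lambda0 : lambda q 0 = 0.
Proof. by apply/eqP; rewrite -sqrf_eq0 lambda_sqr expr0 expr1n subrr. Qed.

Lemma lambdaS_neq0 n : lambda q n.+1 != 0.
Proof. by rewrite -sqrf_eq0 lambda_sqr (qC_pow_neq1 hq). Qed.

(** The norm of pi(d^n) on ker pi(a), which relates shells to the vectors eta_n. *)
Definition shell_norm n : R[i] := \prod_(k < n) lambda q k.+1.

Lemma shell_norm0 : shell_norm 0 = 1. Proof. exact: big_ord0. Qed.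
Lemma shell_normS n : shell_norm n.+1 = lambda q n.+1 * shell_norm n.
Proof. by rewrite /shell_norm big_ord_recr mulrC. Qed.
Lemma shell_norm_neq0 n : shell_norm n != 0.
Proof.
elim: n => [|n IH]; first by rewrite shell_norm0 oner_neq0.
by rewrite shell_normS mulf_neq0 ?lambdaS_neq0.
Qed.
Lemma shell_norm_conj n : (shell_norm n)^* = shell_norm n.
Proof.
elim: n => [|n IH]; first by rewrite shell_norm0 rmorph1.
by rewrite shell_normS rmorphM /= IH lambda_conj.
Qed.

End Lambda.

Lemma lin_sub_lin (K : nzRingType) (V : lmodType K) (X Y : set V) :
  X `<=` lin Y -> lin X `<=` lin Y.
Proof.
move=> XY x; elim/lin_ind => [|k {}x y Xx _ Yy]; first exact: (lin_subspace Y).1.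
by apply: (lin_subspace Y).2 => //; exact: XY.
Qed.

Section Forward.
Variables (R : realType) (q : R) (hq : 0 < q < 1).
Local Notation C := R[i].
Local Notation A := (SUq2 hq).
Local Notation qC := ((q%:C)%C : C).
Local Notation a := (ua qC : A).
Local Notation b := (ub qC : A).
Local Notation c := (uc qC : A).
Local Notation d := (ud qC : A).
Variables (G H0 K : hilbert R) (S : hilbert_sum G H0 K).
Variables (pi : A -> K -> K) (F : pop K K).
Variables (v : G -> G) (w : H0 -> H0) (T Rop : pop H0 H0) (D0 : set H0)
  (Q : pop G G) (E : set G).
Hypothesis mr : model_rep S v w pi.
Let hpi := mr_rep mr.
Let q0 := qC_neq0 hq.
Local Notation i := (inG S).
Local Notation j := (inH S 0).
Local Notation f := (shell pi).
Local Notation mu := (shell_norm q).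

Let E' := [set i e | e in E].
Let D0' := [set j x | x in D0].
Let w_lin := unitary_lin (mr_w mr).
Let w'_lin := badj_lin (mr_w mr).
Let ww' := unitary_adj (mr_w mr).
Let w'w := adj_unitary (mr_w mr).
Let v'v := adj_unitary (mr_v mr).
Let i_lin := inG_linear S.
Let j_lin n := inH_linear S n.

Lemma model_ker_a x : pi a (j x) = 0.
Proof. by rewrite (mr_Ha mr) lambda0 // scale0r. Qed.

Lemma model_shell n x : f n (j x) = mu n *: inH S n x.
Proof.
elim: n => [|n IH]; first by rewrite shell0 shell_norm0 scale1r.
rewrite -pi_d_shell IH (lin_scale (pi_lin hpi d)) (mr_Hd mr) scalerA.
by rewrite shell_normS mulrC.
Qed.

Lemma model_core : core_domain pi E' D0' = model_domain S D0 E.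
Proof.
have lin_eq : lin [set z | exists n eta, D0' eta /\ z = pi (d ^+ n) eta] =
    lin [set z | exists n eta, D0 eta /\ z = inH S n eta].
  apply/seteqP; split; apply: lin_sub_lin => z [n [eta []]].
    move=> [x Dx <-] ->; rewrite -(shellE hpi) model_shell.
    by apply: (subspaceZ (lin_subspace _)); apply: sub_lin; exists n, x.
  move=> Dx ->.
  have -> : inH S n eta = (mu n)^-1 *: f n (j eta).
    by rewrite model_shell scalerA mulVf ?scale1r // shell_norm_neq0.
  apply: (subspaceZ (lin_subspace _)); apply: sub_lin; exists n, (j eta).
  by split; [exists eta | rewrite shellE].
by rewrite /core_domain /model_domain lin_eq.
Qed.

Section Data.
Hypothesis da : data_a q w T Rop D0.
Hypothesis db : data_b q v Q E.
Hypothesis dc : data_c q S w T Rop D0 Q E F.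
Local Notation w' := (badj w).
Local Notation v' := (badj v).
Let U := adjoint T.

Let T_lin : linear_op T. Proof. by case: da. Qed.
Let R_sym : symmetric_op Rop. Proof. by case: da. Qed.
Let sD0 : subspace D0. Proof. by case: da => _ _ []. Qed.
Let dD0 : hdense D0. Proof. by case: da => _ _ []. Qed.
Let D0_dom x : D0 x -> [/\ dom T x, dom U x & dom Rop x].
Proof. by case: da => _ _ _ [h _] _ /h[[]]. Qed.
Let D0_w x : D0 x -> D0 (w x).
Proof. by case: da => _ _ _ [_ e] _ Dx; rewrite -e; exists x. Qed.
Let D0_w' x : D0 x -> D0 (w' x).
Proof. by case: da => _ _ _ [_ e] _; rewrite -{1}e => -[y Dy <-]; rewrite w'w. Qed.
Let sE : subspace E. Proof. by case: db => _ []. Qed.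
Let dE : hdense E. Proof. by case: db => _ []. Qed.
Let E_dom x : E x -> dom Q x. Proof. by case: db => _ _ h _ _ /h. Qed.
Let E_v x : E x -> E (v x).
Proof. by case: db => _ _ _ e _ Ex; rewrite -e; exists x. Qed.
Let E_v' x : E x -> E (v' x).
Proof. by case: db => _ _ _ e _; rewrite -{1}e => -[y Ey <-]; rewrite v'v. Qed.

Let opZ (H H' : hilbert R) (X : pop H H') k x : linear_op X -> dom X x ->
  X (k *: x) = k *: X x.
Proof.
move=> [[X0 _] lX] dx; have := lX k _ _ dx X0; rewrite addr0 => ->.
by have := lX (-1) _ _ X0 X0; rewrite scaler0 addr0 scaleN1r addNr => ->; rewrite addr0.
Qed.

Let T_w' x : D0 x -> T (w' x) = qC *: w' (T x).
Proof.
by case: da => _ _ _ _ /(_ x) + Dx => /(_ Dx)[e _];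
  rewrite -(lin_scale w'_lin) -e w'w.
Qed.
Let T_w x : D0 x -> T (w x) = qC^-1 *: w (T x).
Proof.
by move=> Dx; rewrite -{2}(w'w x) T_w' ?(lin_scale w_lin) ?ww' ?scalerA ?mulVf
  ?scale1r //; exact: D0_w.
Qed.

Let U_adj x y : D0 x -> D0 y -> '[T x, y] = '[x, U y].
Proof.
move=> /D0_dom[Tx _ _] /D0_dom[_ [z zy] _].
exact: (xgetPex 0 (ex_intro (adj_set T y) z zy)).
Qed.
(* As [D0] is dense, identities for the adjoint on [D0] follow from those for [T]. *)
Let U_eq x y : D0 y -> (forall z, D0 z -> '[T z, y] = '[z, x]) -> U y = x.
Proof. by move=> Dy e; apply: (hdense_eq dD0) => z Dz; rewrite -U_adj // e. Qed.
Let U_w' x : D0 x -> U (w' x) = qC *: w' (U x).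
Proof.
move=> Dx; apply: U_eq => [|z Dz]; first exact: D0_w'.
rewrite -(unitary_adjE (mr_w mr)) innerZr realC_conj -(unitary_adjE (mr_w mr)).
rewrite -U_adj // ?T_w // ?innerZl ?mulrA ?mulfV ?mul1r //; exact: D0_w.
Qed.
Let U_w x : D0 x -> U (w x) = qC^-1 *: w (U x).
Proof.
by move=> Dx; rewrite -{2}(w'w x) U_w' ?(lin_scale w_lin) ?ww' ?scalerA ?mulVf
  ?scale1r //; exact: D0_w.
Qed.
Let UZ k x : D0 x -> U (k *: x) = k *: U x.
Proof.
move=> Dx; apply: U_eq => [|z Dz]; first exact: (subspaceZ sD0).
by rewrite !innerZr U_adj.
Qed.

Let Rn n x := iter n w (Rop (iter n w' x)).
Let P x := w' (Rop (w x)) - Rop x.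

Let iter_lin (H : hilbert R) (u : H -> H) n : linear u -> linear (iter n u).
Proof. by move=> lu k x y; elim: n => //= n ->; rewrite lu. Qed.
Let D0_iter n x : D0 x -> D0 (iter n w' x).
Proof. by move=> Dx; elim: n => //= n; exact: D0_w'. Qed.

Let RnZ n k x : D0 x -> Rn n (k *: x) = k *: Rn n x.
Proof.
move=> Dx; have [_ _ Rx] := D0_dom (D0_iter n Dx).
by rewrite /Rn (lin_scale (iter_lin n w'_lin)) opZ ?(lin_scale (iter_lin n w_lin)) //;
  case: R_sym.
Qed.
Let PZ k x : D0 x -> P (k *: x) = k *: P x.
Proof.
move=> Dx; have [_ _ Rx] := D0_dom Dx; have [_ _ Rwx] := D0_dom (D0_w Dx).
by rewrite /P (lin_scale w_lin) !opZ ?(lin_scale w'_lin) ?scalerBr //; case: R_sym.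
Qed.
Let Rn_w n x : Rn n.+1 (w x) = w (Rn n x).
Proof. by rewrite /Rn [iter n.+1 w' _]iterSr w'w. Qed.
Let Rn_w' n x : Rn n (w' x) = w' (Rn n.+1 x).
Proof. by rewrite /Rn [iter n.+1 w' _]iterSr iterS w'w. Qed.

(* The second order relation for [Rop] says that successive differences of [Rn]
   scale by q^2; this yields the closed recursion [RS]. *)
Let R1 x : D0 x -> Rn 1 x = Rn 0 x - qC ^+ 2 *: P x.
Proof.
move=> Dx; case: da => _ _ _ _ /(_ _ (D0_w Dx))[_].
move/(congr1 w'); rewrite !w'w (lin_add w'_lin) !(lin_scale w'_lin) !w'w.
by move/(canRL (addrK _)); rewrite /Rn /P /= => ->; lmod.
Qed.
Let P_w'w x : D0 x -> w (P (w' x)) = qC ^+ 2 *: P x.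
Proof.
move=> Dx; rewrite /P (lin_sub w_lin) !ww' -/(P x).
by have := R1 Dx; rewrite /Rn /= => ->; lmod.
Qed.
Let P_w' x : D0 x -> P (w' x) = qC ^+ 2 *: w' (P x).
Proof. by move=> Dx; rewrite -(lin_scale w'_lin) -P_w'w // w'w. Qed.
Let P_w x : D0 x -> P (w x) = qC ^- 2 *: w (P x).
Proof.
move=> Dx; apply: (scalerI (expf_neq0 2 q0)).
by rewrite -P_w'w ?w'w ?scalerA ?divff ?expf_neq0 ?scale1r //; exact: D0_w.
Qed.
Let RS n x : D0 x -> Rn n.+1 x = Rn n x - (qC ^+ 2 * (qC ^+ n) ^+ 2) *: P x.
Proof.
elim: n x => [|n IH] x Dx; first by rewrite R1 // expr0 expr1n mulr1.
have := D0_w' Dx => Dx'.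
rewrite -{1}(ww' x) Rn_w IH // (lin_sub w_lin) (lin_scale w_lin) P_w'w //.
by rewrite -Rn_w ww' [qC ^+ n.+1]exprS; move: (qC ^+ n) => X; lmod.
Qed.

Let Q_v x : E x -> v (Q (v' x)) + qC ^+ 2 *: v' (Q (v x)) = (1 + qC ^+ 2) *: Q x.
Proof.
move=> Ex; have v'_lin := badj_lin (mr_v mr).
case: db => _ _ _ _ /(_ _ (E_v Ex)).
by move/(congr1 v'); rewrite !v'v (lin_add v'_lin) !(lin_scale v'_lin) !v'v.
Qed.

Let sub_im (H : hilbert R) (u : H -> K) (X : set H) : linear u -> subspace X ->
  subspace [set u x | x in X].
Proof.
move=> lu sX; split; first by exists 0; [exact: sX.1 | exact: lin_zero].
by move=> k _ _ [x Xx <-] [y Xy <-]; exists (k *: x + y); [exact: sX.2 | exact: lu].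
Qed.
Let sE' : subspace E'. Proof. exact: sub_im. Qed.
Let sD0' : subspace D0'. Proof. exact: sub_im. Qed.

Let hE' x : E' x -> [/\ pi c x = 0, E' (pi a x) & E' (pi d x)].
Proof.
move=> [e Ee <-]; split; first exact: (mr_Gc mr).
  by rewrite (mr_Ga mr); exists (v e) => //; exact: E_v.
by rewrite (mr_Gd mr); exists (v' e) => //; exact: E_v'.
Qed.
Let pi_c_j x : pi c (j x) = j (w x).
Proof. by rewrite (mr_Hc mr) expr0 scale1r. Qed.
Let pi_b_j x : pi b (j x) = j (- qC *: w' x).
Proof. by rewrite (mr_Hb mr) expr1 (lin_scale (j_lin 0)). Qed.
Let hD0' x : D0' x -> [/\ pi a x = 0, D0' (pi b x) & D0' (pi c x)].
Proof.
move=> [e De <-]; split; first exact: model_ker_a.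
  by rewrite pi_b_j; exists (- qC *: w' e) => //; apply/(subspaceZ sD0)/D0_w'.
by rewrite pi_c_j; exists (w e) => //; exact: D0_w.
Qed.

Local Notation D := (core_domain pi E' D0').
Let sD : subspace D. Proof. exact: core_subspace. Qed.
Let F_linop : linear_op F. Proof. by case: dc. Qed.
Let D_core : is_core D F. Proof. by rewrite model_core; case: dc. Qed.
Let F_lin k x y : D x -> D y -> F (k *: x + y) = k *: F x + F y.
Proof. by move=> /D_core.1 Fx /D_core.1 Fy; exact: F_linop.2. Qed.

Let j_inj : injective j.
Proof.
by move=> x y e; apply: inner_ext => z; rewrite -!(inH_isom S 0) e.
Qed.
(* A left inverse of [j], needed to turn maps of [H0] into maps of [K]. *)
Let p x : H0 := xget 0 [set y | j y = x].
Let pj x : p (j x) = x.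
Proof. by apply/j_inj/(xgetPex 0 (ex_intro (fun y => j y = j x) x erefl)). Qed.

Let model_form : op_form pi F E' D0' (j \o T \o p) (j \o U \o p) (j \o P \o p)
  (fun n => j \o Rn n \o p).
Proof.
have [_ _ Fj Fi] := dc.
split.
- move=> _ [e Ee <-]; rewrite !(mr_Ga mr, mr_Gd mr) !Fi //; try exact: E_v; try exact: E_v'.
  rewrite (mr_Gc mr) !(mr_Ga mr, mr_Gd mr); split=> //.
  by rewrite -!(lin_scale i_lin) -(lin_add i_lin) Q_v.
- move=> n _ [x Dx <-]; rewrite /comp !pj !model_shell.
  have Dn : dom F (inH S n x).
    apply: D_core.1; rewrite model_core; exists 0.
      by exists 0; [exact: sE.1 | exact: (lin_zero i_lin)].
    by exists (inH S n x); rewrite ?add0r //; apply: sub_lin; exists n, x.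
  rewrite opZ // Fj // !scalerDr !scalerA shell_normS -(lambda_sqr hq) expr2.
  rewrite [mu n * lambda q n.+1]mulrC; congr (_ + _ + _).
  case: n {Dn} => [|n]; first by rewrite lambda0 // mulr0 !mul0r !scale0r.
  by rewrite shell_normS /=; congr (_ *: _); ring.
- move=> _ [x Dx <-]; rewrite /comp model_ker_a pi_b_j pi_c_j !pj pi_b_j pi_c_j; split=> //.
    have [Tx _ _] := D0_dom (D0_w' Dx).
    by rewrite opZ // T_w' // -(lin_scale (j_lin 0)); congr j; lmod.
  by rewrite T_w // -(lin_scale (j_lin 0)).
- move=> _ [x Dx <-]; rewrite /comp model_ker_a pi_b_j pi_c_j !pj pi_b_j pi_c_j; split=> //.
    rewrite UZ ?U_w' // -?(lin_scale (j_lin 0)); last exact: D0_w'.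
    by congr j; lmod.
  by rewrite U_w // -(lin_scale (j_lin 0)).
- move=> _ [x Dx <-]; rewrite /comp model_ker_a pi_b_j pi_c_j !pj pi_b_j pi_c_j; split=> //.
    rewrite PZ ?P_w' // -?(lin_scale (j_lin 0)); last exact: D0_w'.
    by congr j; lmod.
  by rewrite P_w // -(lin_scale (j_lin 0)).
- move=> n _ [x Dx <-]; rewrite /comp model_ker_a pi_b_j pi_c_j !pj pi_b_j pi_c_j.
  split=> //.
  + by rewrite RS // (lin_sub (j_lin 0)) (lin_scale (j_lin 0)).
  + by rewrite RnZ ?Rn_w' //; exact: D0_w'.
  + by rewrite Rn_w.
Qed.

Let iter_adj n x y : '[iter n w x, y] = '[x, iter n w' y].
Proof.
elim: n x y => //= n IH x y.
by rewrite (unitary_adjE (mr_w mr)) IH -iterSr.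
Qed.

Let F_sym : symmetric_op F.
Proof.
apply: (core_symmetric F_linop D_core).
apply: (form_symmetric hpi sE' hE' hD0' F_lin model_form).
- have [_ _ _ Fi] := dc; move=> _ _ [x Ex <-] [y Ey <-].
  rewrite !Fi // !(inG_isom S); case: db => -[_ Q_sym] _ _ _ _.
  by apply: Q_sym; exact: E_dom.
- by move=> _ _ [x Dx <-] [y Dy <-]; rewrite /comp !pj !(inH_isom S) U_adj.
- move=> n _ _ [x Dx <-] [y Dy <-]; rewrite /comp !pj !(inH_isom S) /Rn.
  rewrite iter_adj [RHS]innerC iter_adj -innerC.
  have [_ _ Rx] := D0_dom (D0_iter n Dx); have [_ _ Ry] := D0_dom (D0_iter n Dy).
  by case: R_sym => _; exact.
Qed.

Let D_dense : hdense D.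
Proof.
have scl := hclosure_subspace sD.
have isom_cl (H : hilbert R) (u : H -> K) (X : set H) x : linear u ->
    (forall y z, '[u y, u z] = '[y, z]) -> hdense X ->
    (forall y, X y -> D (u y)) -> hclosure D (u x).
  move=> lu iu dX XD e e0; have [y [Xy xy]] := dX x e e0.
  exists (u y); split; first exact: XD.
  by rewrite -(lin_sub lu) /hnorm iu.
suff h : [set inG S x + y | x in setT
    & y in lin [set z | exists n eta, z = inH S n eta]] `<=` hclosure D.
  by move=> x; exact: (hclosure_trans h (@sum_dense _ _ _ _ S x)).
move=> _ [x _ [y yl <-]]; apply: (subspaceD scl).
  apply: (isom_cl _ _ E) => //; first exact: (inG_isom S).
  by move=> e Ee; apply: core_E => //; exists e.
elim/lin_ind: yl => [|k z y' [n [eta ->]] _ Dy]; first exact: scl.1.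
apply: scl.2 => //; apply: (isom_cl _ _ D0) => //; first exact: (inH_isom S).
move=> e De; rewrite model_core; exists 0.
  by exists 0; [exact: sE.1 | exact: (lin_zero i_lin)].
by exists (inH S n e); rewrite ?add0r //; apply: sub_lin; exists n, e.
Qed.

(** The model has the form required by [op_relations_of_form], and its symmetry
    and density follow from those of the data. *)
Lemma model_admissible (Gam : star_fodc A) : is_3D Gam ->
  admissible_comm_rep Gam pi F.
Proof.
move=> h3; have D_pi x u : D u -> D (pi x u) by exact: core_stable.
have h : comm_setting pi F D.
  split=> //.
  - move=> x e e0; have [y [Dy xy]] := D_dense x e0.
    by exists y; split=> //; exact: D_core.1.
  - exact: D_core.1.
  - by move=> x u /(D_pi x)/D_core.1.
exists E', D0'; split=> //; split=> //; exists h.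
apply: star_hom_of_relations => //; apply/op_relationsP => // u Du.
exact: (op_relations_of_form hpi sE' hE' hD0' F_lin model_form).
Qed.

End Data.

End Forward.

(** * From admissible representations to the model *)

(** Pythagoras: the projection is the nearest point. *)
Lemma hnorm_orth_le (R : realType) (H : hilbert R) (u z : H) :
  '[u, z] = 0 -> hnorm u <= hnorm (u - z).
Proof.
move=> e; rewrite -ler_sqr ?nnegrE ?hnorm_ge0 // !hnorm_sqr !innerE e.
have -> : '[z, u] = 0 by rewrite innerC e rmorph0.
by rewrite oppr0 addr0 add0r opprK lerDl (dnorm_ge0 (@inner R H)).
Qed.

Section Backward.
Variables (R : realType) (q : R) (hq : 0 < q < 1).
Local Notation C := R[i].
Local Notation A := (SUq2 hq).
Local Notation qC := ((q%:C)%C : C).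
Local Notation a := (ua qC : A).
Local Notation b := (ub qC : A).
Local Notation c := (uc qC : A).
Local Notation d := (ud qC : A).
Variables (K : hilbert R) (pi : A -> K -> K) (hpi : is_star_rep pi).
Local Notation f := (shell pi).
Local Notation mu := (shell_norm q).
Let q0 := qC_neq0 hq.
Let lE := pi_linE hpi.

(** The kernels of pi(c) and pi(a), written as orthogonal complements. *)
Definition ker_c_space : hilbert R := perp_hilbert (range (pi b)).
Definition ker_a_space : hilbert R := perp_hilbert (range (pi d)).
Local Notation G := ker_c_space.
Local Notation H0 := ker_a_space.
Let i (x : G) : K := pval x.
Let j (x : H0) : K := pval x.

Let i_ker x : pi c (i x) = 0.
Proof.
apply: (scalerI (a := - qC)); first by rewrite oppr_eq0.
rewrite scaler0; apply: inner_ext => y; rewrite inner0l innerC -(pi_adj_b hpi) innerC.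
have /asboolP/(_ (pi b y)) e := pvalP x.
by rewrite /i e ?rmorph0 //; exists y.
Qed.
Let j_ker x : pi a (j x) = 0.
Proof.
apply: inner_ext => y; rewrite inner0l (pi_adj_a hpi).
by have /asboolP := pvalP x; apply; exists y.
Qed.

Let pG (x : K) : G := xget 0 [set y | i y = x].
Let pH (x : K) : H0 := xget 0 [set y | j y = x].
Let pGK x : pi c x = 0 -> i (pG x) = x.
Proof.
move=> cx; have [y yx] : exists y : G, pval y = x.
  apply: perpP => _ [z _ <-].
  by rewrite innerC (pi_adj_b hpi) cx scaler0 inner0r rmorph0.
exact: (xgetPex 0 (ex_intro (fun y => i y = x) y yx)).
Qed.
Let pHK x : pi a x = 0 -> j (pH x) = x.
Proof.
move=> ax; have [y yx] : exists y : H0, pval y = x.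
  by apply: perpP => _ [z _ <-]; rewrite -(pi_adj_a hpi) ax inner0l.
exact: (xgetPex 0 (ex_intro (fun y => j y = x) y yx)).
Qed.
Let i_inj : injective i. Proof. exact: pval_inj. Qed.
Let j_inj : injective j. Proof. exact: pval_inj. Qed.
Let i_lin : linear i. Proof. by []. Qed.
Let j_lin : linear j. Proof. by []. Qed.

Definition ker_c_unitary (x : G) : G := pG (pi a (i x)).
Definition ker_a_unitary (x : H0) : H0 := pH (pi c (j x)).
Local Notation v := ker_c_unitary.
Local Notation w := ker_a_unitary.
Let vE x : i (v x) = pi a (i x). Proof. exact/pGK/ker_c_a/i_ker. Qed.
Let wE x : j (w x) = pi c (j x). Proof. exact/pHK/ker_a_c/j_ker. Qed.
Let c_b x : pi a x = 0 -> pi c (- qC^-1 *: pi b x) = x.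
Proof.
by move=> ax; rewrite lE (pi_cb hpi) (ker_a_bc hpi) // scalerA mulrNN mulVf ?scale1r.
Qed.

Lemma ker_c_unitaryP : unitary v.
Proof.
split=> [k x y|x y|y].
- by apply: i_inj; rewrite vE !i_lin !vE (pi_lin hpi).
- rewrite -[LHS]/('[i (v x), i (v y)]) !vE (pi_adj_a hpi) (ker_c_da hpi) //.
- exists (pG (pi d (i y))); apply: i_inj.
  have cy : pi c (pi d (i y)) = 0 by apply: ker_c_d.
  by rewrite vE pGK // (ker_c_ad hpi).
Qed.
Lemma ker_a_unitaryP : unitary w.
Proof.
split=> [k x y|x y|y].
- by apply: j_inj; rewrite wE !j_lin !wE (pi_lin hpi).
- rewrite -[LHS]/('[j (w x), j (w y)]) !wE (pi_adj_c hpi) (ker_a_bc hpi) //.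
  by rewrite scalerA mulrNN mulVf // scale1r.
- exists (pH (- qC^-1 *: pi b (j y))); apply: j_inj.
  have ay : pi a (- qC^-1 *: pi b (j y)) = 0.
    by rewrite lE (ker_a_b hpi) ?scaler0.
  by rewrite wE pHK // c_b.
Qed.
Local Notation v' := (badj v).
Local Notation w' := (badj w).
Let v'E x : i (v' x) = pi d (i x).
Proof. by rewrite -{2}(unitary_adj ker_c_unitaryP x) vE (ker_c_da hpi). Qed.
Let w'E x : j (w' x) = - qC^-1 *: pi b (j x).
Proof.
rewrite -{2}(unitary_adj ker_a_unitaryP x) wE (ker_a_bc hpi) //.
by rewrite scalerA mulrNN mulVf // scale1r.
Qed.

Definition normed_shell n (x : H0) : K := (mu n)^-1 *: f n (j x).
Local Notation h_ := normed_shell.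

Let shell_normed n x : f n (j x) = mu n *: h_ n x.
Proof. by rewrite /h_ scalerA divff ?shell_norm_neq0 // scale1r. Qed.

Let h_isom n x y : '[h_ n x, h_ n y] = '[x, y].
Proof.
rewrite !innerE fmorphV /= shell_norm_conj // -[RHS]/('[j x, j y]).
have -> : '[f n (j x), f n (j y)] = mu n ^+ 2 * '[j x, j y].
  elim: n => [|n IH]; first by rewrite shell_norm0 !shell0 expr1n mul1r.
  by rewrite (shell_innerS hpi) // IH shell_normS exprMn (lambda_sqr hq) mulrA.
by rewrite expr2 -mulrA mulKf ?shell_norm_neq0 // mulKf ?shell_norm_neq0.
Qed.

Section Sum.
Hypothesis dense : hdense [set i x + y | x in setT
    & y in lin [set z | exists n x, z = h_ n x]].

Definition rep_sum : hilbert_sum G H0 K.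
Proof.
refine (@HilbertSum R G H0 K i h_ i_lin _ (fun _ _ => erefl) h_isom _ _ dense).
- by move=> n k x y; rewrite /h_ j_lin (shell_lin hpi) scalerDr !scalerA mulrC.
- by move=> m n x y mn; rewrite !innerE (shell_orth hpi) // !mulr0.
- by move=> n x y; rewrite !innerE (ker_c_shell_orth hpi) // mulr0.
Defined.

Lemma rep_sum_model : model_rep rep_sum v w pi.
Proof.
split.
- exact: ker_c_unitaryP.
- exact: ker_a_unitaryP.
- exact: hpi.
- by move=> x; exact: esym (vE x).
- by move=> x; exact: esym (v'E x).
- by move=> x; exact: (ker_bc hpi _).2 (i_ker x).
- by move=> x; exact: i_ker.
- move=> n x; rewrite -[inH _ n x]/(h_ n x) /h_ lE (pi_a_shell hpi) //.
  rewrite -(lambda_sqr hq); case: n => [|n].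
    by rewrite lambda0 // expr0n /= !scale0r !scaler0.
  rewrite -[inHp _ _ _]/(h_ n x) /h_ /= shell_normS !scalerA; congr (_ *: _).
  have := lambdaS_neq0 hq n => l0; rewrite invfM expr2.
  by rewrite mulrACA mulVf // mul1r mulrC.
- move=> n x; rewrite -[inH _ n x]/(h_ n x) -[inH _ n.+1 x]/(h_ n.+1 x).
  rewrite /h_ lE pi_d_shell shell_normS scalerA invfM mulrA.
  by rewrite divff ?mul1r // lambdaS_neq0.
- move=> n x; rewrite -[inH _ n x]/(h_ n x) -[inH _ n (w x)]/(h_ n (w x)).
  by rewrite /h_ lE (pi_c_shell hpi) wE !scalerA mulrC.
- move=> n x; rewrite -[inH _ n x]/(h_ n x) -[inH _ n (w' x)]/(h_ n (w' x)).
  rewrite /h_ lE (pi_b_shell hpi) w'E (shell_linE hpi) !scalerA.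
  congr (_ *: _); rewrite exprS; move: (mu n)^-1 (qC ^+ n) => m Q.
  have := mulfV q0; move: (qC^-1) => p e; ring: e.
Qed.

End Sum.

Section Admissible.
Variables (F : pop K K) (E D0 : set K).
Hypotheses (sE : subspace E) (sD0 : subspace D0).
Hypothesis hE : forall x, E x -> [/\ pi c x = 0, E (pi a x) & E (pi d x)].
Hypothesis hD0 : forall x, D0 x -> [/\ pi a x = 0, D0 (pi b x) & D0 (pi c x)].
Local Notation D := (core_domain pi E D0).
Hypotheses (F_symm : symmetric_op F) (D_core : is_core D F) (D_dense : hdense D).
Hypothesis rel : forall x, D x -> op_relations (hq := hq) pi F x.

Let D_dom : D `<=` dom F. Proof. by case: D_core. Qed.
Let F_lin k x y : D x -> D y -> F (k *: x + y) = k *: F x + F y.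
Proof. by move=> /D_dom Fx /D_dom Fy; case: F_symm => -[_ +] _; apply. Qed.
Let F_sym x y : D x -> D y -> '[F x, y] = '[x, F y].
Proof. by move=> /D_dom Fx /D_dom Fy; case: F_symm => _; apply. Qed.

Let D0_H : set H0 := [set x | D0 (j x)].
Let E_G : set G := [set x | E (i x)].

Let E_im : [set i x | x in E_G] = E.
Proof.
apply/seteqP; split=> [_ [x Ex <-] //|x Ex]; have [cx _ _] := hE Ex.
by exists (pG x); rewrite /E_G /= pGK.
Qed.
Let D0_im : [set h_ 0 x | x in D0_H] = D0.
Proof.
have h0 x : h_ 0 x = j x by rewrite /h_ shell_norm0 invr1 scale1r.
apply/seteqP; split=> [_ [x Dx <-]|x Dx]; first by rewrite h0.
by have [ax _ _] := hD0 Dx; exists (pH x); rewrite ?h0 /D0_H /= pHK.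
Qed.

(* Projecting a vector of the core to ker pi(a) or ker pi(c) gives a vector of [D0]
   or [E], because shells are orthogonal to each other and to ker pi(c).  Density of
   [D0] and [E] then follows by projecting approximations. *)
Let D_split y : D y -> exists e x, [/\ E e, D0 x,
  forall u, pi c u = 0 -> '[u, y - e] = 0 & forall u, pi a u = 0 -> '[u, y - x] = 0].
Proof.
move: y; apply: (core_ind hpi sE) => [k u v Du Dv|e Ee|n x Dx].
- move=> [e [x [Ee Dx oe ox]]] [e' [x' [Ee' Dx' oe' ox']]].
  exists (k *: e + e'), (k *: x + x'); split; [exact: sE.2|exact: sD0.2| |].
    move=> z cz; have -> : k *: u + v - (k *: e + e') = k *: (u - e) + (v - e') by lmod.
    by rewrite innerDr innerZr oe // oe' // mulr0 addr0.
  move=> z az; have -> : k *: u + v - (k *: x + x') = k *: (u - x) + (v - x') by lmod.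
  by rewrite innerDr innerZr ox // ox' // mulr0 addr0.
- exists e, 0; split=> //; first exact: sD0.1.
    by move=> u _; rewrite subrr inner0r.
  move=> u au; rewrite subr0 innerC -[u](shell0 pi) (ker_c_shell_orth hpi) ?rmorph0 //.
  by have [] := hE Ee.
- have [ax _ _] := hD0 Dx; case: n => [|n].
    exists 0, x; split=> //; first exact: sE.1.
      by move=> u cu; rewrite subr0 (ker_c_shell_orth hpi).
    by move=> u _; rewrite shell0 subrr inner0r.
  exists 0, 0; split; [exact: sE.1|exact: sD0.1| |].
    by move=> u cu; rewrite subr0 (ker_c_shell_orth hpi).
  by move=> u au; rewrite subr0 -[u](shell0 pi) (shell_orth hpi).
Qed.

Let E_G_dense : hdense E_G.
Proof.
move=> x e e0; have [y [/D_split[z [_ [Ez _ oz _]]] xy]] := D_dense (i x) e0.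
have [cz _ _] := hE Ez; exists (pG z); split; first by rewrite /E_G /= pGK.
apply: le_lt_trans xy; rewrite -[X in X <= _]/(hnorm (i (x - pG z))).
rewrite (lin_sub i_lin) pGK //.
have -> : i x - y = (i x - z) - (y - z) by lmod.
by apply/hnorm_orth_le/oz; rewrite lE i_ker lE cz subr0.
Qed.
Let D0_H_dense : hdense D0_H.
Proof.
move=> x e e0; have [y [/D_split[_ [z [_ Dz _ oz]]] xy]] := D_dense (j x) e0.
have [az _ _] := hD0 Dz; exists (pH z); split; first by rewrite /D0_H /= pHK.
apply: le_lt_trans xy; rewrite -[X in X <= _]/(hnorm (j (x - pH z))).
rewrite (lin_sub j_lin) pHK //.
have -> : j x - y = (j x - z) - (y - z) by lmod.
by apply/hnorm_orth_le/oz; rewrite lE j_ker lE az subr0.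
Qed.

Let sum_is_dense : hdense [set i x + y | x in setT
    & y in lin [set z | exists n x, z = h_ n x]].
Proof.
move=> x e e0; have [_ [[u Eu [z zl <-]] xz]] := D_dense x e0.
have [cu _ _] := hE Eu.
exists (u + z); split=> //; exists (pG u) => //; rewrite pGK //; exists z => //.
apply: lin_sub_lin zl => _ [n [eta [Deta ->]]]; have [aeta _ _] := hD0 Deta.
rewrite -(shellE hpi) -[eta]pHK // shell_normed.
by apply: (subspaceZ (lin_subspace _)); apply: sub_lin; exists n, (pH eta).
Qed.

Local Notation S := (rep_sum sum_is_dense).
Let mr : model_rep S v w pi. Proof. exact: rep_sum_model. Qed.

Let D0_w x : D0_H x -> D0_H (w x).
Proof. by move=> /hD0[_ _]; rewrite /D0_H /= wE. Qed.
Let D0_w' x : D0_H x -> D0_H (w' x).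
Proof. by move=> /hD0[_ + _]; rewrite /D0_H /= w'E; exact: subspaceZ. Qed.
Let E_v x : E_G x -> E_G (v x).
Proof. by move=> /hE[_ + _]; rewrite /E_G /= vE. Qed.
Let E_v' x : E_G x -> E_G (v' x).
Proof. by move=> /hE[_ _]; rewrite /E_G /= v'E. Qed.
Let im_w : w @` D0_H = D0_H.
Proof.
apply/seteqP; split=> [_ [x Dx <-]|x Dx]; first exact: D0_w.
by exists (w' x); [exact: D0_w' | exact: (unitary_adj ker_a_unitaryP)].
Qed.
Let im_v : v @` E_G = E_G.
Proof.
apply/seteqP; split=> [_ [x Ex <-]|x Ex]; first exact: E_v.
by exists (v' x); [exact: E_v' | exact: (unitary_adj ker_c_unitaryP)].
Qed.
Let sD0_H : subspace D0_H.
Proof. by split=> [|k x y Dx Dy]; [exact: sD0.1 | exact: sD0.2]. Qed.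
Let sE_G : subspace E_G.
Proof. by split=> [|k x y Ex Ey]; [exact: sE.1 | exact: sE.2]. Qed.

(* Linearity of T and R comes from their having adjoints on a dense subspace. *)
Let linear_of_adjoint (H : hilbert R) (X : set H) (B B' : H -> H) : subspace X ->
  hdense X -> (forall x y, X x -> X y -> '[B x, y] = '[x, B' y]) ->
  forall k x y, X x -> X y -> B (k *: x + y) = k *: B x + B y.
Proof.
move=> sX dX e k x y Xx Xy; apply: (hdense_eq dX) => z Xz.
have eB u : X u -> '[z, B u] = '[B' z, u].
  by move=> Xu; rewrite innerC e // -innerC.
by rewrite innerDr innerZr !eB ?innerDr ?innerZr //; exact: sX.2.
Qed.

Section WithForm.
Variables (T U P : K -> K) (Rn : nat -> K -> K).
Hypothesis form : op_form pi F E D0 T U P Rn.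

Let TH := Pop D0_H (fun x => pH (T (j x))).
Let RH := Pop D0_H (fun x => pH (Rn 0 (j x))).
Let QG := Pop E_G (fun x => pG (F (i x))).

Let TE x : D0_H x -> j (TH x) = T (j x).
Proof. by move=> /(form_T form)[aT _ _]; rewrite /= pHK. Qed.
Let RE x : D0_H x -> j (RH x) = Rn 0 (j x).
Proof. by move=> /(form_R form 0)[aR _ _ _]; rewrite /= pHK. Qed.
Let QE x : E_G x -> i (QG x) = F (i x).
Proof. by move=> /(form_E form)[cF _]; rewrite /= pGK. Qed.

Let adj x y : D0_H x -> D0_H y ->
  '[T (j x), j y] = '[j x, U (j y)] /\ '[Rn 0 (j x), j y] = '[j x, Rn 0 (j y)].
Proof. by move=> Dx Dy; exact: (form_adjoint hpi sE hD0 form F_sym). Qed.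

Let U_adj y : D0_H y -> adj_set TH y (pH (U (j y))).
Proof.
move=> Dy x Dx; have [aU _ _] := form_U form Dy.
rewrite -[LHS]/('[j (TH x), j y]) TE // -[RHS]/('[j x, j (pH (U (j y)))]) pHK //.
by have [] := adj Dx Dy.
Qed.
Let UE y : D0_H y -> j (adjoint TH y) = U (j y).
Proof.
move=> Dy; rewrite (adjoint_unique (T := TH) D0_H_dense (U_adj Dy)) pHK //.
by have [] := form_U form Dy.
Qed.

Let RH_sym x y : D0_H x -> D0_H y -> '[RH x, y] = '[x, RH y].
Proof.
move=> Dx Dy; rewrite -[LHS]/('[j (RH x), j y]) -[RHS]/('[j x, j (RH y)]) !RE //.
by have [] := adj Dx Dy.
Qed.

(* [form_R] at the vector w' x, on which [c] gives back x. *)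
Let iter_R n x : D0_H x -> j (iter n w (RH (iter n w' x))) = Rn n (j x).
Proof.
elim: n x => [|n IH] x Dx; first exact: RE.
rewrite iterS iterSr wE IH; last exact: D0_w'.
have [_ _ _ <-] := form_R form n (D0_w' Dx).
by rewrite w'E c_b.
Qed.

Lemma backward_data_a : data_a q w TH RH D0_H.
Proof.
split=> //.
- split=> // k x y Dx Dy.
  apply: (linear_of_adjoint (X := D0_H) (B := TH) (B' := pH \o U \o j)) Dy => //.
  by move=> x' y' Dx' Dy'; exact: (U_adj Dy' Dx').
- split=> //; split=> // k x y Dx Dy.
  exact: (linear_of_adjoint (X := D0_H) (B := RH) (B' := RH)).
- split=> // x Dx; split=> //; split=> //.
  by exists (pH (U (j x))); exact: U_adj.
move=> x Dx; split; apply: j_inj.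
  rewrite wE TE; last exact: D0_w'.
  have [_ _ e] := form_T form (D0_w' Dx).
  move: e; rewrite {1}w'E c_b // => e.
  by rewrite (lin_scale j_lin) TE // e scalerA mulfV // scale1r.
rewrite -[w (w (RH _))]/(iter 2 w (RH (iter 2 w' x))).
rewrite -[w (RH _)]/(iter 1 w (RH (iter 1 w' x))) -[RH x]/(iter 0 w (RH (iter 0 w' x))).
rewrite (lin_add j_lin) !(lin_scale j_lin) !iter_R //.
have [_ -> _ _] := form_R form 1 Dx; have [_ -> _ _] := form_R form 0 Dx.
by rewrite expr0 expr1n expr1; lmod.
Qed.

Lemma backward_data_b : data_b q v QG E_G.
Proof.
have Q_sym x y : E_G x -> E_G y -> '[QG x, y] = '[x, QG y].
  move=> Ex Ey; rewrite -[LHS]/('[i (QG x), i y]) -[RHS]/('[i x, i (QG y)]) !QE //.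
  by apply: F_sym; exact: core_E.
split=> //.
  split=> //; split=> // k x y Ex Ey.
  exact: (linear_of_adjoint (X := E_G) (B := QG) (B' := QG)).
move=> x Ex; apply: i_inj; have Ex' := E_v' Ex.
rewrite (lin_add i_lin) !(lin_scale i_lin) !vE !QE // ?v'E //; last exact: E_v'.
have [cF _] := form_E form Ex; have [_ ] := form_E form Ex'.
rewrite !v'E (ker_c_ad hpi) // => /(congr1 (pi a)).
by rewrite !lE (ker_c_ad hpi) // => <-.
Qed.

Lemma backward_data_c : data_c q S w TH RH D0_H QG E_G F.
Proof.
split.
- by case: F_symm.
- rewrite -(model_core _ _ mr) -[inG S]/i -[inH S 0]/(h_ 0).
  by rewrite E_im D0_im.
- move=> x n Dx; have [aT _ _] := form_T form Dx.
  have Df : D (f n (j x)) by exact: core_shell.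
  have sub := core_subspace pi D0 sE.
  have FZ k y : D y -> F (k *: y) = k *: F y.
    move=> Dy; have := F_lin k Dy sub.1; rewrite addr0 => ->.
    by have := F_lin (-1) sub.1 sub.1; rewrite scaler0 addr0 scaleN1r addNr => ->;
      rewrite addr0.
  rewrite -[inH S n x]/(h_ n x) {1}/h_ FZ // (form_shell form) //.
  rewrite -[inH S n.+1 _]/(h_ n.+1 (adjoint TH x)).
  rewrite -[inH S n _]/(h_ n (iter n w (RH (iter n w' x)))).
  rewrite /h_ iter_R // UE // !scalerDr; congr (_ + _ + _).
    case: n {Df} => [|n].
      by rewrite lambda0 // expr0 expr1n subrr !scale0r scaler0.
    rewrite -[inHp S n.+1 _]/(h_ n (TH x)) /h_ TE // -(lambda_sqr hq) !scalerA /=.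
    congr (_ *: _); have := lambdaS_neq0 hq n => l0.
    by rewrite shell_normS invfM expr2 mulrACA mulVf // mul1r mulrC.
  rewrite shell_normS scalerA; congr (_ *: _).
  by rewrite invfM mulrA mulfV ?mul1r // lambdaS_neq0.
- by move=> x Ex; rewrite -[inG S x]/(i x) -[RHS]/(i (QG x)) QE.
Qed.

End WithForm.

(** The density of the core domain makes the kernels of pi(c) and pi(a) generate the
    whole space, so the classification of representations needs no spectral theory. *)
Lemma backward_model : exists (K1 K2 : hilbert R) (S : hilbert_sum K1 K2 K),
  model_pair S pi F.
Proof.
have [T [U [P [Rn form]]]] := op_form_of_relations hpi sE hE hD0 F_lin rel.
exists G, H0, S, v, w; do 2 eexists; exists D0_H; eexists; exists E_G; split.
- exact: mr.
- exact: backward_data_a form.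
- exact: backward_data_b form.
- exact: backward_data_c form.
Qed.

End Admissible.

End Backward.

Theorem theorem1 (R : realType) (q : R) (hq : 0 < q < 1)
    (Gam : star_fodc (SUq2 hq)) (hGam : is_3D Gam) :
  (forall (G H0 K : hilbert R) (S : hilbert_sum G H0 K)
      (pi : SUq2 hq -> K -> K) (F : pop K K),
      model_pair S pi F -> admissible_comm_rep Gam pi F) /\
  (forall (K : hilbert R) (pi : SUq2 hq -> K -> K) (F : pop K K),
      admissible_comm_rep Gam pi F ->
      exists (G H0 K' : hilbert R) (S : hilbert_sum G H0 K')
        (pi' : SUq2 hq -> K' -> K') (F' : pop K' K'),
        model_pair S pi' F' /\ unitarily_equivalent pi F pi' F').
Proof.
split=> [G H0 K S pi F [v [w [T [Rop [D0 [Q [E [mr da db dc]]]]]]]]|].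
  exact: (model_admissible mr da db dc).
move=> K pi F [E [D0 [sE sD0 hE hD0 [core [h [rho hrho]]]]]].
have hpi := cs_rep h.
have stable x v : core_domain pi E D0 v -> core_domain pi E D0 (pi x v).
  exact: core_stable.
have rel := relations_of_star_hom hGam hrho.
have oprel v : core_domain pi E D0 v -> op_relations (hq := hq) pi F v.
  exact: (op_relationsP h stable).1 rel v.
have [K1 [K2 [S mp]]] :=
  backward_model hpi sE sD0 hE hD0 (cs_sym h) core (cs_dense h) oprel.
exists K1, K2, K, S, pi, F; split=> //.
by exists id; split=> //; split=> // y; exists y.
Qed.
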